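(* For every constant $\lambda \ge 0$ there are constants $f_\lambda > 0$ and $n_0$ such that for all integers $m,n \ge n_0$ the following holds. Let $G$ be the $m\times n$ grid graph and let $P$ be a random 2-partition of $V(G)$ drawn from the $\lambda$-smooth spanning tree distribution on $G$, i.e. $\Pr[P] \propto \mathrm{sp}(P)\, e^{-\lambda\cdot \mathrm{imb}(P)}$. Then for every edge $\{u,v\}\in E(G)$, the probability that $u$ and $v$ lie in the same part of $P$ is at least $f_\lambda$. That is, this distribution is $f_\lambda$-fair.
   Context: The $m\times n$ grid graph has vertex set $\{(i,j): 1\le i\le m,\ 1\le j\le n\}$. Two vertices are adjacent iff their coordinates differ by exactly $1$ in one coordinate and agree in the other. A 2-partition of a graph $G$ is an unordered pair $(S,T)$ of nonempty disjoint vertex sets with $S\cup T=V(G)$. For a graph $H$, $\mathrm{sp}(H)$ denotes the number of spanning trees of $H$. For a 2-partition $P=(S,T)$, the spanning tree score is $\mathrm{sp}(P)=\mathrm{sp}(G[S])\cdot\mathrm{sp}(G[T])$; this is nonzero iff both parts induce connected subgraphs. The imbalance is $\mathrm{imb}(P)=\big||S|-|T|\big|/2$. A distribution over 2-partitions is $\alpha$-fair if every pair of adjacent vertices is assigned to the same part with probability at least $\alpha$. *)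

(* Defs.v *)
From mathcomp Require Import all_boot all_order all_algebra.
From mathcomp Require Import boolp reals sequences.

Set Implicit Arguments.
Unset Strict Implicit.
Unset Printing Implicit Defensive.

Import Order.TTheory GRing.Theory Num.Theory.
Local Open Scope ring_scope.

(* A finite simple graph is given by a set of vertices V : {set T} and a set of
   edges E : {set {set T}}, each edge being an unordered pair [set x; y]. *)
Section Graphs.
Variable T : finType.
Implicit Types (V S : {set T}) (E F : {set {set T}}).

Definition edge_rel E : rel T := fun x y => [set x; y] \in E.

Definition connected_graph V E : Prop :=
  V != set0 /\ {in V &, forall x y, connect (edge_rel E) x y}.

Definition acyclic_graph E : Prop :=
  ~ exists c : seq T, (3 <= size c)%N /\ ucycle (edge_rel E) c.

(* F is the edge set of a spanning tree of the graph (V, E). *)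
Definition spanning_tree V E F : Prop :=
  [/\ F \subset E, connected_graph V F & acyclic_graph F].

Definition sp V E : nat :=
  #|[set F : {set {set T}} | `[< spanning_tree V E F >] ]|.

Definition induced_edges E S : {set {set T}} := [set e in E | e \subset S].

End Graphs.

Section Partitions.
Variables (R : realType) (T : finType).
Implicit Types (E P : {set {set T}}).

(* An unordered pair {S, S'} is the two-element set P = [set S; S'];
   partition requires the blocks to be nonempty, disjoint and covering. *)
Definition two_partitions : {set {set {set T}}} :=
  [set P | partition P [set: T] & #|P| == 2].

Definition sp_score E P : nat := (\prod_(S in P) sp S (induced_edges E S))%N.

(* As P is unordered, the maximum ranges over both orderings of its two blocks
   (and over the pairs (S, S), which contribute 0); see imbE. *)
Definition imb P : R :=
  (\max_(S in P) \max_(S' in P) `|#|S| - #|S'| |)%N%:R / 2.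

Definition smooth_weight E (lambda : R) P : R :=
  (sp_score E P)%:R * expR (- (lambda * imb P)).

Definition smooth_distribution E (lambda : R) P : R :=
  smooth_weight E lambda P
    / \sum_(Q in two_partitions) smooth_weight E lambda Q.

Definition same_part P (u v : T) : bool :=
  [exists S in P, (u \in S) && (v \in S)].

(* mu is the probability mass function of a distribution on two_partitions. *)
Definition fair E (mu : {set {set T}} -> R) (alpha : R) : Prop :=
  forall u v : T, [set u; v] \in E ->
    alpha <= \sum_(P in two_partitions | same_part P u v) mu P.

Lemma two_partitionsP P :
  reflect (exists S S' : {set T},
             [/\ S != set0, S' != set0, [disjoint S & S'],
                 S :|: S' = [set: T] & P = [set S; S']])
          (P \in two_partitions).
Proof.
rewrite inE; apply: (iffP andP) => [[/and3P[/eqP cP tP P0]]|].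
  move=> /cards2P[S [S' [SS' PE]]]; exists S, S'.
  move: cP tP P0; rewrite PE => cP /trivIsetP tP.
  rewrite !inE negb_or ![set0 == _]eq_sym => /andP[S0 S'0]; split => //.
    by apply: tP; rewrite ?inE ?eqxx ?orbT.
  by rewrite -cP /cover big_setU1 ?inE //= big_set1.
move=> [S [S' [S0 S'0 dS US ->]]].
have SS' : S != S'.
  apply: contraNneq S0 => SS'; move: dS.
  by rewrite -SS' -setI_eq0 setIid.
split; last by rewrite cards2 SS'.
apply/and3P; split.
- by rewrite /cover big_setU1 ?inE //= big_set1 US.
- apply/trivIsetP => A B; rewrite !inE.
  move=> /orP[] /eqP-> /orP[] /eqP->; rewrite ?eqxx //.
  by rewrite disjoint_sym.
- by rewrite !inE negb_or ![set0 == _]eq_sym S0.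
Qed.

Lemma sp_scoreE E (S S' : {set T}) : S != S' ->
  sp_score E [set S; S'] =
    (sp S (induced_edges E S) * sp S' (induced_edges E S'))%N.
Proof. by move=> SS'; rewrite /sp_score big_setU1 ?inE //= big_set1. Qed.

Lemma imbE (S S' : {set T}) : S != S' ->
  imb [set S; S'] = `|#|S|%:R - #|S'|%:R| / 2.
Proof.
move=> SS'; rewrite /imb.
do 3 rewrite big_setU1 ?inE //= big_set1.
rewrite !distnn max0n maxn0 [`|#|S'| - _|%N]distnC maxnn.
by rewrite natr_absz intr_norm rmorphB.
Qed.

End Partitions.

Section Grid.
Variables m n : nat.

Definition grid_adj (u v : 'I_m * 'I_n) : bool :=
  ((u.1 == v.1) && ((u.2.+1 == v.2 :> nat) || (v.2.+1 == u.2 :> nat)))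
  || ((u.2 == v.2) && ((u.1.+1 == v.1 :> nat) || (v.1.+1 == u.1 :> nat))).

Definition grid_edges : {set {set 'I_m * 'I_n}} :=
  [set e | [exists u, exists v, grid_adj u v && (e == [set u; v])]].

End Grid.

(* Main.v *)
(* A pair of spanning trees of the two parts is a two-component spanning forest.
   If the edge uv is separated, the forest can be modified within bounded
   distance of uv so that u and v end up in the same part: the part sizes change
   by a bounded amount and boundedly many forests share the same image, hence
   the separated forests weigh at most a constant times the other ones.

   To find the modification it suffices to relabel vertices in a window such that
   both parts stay connected through the tree edges outside the window and all
   grid edges inside it; any acyclic edge set then extends to spanning trees.
   Two moves are used.  A vertex may change sides if its neighbours in its own
   part are joined to each other elsewhere.  Two small sets V and P on different
   sides may be exchanged if P joins the two pieces into which V cuts its part: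
   by the Jordan curve theorem P then separates exactly the vertices that V
   joins.  A finite case distinction shows that as long as uv is separated, some
   sequence of moves either unites u and v or decreases the number of vertices of
   v's side in the window. *)
From Stdlib Require Import ZArith NArith List Lia Bool.

Module Lattice.

Import ListNotations.
Local Open Scope Z_scope.

Definition cell := (Z * Z)%type.

Definition adjc (p q : cell) : Prop :=
  (fst p = fst q /\ (snd q = snd p + 1 \/ snd p = snd q + 1)) \/
  (snd p = snd q /\ (fst q = fst p + 1 \/ fst p = fst q + 1)).

Definition ceqb (p q : cell) : bool := (fst p =? fst q) && (snd p =? snd q).

Definition adjb (p q : cell) : bool :=
  ((fst p =? fst q) && ((snd q =? snd p + 1) || (snd p =? snd q + 1))) ||
  ((snd p =? snd q) && ((fst q =? fst p + 1) || (fst p =? fst q + 1))).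

Lemma ceqbP p q : reflect (p = q) (ceqb p q).
Proof.
destruct p as [a b], q as [c d]; unfold ceqb; simpl.
destruct (Z.eqb_spec a c), (Z.eqb_spec b d); simpl; constructor; congruence.
Qed.

Lemma adjbP p q : adjb p q = true -> adjc p q.
Proof.
unfold adjb, adjc; rewrite !orb_true_iff, !andb_true_iff, !orb_true_iff, !Z.eqb_eq.
tauto.
Qed.

Lemma adjc_sym p q : adjc p q -> adjc q p.
Proof. unfold adjc; intuition. Qed.

(** * Winding parity of closed lattice walks *)

Fixpoint wsum (f : cell -> cell -> bool) (p : cell) (l : list cell) : bool :=
  match l with
  | [] => false
  | q :: l' => xorb (f p q) (wsum f q l')
  end.

Fixpoint chain (p : cell) (l : list cell) : Prop :=
  match l with
  | [] => True
  | q :: l' => adjc p q /\ chain q l'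
  end.

Fixpoint chainb (p : cell) (l : list cell) : bool :=
  match l with
  | [] => true
  | q :: l' => adjb p q && chainb q l'
  end.

Lemma chainbP p l : chainb p l = true -> chain p l.
Proof.
revert p; induction l as [|q l IH]; simpl; intros p; [easy|].
rewrite andb_true_iff; intros [H1 H2]; split; [now apply adjbP|now apply IH].
Qed.

(* The step [p, q] crosses the upward ray starting at [b + (1/2, 1/2)]. *)
Definition ray_step (b p q : cell) : bool :=
  (snd p =? snd q) && (Z.min (fst p) (fst q) =? fst b) && (snd b <? snd p).

Definition is_edge (e1 e2 p q : cell) : bool :=
  (ceqb p e1 && ceqb q e2) || (ceqb p e2 && ceqb q e1).

(* Moving the base point of the ray from [b] to an adjacent [b'] sweeps over
   one edge of the lattice, which contains the cell [key b b']. *)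
Definition key (b b' : cell) : cell :=
  if fst b =? fst b' then (fst b, Z.max (snd b) (snd b'))
  else (Z.max (fst b) (fst b'), snd b).

Definition key' (b b' : cell) : cell :=
  if fst b =? fst b' then (fst b + 1, Z.max (snd b) (snd b'))
  else (Z.max (fst b) (fst b'), snd b + 1).

Definition swept (b b' : cell) : cell -> cell -> bool :=
  is_edge (key b b') (key' b b').

Ltac zcases :=
  repeat match goal with
  | |- context [Z.eqb ?a ?b] => destruct (Z.eqb_spec a b)
  | |- context [Z.ltb ?a ?b] => destruct (Z.ltb_spec a b)
  end; simpl; try reflexivity; exfalso; lia.

Definition above (b c : cell) : bool := (fst c =? fst b) && (snd b <? snd c).

Lemma ray_step_vertical x y p q : adjc p q ->
  xorb (ray_step (x, y) p q) (ray_step (x, y - 1) p q) =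
  is_edge (x, y) (x + 1, y) p q.
Proof.
destruct p as [a b], q as [c d]; unfold adjc, ray_step, is_edge, ceqb; simpl.
intros [[-> [-> | ->]]|[-> [-> | ->]]]; zcases.
Qed.

Lemma ray_step_horizontal x y p q : adjc p q ->
  xorb (ray_step (x, y) p q) (ray_step (x + 1, y) p q) =
  xorb (is_edge (x + 1, y) (x + 1, y + 1) p q)
       (xorb (above (x + 1, y) p) (above (x + 1, y) q)).
Proof.
destruct p as [a b], q as [c d]; unfold adjc, ray_step, is_edge, ceqb, above; simpl.
intros [[-> [-> | ->]]|[-> [-> | ->]]]; zcases.
Qed.

Lemma wsum_eq f g p l : chain p l ->
  (forall q r, adjc q r -> f q r = g q r) -> wsum f p l = wsum g p l.
Proof.
intros Hc H; revert p Hc; induction l as [|q l IH]; simpl; intros p Hc; [easy|].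
now destruct Hc as [H1 H2]; rewrite (H p q H1), (IH q H2).
Qed.

Lemma wsum_xor f g p l :
  wsum (fun q r => xorb (f q r) (g q r)) p l = xorb (wsum f p l) (wsum g p l).
Proof.
revert p; induction l as [|q l IH]; simpl; intros p; [reflexivity|].
rewrite IH; now destruct (f p q), (g p q), (wsum f q l), (wsum g q l).
Qed.

Lemma last_cons (q : cell) l p : last (q :: l) p = last l q.
Proof.
revert q; induction l as [|r l IH]; intros q; [easy|].
destruct l; [easy|apply IH].
Qed.

Lemma wsum_telescope h p l :
  wsum (fun q r => xorb (h q) (h r)) p l = xorb (h p) (h (last l p)).
Proof.
revert p; induction l as [|q l IH]; intros p; [now simpl; destruct (h p)|].
rewrite last_cons; cbn [wsum]; rewrite IH.
now destruct (h p), (h q), (h (last l q)).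
Qed.

Lemma last_app (l1 l2 : list cell) p : last (l1 ++ l2) p = last l2 (last l1 p).
Proof.
revert p; induction l1 as [|q l1 IH]; intros p; [easy|].
rewrite <- app_comm_cons, !last_cons; apply IH.
Qed.

Lemma wsum_app f p l1 l2 :
  wsum f p (l1 ++ l2) = xorb (wsum f p l1) (wsum f (last l1 p) l2).
Proof.
revert p; induction l1 as [|q l1 IH]; intros p; [now destruct (wsum f p l2)|].
rewrite <- app_comm_cons, last_cons; cbn [wsum]; rewrite IH.
destruct (f p q), (wsum f q l1), (wsum f (last l1 q) l2); easy.
Qed.

Lemma chain_app p l1 l2 :
  chain p l1 -> chain (last l1 p) l2 -> chain p (l1 ++ l2).
Proof.
revert p; induction l1 as [|q l1 IH]; intros p; [easy|].
rewrite last_cons; simpl; intuition.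
Qed.

Lemma wsum_edge_absent e1 e2 p l :
  ~ In e1 (p :: l) -> wsum (is_edge e1 e2) p l = false.
Proof.
revert p; induction l as [|q l IH]; intros p Hn; [easy|]; simpl.
rewrite IH by (intros H; apply Hn; now right); unfold is_edge.
destruct (ceqbP p e1) as [->|_]; [destruct Hn; now left|].
destruct (ceqbP q e1) as [->|_]; [destruct Hn; right; now left|].
simpl; now rewrite andb_false_r.
Qed.

Definition wind (p : cell) (l : list cell) (b : cell) : bool := wsum (ray_step b) p l.

Lemma wind_adjc p l b b' : chain p l -> last l p = p -> adjc b b' ->
  xorb (wind p l b) (wind p l b') = wsum (swept b b') p l.
Proof.
intros Hc Hl.
assert (V : forall x y, xorb (wind p l (x, y)) (wind p l (x, y - 1)) =
                        wsum (is_edge (x, y) (x + 1, y)) p l).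
{ intros x y; unfold wind; rewrite <- wsum_xor.
  now apply wsum_eq; [|intros; apply ray_step_vertical]. }
assert (Hz : forall x y, xorb (wind p l (x, y)) (wind p l (x + 1, y)) =
                        wsum (is_edge (x + 1, y) (x + 1, y + 1)) p l).
{ intros x y; unfold wind; rewrite <- wsum_xor.
  rewrite (wsum_eq _ _ _ _ Hc (fun q r => ray_step_horizontal x y q r)).
  rewrite (wsum_xor (is_edge (x + 1, y) (x + 1, y + 1))), wsum_telescope, Hl.
  now rewrite xorb_nilpotent, xorb_false_r. }
destruct b as [x y], b' as [x' y']; unfold adjc, swept, key, key'; simpl.
intros [[-> [-> | ->]]|[-> [-> | ->]]].
- rewrite Z.eqb_refl, Z.max_r by lia; rewrite xorb_comm, <- V.
  now replace (y + 1 - 1) with y by lia.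
- rewrite Z.eqb_refl, Z.max_l by lia; rewrite <- V.
  now replace (y' + 1 - 1) with y' by lia.
- destruct (Z.eqb_spec x (x + 1)); [lia|]; rewrite Z.max_r by lia; apply Hz.
- destruct (Z.eqb_spec (x' + 1) x'); [lia|]; rewrite Z.max_l by lia.
  rewrite xorb_comm; apply Hz.
Qed.

(* The intersection parity of the walk [p :: l] with the walk [b :: r], the
   latter being pushed slightly up and to the right. *)
Definition crossing (p : cell) (l : list cell) (b : cell) (r : list cell) : bool :=
  wsum (fun c c' => wsum (swept c c') p l) b r.

Lemma wind_chain p l b r : chain p l -> last l p = p -> chain b r ->
  xorb (wind p l b) (wind p l (last r b)) = crossing p l b r.
Proof.
intros Hc Hl; revert b; induction r as [|b' r IH]; intros b Hr.
  now simpl; rewrite xorb_nilpotent.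
destruct Hr as [H1 H2]; rewrite last_cons; unfold crossing; cbn [wsum].
fold (crossing p l b' r); rewrite <- IH by easy.
rewrite <- (wind_adjc _ _ _ _ Hc Hl H1).
destruct (wind p l b), (wind p l b'), (wind p l (last r b')); easy.
Qed.

Fixpoint keys (b : cell) (r : list cell) : list cell :=
  match r with [] => [] | b' :: r' => key b b' :: keys b' r' end.

Lemma keys_in b r : chain b r -> incl (keys b r) (b :: r).
Proof.
revert b; induction r as [|b' r IH]; intros b; simpl; [easy|].
intros [H1 H2] c [<-|Hc]; [|right; now apply IH].
destruct b as [x y], b' as [x' y']; unfold key, adjc in *; simpl in *.
destruct (Z.eqb_spec x x') as [->|]; destruct H1 as [[? [?|?]]|[? [?|?]]]; subst; try lia.
- right; left; f_equal; lia.
- left; f_equal; lia.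
- right; left; f_equal; lia.
- left; f_equal; lia.
Qed.

Lemma crossing_absent p l b r : (forall c, In c (keys b r) -> ~ In c (p :: l)) ->
  crossing p l b r = false.
Proof.
revert b; induction r as [|b' r IH]; intros b H; [easy|].
unfold crossing; cbn [wsum]; fold (crossing p l b' r).
rewrite IH by (intros c Hc; apply H; now right).
now unfold swept; rewrite wsum_edge_absent by (apply H; now left).
Qed.

Lemma crossing_app p l1 l2 b r :
  crossing p (l1 ++ l2) b r =
  xorb (crossing p l1 b r) (crossing (last l1 p) l2 b r).
Proof.
revert b; induction r as [|b' r IH]; intros b; [easy|].
unfold crossing; cbn [wsum]; fold (crossing p (l1 ++ l2) b' r) (crossing p l1 b' r)
  (crossing (last l1 p) l2 b' r); rewrite IH, wsum_app.
destruct (wsum (swept b b') p l1), (wsum (swept b b') (last l1 p) l2),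
  (crossing p l1 b' r), (crossing (last l1 p) l2 b' r); easy.
Qed.

(* Discrete Jordan curve theorem: a walk [b :: k] avoiding the closed walk
   [a :: l1 ++ l2] has the same endpoints as [b :: r], hence [b :: r] meets the
   closed walk evenly, and it can do so only along the part [l2]. *)
Lemma jordan a l1 l2 b r k :
  chain a l1 -> chain (last l1 a) l2 -> last l2 (last l1 a) = a ->
  chain b r -> chain b k -> last r b = last k b ->
  (forall c, In c (keys b r) -> ~ In c (a :: l1)) ->
  (forall c, In c (b :: k) -> ~ In c (a :: l1 ++ l2)) ->
  crossing (last l1 a) l2 b r = false.
Proof.
intros H1 H2 Hl Hr Hk E Hkr Hkk.
assert (Hc := chain_app _ _ _ H1 H2).
assert (Hlast : last (l1 ++ l2) a = a) by now rewrite last_app.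
assert (X := wind_chain _ _ _ _ Hc Hlast Hr).
assert (Y := wind_chain _ _ _ _ Hc Hlast Hk).
rewrite E, Y, crossing_absent, crossing_app, crossing_absent in X by
  (try exact Hkr; intros c Hi; apply Hkk, keys_in; assumption).
now destruct (crossing (last l1 a) l2 b r).
Qed.

(** * Connectivity inside a set of cells *)

Section Connectivity.
Variable H : cell -> cell -> Prop.
Hypothesis Hsym : forall p q, H p q -> H q p.
Hypothesis Hadj : forall p q, H p q -> adjc p q.

Inductive conn (S : cell -> Prop) (p : cell) : cell -> Prop :=
| conn_refl : S p -> conn S p p
| conn_step q r : conn S p q -> H q r -> S r -> conn S p r.

Lemma conn_r S p q : conn S p q -> S q.
Proof. now destruct 1. Qed.

Lemma conn_trans S p q r : conn S p q -> conn S q r -> conn S p r.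
Proof. induction 2; [easy|econstructor; eassumption]. Qed.

Lemma conn_edge (S : cell -> Prop) p q : S p -> S q -> H p q -> conn S p q.
Proof. intros; econstructor; [now constructor|eassumption|easy]. Qed.

Lemma conn_sym S p q : conn S p q -> conn S q p.
Proof.
induction 1 as [|q r C IH E Sr]; [now constructor|].
eapply conn_trans; [apply (conn_edge S r q)|exact IH]; auto.
now apply conn_r in C.
Qed.

Lemma conn_mono (S S' : cell -> Prop) p q :
  (forall c, S c -> S' c) -> conn S p q -> conn S' p q.
Proof. intros M; induction 1; [constructor; auto|econstructor; eauto]. Qed.

Lemma conn_walk S p q : conn S p q ->
  exists l, chain p l /\ last l p = q /\ forall c, In c (p :: l) -> S c.
Proof.
induction 1 as [Sp|q r C (l & L1 & L2 & L3) E Sr].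
- exists []; split; [|split]; simpl; try easy; now intros c [<-|[]].
- exists (l ++ [r]); split; [|split].
  + apply chain_app; [easy|]; rewrite L2; simpl; auto.
  + now rewrite last_app.
  + intros c; rewrite app_comm_cons, in_app_iff; intros [Hc|[<-|[]]]; auto.
Qed.

Lemma conn_first_hit (S : cell -> Prop) (V : cell -> bool) p q :
  conn S p q -> V p = false -> V q = true ->
  exists c v, conn (fun x => S x /\ V x = false) p c /\ H c v /\ V v = true.
Proof.
intros C Vp Vq.
assert (X : (exists c v, conn (fun x => S x /\ V x = false) p c /\ H c v /\ V v = true)
            \/ conn (fun x => S x /\ V x = false) p q).
{ clear Vq; induction C as [|q r C IH E Sr]; [now right; constructor|].
  destruct IH as [IH|IH]; [now left|].
  destruct (V r) eqn:Vr; [left; now exists q, r|].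
  right; econstructor; eauto. }
destruct X as [X|X]; [easy|]; apply conn_r in X; destruct X; congruence.
Qed.

(* If both walks existed they would cross: [a1 -> a2] through [S] and [b1 -> b2]
   through [S'], closed up or compared by [q] and [r] which meet oddly. *)
Lemma conn_cross S S' a1 a2 q b1 b2 r :
  chain a2 q -> last q a2 = a1 -> chain b1 r -> last r b1 = b2 ->
  (forall c, In c (keys b1 r) -> ~ S c) ->
  (forall c, S' c -> ~ S c /\ ~ In c (a2 :: q)) ->
  crossing a2 q b1 r = true ->
  conn S a1 a2 -> conn S' b1 b2 -> False.
Proof.
intros Hq Lq Hr Lr Hk HS Hx C C'.
destruct (conn_walk _ _ _ C) as (l & L1 & L2 & L3).
destruct (conn_walk _ _ _ C') as (k & K1 & K2 & K3).
enough (crossing a2 q b1 r = false) by congruence.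
subst a2; apply (jordan a1 l q b1 r k); auto.
- congruence.
- intros c Hc Hi; apply (Hk c); auto.
- intros c Hc; destruct (HS c (K3 c Hc)) as [N1 N2].
  rewrite app_comm_cons, in_app_iff; intros [Hi|Hi]; [apply N1; auto|].
  now apply N2; right.
Qed.

End Connectivity.

(** * Bit masks on a window *)

Definition inbox (c : cell) : bool :=
  (-4 <=? fst c) && (fst c <=? 5) && (-4 <=? snd c) && (snd c <=? 4).

Definition idx (c : cell) : N := Z.to_N ((snd c + 4) * 10 + (fst c + 4)).

Definition cell_of (i : N) : cell :=
  (Z.of_N i mod 10 - 4, Z.of_N i / 10 - 4).

Definition tb (m : N) (c : cell) : bool := inbox c && N.testbit m (idx c).

Definition rect_mask (x0 x1 y0 y1 : Z) : N :=
  fold_right N.lor 0%N (map (fun i => let c := cell_of i in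
    if (x0 <=? fst c) && (fst c <=? x1) && (y0 <=? snd c) && (snd c <=? y1)
    then N.shiftl 1 i else 0%N) (map N.of_nat (seq 0 90))).

Definition win_mask : N := Eval vm_compute in rect_mask (-3) 4 (-3) 3.
Definition flip_mask : N := Eval vm_compute in rect_mask (-2) 3 (-2) 2.

Definition inwin (c : cell) : Prop := -3 <= fst c <= 4 /\ -3 <= snd c <= 3.
Definition inflip (c : cell) : Prop := -2 <= fst c <= 3 /\ -2 <= snd c <= 2.

Definition subm (a b : N) : bool := N.eqb (N.ldiff a b) 0.

(* Labels are only recorded off the outermost columns of the box, so that the
   shifts by one never reach a recorded cell of another row. *)
Definition grow (m : N) : N :=
  N.lor m (N.lor (N.lor (N.shiftl m 1) (N.shiftr m 1))
                 (N.lor (N.shiftl m 10) (N.shiftr m 10))).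

Fixpoint flood (n : nat) (f C : N) : N :=
  match n with
  | O => f
  | S n' => let g := N.land (grow f) C in
            if N.eqb g f then f else flood n' g C
  end.

Definition bit (i : N) : N := N.shiftl 1 i.

Definition region (i C : N) : N := flood 60 (N.land (bit i) C) C.

Lemma inboxP c : inbox c = true <-> -4 <= fst c <= 5 /\ -4 <= snd c <= 4.
Proof. unfold inbox; rewrite !andb_true_iff, !Z.leb_le; lia. Qed.

Lemma cell_of_idx c : inbox c = true -> cell_of (idx c) = c.
Proof.
rewrite inboxP; destruct c as [x y]; simpl; intros Hc; unfold cell_of, idx; simpl.
rewrite Z2N.id by lia; f_equal.
- rewrite Z.add_comm, Z.mod_add, Z.mod_small by lia; lia.
- rewrite Z.div_add_l, Z.div_small by lia; lia.
Qed.

Lemma tb_lor a b c : tb (N.lor a b) c = tb a c || tb b c.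
Proof. unfold tb; rewrite N.lor_spec; now destruct (inbox c). Qed.

Lemma tb_land a b c : tb (N.land a b) c = tb a c && tb b c.
Proof. unfold tb; rewrite N.land_spec; now destruct (inbox c). Qed.

Lemma tb_ldiff a b c : tb (N.ldiff a b) c = tb a c && negb (tb b c).
Proof. unfold tb; rewrite N.ldiff_spec; now destruct (inbox c). Qed.

Lemma tb_lxor a b c : tb (N.lxor a b) c = xorb (tb a c) (tb b c).
Proof. unfold tb; rewrite N.lxor_spec; now destruct (inbox c). Qed.

Lemma tb_0 c : tb 0 c = false.
Proof. unfold tb; rewrite N.bits_0; apply andb_false_r. Qed.

Lemma subm_tb a b c : subm a b = true -> tb a c = true -> tb b c = true.
Proof.
unfold subm; rewrite N.eqb_eq; intros E Ha.
assert (X := tb_ldiff a b c); rewrite E, tb_0, Ha in X.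
now destruct (tb b c).
Qed.

Lemma testbit_bit i j : N.testbit (bit i) j = N.eqb i j.
Proof. unfold bit; rewrite N.shiftl_1_l; apply N.pow2_bits_eqb. Qed.

Lemma tb_bit i c : tb (bit i) c = true -> c = cell_of i /\ inbox c = true.
Proof.
unfold tb; rewrite testbit_bit, andb_true_iff, N.eqb_eq; intros [Hi ->].
now rewrite cell_of_idx.
Qed.

Lemma tb_cell_of i m : inbox (cell_of i) = true -> idx (cell_of i) = i ->
  tb m (cell_of i) = N.testbit m i.
Proof. unfold tb; now intros -> ->. Qed.

Definition valid_idx (i : N) : bool := N.ltb i 90.

Lemma valid_idxP i : valid_idx i = true ->
  inbox (cell_of i) = true /\ idx (cell_of i) = i.
Proof.
unfold valid_idx; rewrite N.ltb_lt; intros Hi.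
assert (X : forallb (fun i => inbox (cell_of i) && N.eqb (idx (cell_of i)) i)
              (map N.of_nat (seq 0 90)) = true) by now vm_compute.
rewrite forallb_forall in X.
assert (Y : In i (map N.of_nat (seq 0 90))).
{ apply in_map_iff; exists (N.to_nat i); split; [lia|apply in_seq; lia]. }
specialize (X i Y); now rewrite andb_true_iff, N.eqb_eq in X.
Qed.

Lemma box_forall (P : cell -> bool) :
  forallb (fun i => P (cell_of i)) (map N.of_nat (seq 0 90)) = true ->
  forall c, inbox c = true -> P c = true.
Proof.
intros X c Hc; rewrite forallb_forall in X.
rewrite <- (cell_of_idx c Hc); apply X, in_map_iff.
assert (B := proj1 (inboxP c) Hc).
exists (N.to_nat (idx c)); split; [lia|]; apply in_seq; unfold idx; lia.
Qed.

Lemma tb_win c : tb win_mask c = true -> inwin c.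
Proof.
intros Hc; assert (Hb : inbox c = true) by (unfold tb in Hc; now rewrite andb_true_iff in Hc).
assert (X := box_forall (fun c => implb (tb win_mask c)
  ((-3 <=? fst c) && (fst c <=? 4) && (-3 <=? snd c) && (snd c <=? 3)))
  ltac:(now vm_compute) c Hb).
cbv beta in X; rewrite Hc in X; simpl in X.
rewrite !andb_true_iff, !Z.leb_le in X; unfold inwin; lia.
Qed.

Lemma tb_flip c : tb flip_mask c = true -> inflip c.
Proof.
intros Hc; assert (Hb : inbox c = true) by (unfold tb in Hc; now rewrite andb_true_iff in Hc).
assert (X := box_forall (fun c => implb (tb flip_mask c)
  ((-2 <=? fst c) && (fst c <=? 3) && (-2 <=? snd c) && (snd c <=? 2)))
  ltac:(now vm_compute) c Hb).
cbv beta in X; rewrite Hc in X; simpl in X.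
rewrite !andb_true_iff, !Z.leb_le in X; unfold inflip; lia.
Qed.

Lemma tb_inbox m c : tb m c = true -> inbox c = true.
Proof. unfold tb; now rewrite andb_true_iff. Qed.

Lemma inwin_box c : inwin c -> inbox c = true.
Proof. rewrite inboxP; unfold inwin; lia. Qed.

Lemma testbit_shift_r m k c d : (idx d = idx c + k)%N ->
  N.testbit (N.shiftl m k) (idx d) = N.testbit m (idx c) /\
  N.testbit (N.shiftr m k) (idx c) = N.testbit m (idx d).
Proof.
intros E; rewrite E, N.shiftr_spec'; split; [|easy].
rewrite N.shiftl_spec_high' by lia; f_equal; lia.
Qed.

Lemma tb_grow m c d : inwin c -> adjc c d -> tb m c = true -> tb (grow m) d = true.
Proof.
intros Wc A Hc; unfold inwin in Wc.
assert (Bc : inbox c = true) by now apply inwin_box.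
assert (Bd : inbox d = true) by (apply inboxP; unfold adjc in A; lia).
unfold tb in *; rewrite Bd; rewrite Bc in Hc; simpl in *.
unfold grow; rewrite !N.lor_spec.
apply inboxP in Bd; unfold adjc in A.
destruct A as [[E [F|F]]|[E [F|F]]].
- destruct (testbit_shift_r m 10 c d) as [X _];
    [unfold idx; lia|].
  rewrite X, Hc; now rewrite !orb_true_r.
- destruct (testbit_shift_r m 10 d c) as [_ X];
    [unfold idx; lia|].
  rewrite X, Hc; now rewrite !orb_true_r.
- destruct (testbit_shift_r m 1 c d) as [X _];
    [unfold idx; lia|].
  rewrite X, Hc; now rewrite !orb_true_r.
- destruct (testbit_shift_r m 1 d c) as [_ X];
    [unfold idx; lia|].
  rewrite X, Hc; now rewrite !orb_true_r.
Qed.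

Lemma tb_grow_inv m d : inwin d -> tb (grow m) d = true ->
  tb m d = true \/ exists c, adjc c d /\ tb m c = true.
Proof.
intros Wd Hd; assert (Bd := inwin_box d Wd); unfold inwin in Wd.
destruct d as [x y]; simpl in *.
unfold tb at 1 in Hd; rewrite Bd in Hd; simpl in Hd.
unfold grow in Hd; rewrite !N.lor_spec, !orb_true_iff in Hd.
destruct Hd as [Hd|[[Hd|Hd]|[Hd|Hd]]]; [left; unfold tb; now rewrite Bd|right..].
- exists (x - 1, y); split; [unfold adjc; simpl; lia|].
  assert (B : inbox (x - 1, y) = true) by (apply inboxP; simpl; lia).
  destruct (testbit_shift_r m 1 (x - 1, y) (x, y)) as [X _]; [unfold idx; simpl; lia|].
  unfold tb; now rewrite B, <- X.
- exists (x + 1, y); split; [unfold adjc; simpl; lia|].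
  assert (B : inbox (x + 1, y) = true) by (apply inboxP; simpl; lia).
  destruct (testbit_shift_r m 1 (x, y) (x + 1, y)) as [_ X]; [unfold idx; simpl; lia|].
  unfold tb; now rewrite B, <- X.
- exists (x, y - 1); split; [unfold adjc; simpl; lia|].
  assert (B : inbox (x, y - 1) = true) by (apply inboxP; simpl; lia).
  destruct (testbit_shift_r m 10 (x, y - 1) (x, y)) as [X _]; [unfold idx; simpl; lia|].
  unfold tb; now rewrite B, <- X.
- exists (x, y + 1); split; [unfold adjc; simpl; lia|].
  assert (B : inbox (x, y + 1) = true) by (apply inboxP; simpl; lia).
  destruct (testbit_shift_r m 10 (x, y) (x, y + 1)) as [_ X]; [unfold idx; simpl; lia|].
  unfold tb; now rewrite B, <- X.
Qed.

Lemma flood_conn (H : cell -> cell -> Prop) (S : cell -> Prop) C :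
  (forall c, tb C c = true -> S c /\ inwin c) ->
  (forall p q, tb C p = true -> tb C q = true -> adjc p q -> H p q) ->
  forall n f s, (forall c, tb f c = true -> tb C c = true /\ conn H S s c) ->
  forall c, tb (flood n f C) c = true -> tb C c = true /\ conn H S s c.
Proof.
intros HC HH; induction n as [|n IH]; simpl; intros f s Hf c; [apply Hf|].
destruct (N.eqb _ _); [apply Hf|].
apply IH; clear c; intros d; rewrite tb_land, andb_true_iff; intros [Hg Hd].
split; [easy|].
destruct (tb_grow_inv f d) as [Hfd|(c & A & Hc)]; try easy.
- now apply HC.
- now apply Hf.
- destruct (Hf c Hc) as [Cc Kc].
  econstructor; [exact Kc|now apply HH|now apply HC].
Qed.

(** * Certified local surgery *)

Definition mask_of (l : list N) : N := fold_right (fun i m => N.lor (bit i) m) 0%N l.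

Definition nonzero (m : N) : bool := negb (N.eqb (N.land m win_mask) 0).

Definition touch (m f : N) : bool := nonzero (N.land (grow m) f).

(* [Ex V P Q R d1 d2] exchanges the labels of the cells of [V] and [P]; [Q] and
   [R] are walks through [V] joining the cells of the two classes around [V],
   and [d1], [d2] represent the cells around [P]. *)
Inductive exch := Ex (V P Q R : list N) (d1 d2 : N).

Definition attach (f side Y : N) : N :=
  if nonzero (N.land f side) then N.lor f Y else f.

(* The cells of [Y] are known to be connected to those of [side] off [V]. *)
Definition exch_ok (A B K : N) (e : exch) (side Y : N) : bool :=
  let '(Ex V P Q R d1 d2) := e in
  let Vm := mask_of V in let Pm := mask_of P in
  let isA := N.testbit A (hd 0%N V) in
  let C := if isA then A else B in
  let D := if isA then B else A in
  let CV := N.ldiff C Vm in let DP := N.ldiff D Pm in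
  let a2 := hd 0%N Q in let a1 := last (tl Q) a2 in
  let b1 := hd 0%N R in let b2 := last (tl R) b1 in
  let q := map cell_of (tl Q) in let r := map cell_of (tl R) in
  let f := region b1 CV in let g := region b2 CV in
  subm Vm (N.land C flip_mask) && subm Pm (N.land D flip_mask) &&
  subm (grow Vm) K && subm (grow Pm) K &&
  subm Vm (region (hd 0%N V) Vm) && subm Pm (region (hd 0%N P) Pm) &&
  tb DP (cell_of a1) && tb DP (cell_of a2) &&
  tb CV (cell_of b1) && tb CV (cell_of b2) &&
  forallb (tb Vm) (removelast q) && forallb (tb Vm) (removelast r) &&
  chainb (cell_of a2) q && chainb (cell_of b1) r &&
  crossing (cell_of a2) q (cell_of b1) r &&
  subm (N.land (grow Vm) CV) (N.lor f g) &&
  touch Pm (attach f side Y) && touch Pm (attach g side Y) &&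
  subm (N.land (grow Pm) DP) (N.lor (region d1 DP) (region d2 DP)) &&
  touch Vm (N.land (bit a1) DP) && touch Vm (N.land (bit a2) DP).

Definition exch_mask (e : exch) : N :=
  let '(Ex V P _ _ _ _) := e in N.lor (mask_of V) (mask_of P).

(* [Flip i s]: the neighbours of [i] with its label are all joined to [s].
   [Closed s t]: the known component of [s] is complete and misses [t].
   [Dichotomy V y s1 s2]: off [V], [y] is joined to [s1] or to [s2], and each case
   has its own continuation. *)
Inductive plan :=
| Done
| Checkerboard (i : N)
| Closed (s t : N)
| Flip (i s : N) (p : plan)
| Exchange (e : exch) (p : plan)
| Dichotomy (V : list N) (y s1 s2 : N) (e1 : exch) (p1 : plan) (e2 : exch) (p2 : plan).

Definition uidx : N := 44.
Definition vidx : N := 45.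

Definition flip_cells : list cell :=
  map (fun i => cell_of (N.of_nat i)) (filter (fun i => N.testbit flip_mask (N.of_nat i)) (seq 0 90)).

Definition count_flip (m : N) : nat := length (filter (tb m) flip_cells).

(* [K] collects the cells that carry a known label or are known to lie outside
   the grid; [B0] is the value of [B] at the start of the plan. *)
Fixpoint plan_ok (B0 K A B : N) (p : plan) : bool :=
  match p with
  | Done =>
      (N.testbit A uidx && N.testbit A vidx) || (N.testbit B uidx && N.testbit B vidx) ||
      (N.testbit A uidx && N.testbit B vidx && Nat.ltb (count_flip B) (count_flip B0))
  | Checkerboard i =>
      let c := cell_of i in
      let d := (fst c + 1, snd c + 1) in
      let e := (fst c + 1, snd c) in
      let f := (fst c, snd c + 1) in
      (tb A c && tb A d && tb B e && tb B f) || (tb B c && tb B d && tb A e && tb A f)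
  | Closed s t =>
      let C := if N.testbit A s then A else B in
      let f := region s C in
      tb C (cell_of s) && tb f (cell_of s) && subm (grow f) K && subm (N.land (grow f) C) f &&
      tb C (cell_of t) && negb (tb f (cell_of t))
  | Flip i s p =>
      let m := bit i in
      let isA := N.testbit A i in
      let C := if isA then A else B in
      let D := if isA then B else A in
      let Cm := N.ldiff C m in
      tb m (cell_of i) && subm m (N.land C flip_mask) && subm (grow m) K && tb Cm (cell_of s) &&
      subm (N.land (grow m) Cm) (region s Cm) && touch m D &&
      plan_ok B0 K (N.lxor A m) (N.lxor B m) p
  | Exchange e p =>
      let m := exch_mask e in
      exch_ok A B K e 0 0 && plan_ok B0 K (N.lxor A m) (N.lxor B m) p
  | Dichotomy V y s1 s2 e1 p1 e2 p2 =>
      let Vm := mask_of V in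
      let isA := N.testbit A y in
      let C := if isA then A else B in
      let CV := N.ldiff C Vm in
      let f1 := region s1 CV in let f2 := region s2 CV in
      let Y := region y CV in
      let ok e f := let '(Ex V' _ _ _ _ _) := e in
        eqb (N.testbit A (hd 0%N V')) isA && subm (mask_of V') Vm && exch_ok A B K e f Y in
      subm Vm (N.land C flip_mask) && nonzero Vm && subm (grow Vm) K && tb CV (cell_of y) &&
      subm (N.land (grow Vm) CV) (N.lor f1 f2) &&
      ok e1 f1 && plan_ok B0 K (N.lxor A (exch_mask e1)) (N.lxor B (exch_mask e1)) p1 &&
      ok e2 f2 && plan_ok B0 K (N.lxor A (exch_mask e2)) (N.lxor B (exch_mask e2)) p2
  end.

Section Surgery.

Variables xl xr yb yt : Z.
Variable Fr : cell -> cell -> Prop.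
Hypothesis Fr_sym : forall p q, Fr p q -> Fr q p.

Definition Gb (c : cell) : bool :=
  (xl <=? fst c) && (fst c <=? xr) && (yb <=? snd c) && (snd c <=? yt).

Definition joined (p q : cell) : Prop :=
  adjc p q /\ Gb p = true /\ Gb q = true /\
  (Fr p q \/ inbox p = true /\ inbox q = true).

Definition cls (L : cell -> bool) (b : bool) (c : cell) : Prop := Gb c = true /\ L c = b.

Definition valid (L : cell -> bool) : Prop :=
  forall b, (exists c, cls L b c) /\
    (forall p q, cls L b p -> cls L b q -> conn joined (cls L b) p q).

Lemma joined_sym p q : joined p q -> joined q p.
Proof. unfold joined; intuition; auto using adjc_sym. Qed.

Lemma joined_adj p q : joined p q -> adjc p q.
Proof. now unfold joined. Qed.

Lemma joined_local p q : adjc p q -> Gb p = true -> Gb q = true ->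
  inbox p = true -> inbox q = true -> joined p q.
Proof. unfold joined; intuition. Qed.

Lemma conn_class (S : cell -> Prop) r1 :
  (forall p, S p -> conn joined S p r1) -> forall p q, S p -> S q -> conn joined S p q.
Proof.
intros X p q Sp Sq; eapply conn_trans; [now apply X|].
apply conn_sym; auto using joined_sym.
Qed.

Lemma conn_glue (S P U : cell -> Prop) r1 r2 x1 p1 x2 p2 :
  (forall p, S p -> conn joined S p r1 \/ conn joined S p r2) ->
  (forall p q, P p -> P q -> conn joined P p q) ->
  conn joined S r1 x1 -> joined x1 p1 -> P p1 -> conn joined S r2 x2 -> joined x2 p2 -> P p2 ->
  (forall c, U c <-> S c \/ P c) ->
  forall p q, U p -> U q -> conn joined U p q.
Proof.
intros HS HP X1 E1 P1 X2 E2 P2 HU.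
assert (SU : forall c, S c -> U c) by (intros; apply HU; auto).
assert (PU : forall c, P c -> U c) by (intros; apply HU; auto).
apply (conn_class U p1); intros p Up; apply HU in Up; destruct Up as [Sp|Pp].
- destruct (HS p Sp) as [C|C].
  + eapply conn_trans; [eapply conn_mono; [exact SU|]; eapply conn_trans; eassumption|].
    apply conn_edge; auto; apply SU; now apply conn_r in X1.
  + eapply conn_trans; [eapply conn_mono; [exact SU|]; eapply conn_trans; eassumption|].
    eapply conn_trans; [apply conn_edge; [| |exact E2]; auto|].
    * apply SU; now apply conn_r in X2.
    * eapply conn_mono; [exact PU|now apply HP].
- eapply conn_mono; [exact PU|now apply HP].
Qed.

Lemma exchange_valid L L' b (V P : cell -> bool) a1 a2 q b1 b2 r d1 d2
  x1 p1 x2 p2 v1 v2 :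
  let SC := fun c => cls L b c /\ V c = false in
  let SD := fun c => cls L (negb b) c /\ P c = false in
  valid L ->
  (forall c, V c = true -> cls L b c) -> (forall c, P c = true -> cls L (negb b) c) ->
  (forall c, L' c = xorb (L c) (V c || P c)) ->
  (forall p, SC p -> conn joined SC p b1 \/ conn joined SC p b2) ->
  (forall p, SD p -> conn joined SD p d1 \/ conn joined SD p d2) ->
  (forall p q, P p = true -> P q = true -> conn joined (fun c => P c = true) p q) ->
  (forall p q, V p = true -> V q = true -> conn joined (fun c => V c = true) p q) ->
  conn joined SC b1 x1 -> joined x1 p1 -> P p1 = true ->
  conn joined SC b2 x2 -> joined x2 p2 -> P p2 = true ->
  SD a1 -> SD a2 -> SC b1 -> SC b2 ->
  joined a1 v1 -> V v1 = true -> joined a2 v2 -> V v2 = true ->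
  chain a2 q -> last q a2 = a1 -> (forall c, In c (removelast q) -> V c = true) ->
  chain b1 r -> last r b1 = b2 -> (forall c, In c (removelast r) -> V c = true) ->
  crossing a2 q b1 r = true ->
  valid L'.
Proof.
intros SC SD HL HV HP EL HC HD PP VV X1 E1 P1 X2 E2 P2 A1 A2 B1 B2 F1 V1 F2 V2
  Q1 Q2 Q3 R1 R2 R3 Hx.
assert (UC : forall c, cls L' b c <-> SC c \/ P c = true).
{ intros c; unfold SC; split.
  - intros [Gc Lc]; rewrite EL in Lc.
    destruct (P c) eqn:Pc; [now right|left].
    destruct (V c) eqn:Vc; [destruct (HV c Vc) as [_ Z]; rewrite Z in Lc; now destruct b|].
    split; [split|]; auto; now rewrite <- Lc; destruct (L c).
  - intros [[[Gc Lc] Vc]|Pc]; (split; [auto; apply (HP c Pc)|rewrite EL]).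
    + destruct (P c) eqn:Pc; [destruct (HP c Pc) as [_ Z]; rewrite Lc in Z; now destruct b|].
      rewrite Vc, Lc; now destruct b.
    + destruct (HP c Pc) as [_ Z]; rewrite Pc, Z; now destruct b, (V c). }
assert (UD : forall c, cls L' (negb b) c <-> SD c \/ V c = true).
{ intros c; unfold SD; split.
  - intros [Gc Lc]; rewrite EL in Lc.
    destruct (V c) eqn:Vc; [now right|left].
    destruct (P c) eqn:Pc; [destruct (HP c Pc) as [_ Z]; rewrite Z in Lc; now destruct b|].
    split; [split|]; auto; now rewrite <- Lc; destruct (L c).
  - intros [[[Gc Lc] Vc]|Pc]; (split; [auto; apply (HV c Pc)|rewrite EL]).
    + destruct (V c) eqn:Pc; [destruct (HV c Pc) as [_ Z]; rewrite Lc in Z; now destruct b|].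
      rewrite Vc, Lc; now destruct b.
    + destruct (HV c Pc) as [_ Z]; rewrite Pc, Z; now destruct b. }
assert (KC := conn_glue SC (fun c => P c = true) (cls L' b) b1 b2 x1 p1 x2 p2
                HC PP X1 E1 P1 X2 E2 P2 UC).
assert (N12 : ~ conn joined SD a1 a2).
{ intros K.
  apply (conn_cross joined joined_adj SD (cls L' b) a1 a2 q b1 b2 r); auto.
  - intros c Hc [[_ Lc] Pc].
    assert (Hc' := keys_in _ _ R1 c Hc).
    assert (In c (removelast (b1 :: r)) \/ c = b2) as [Hi| ->].
    { destruct r as [|r0 r']; [left; now destruct Hc|].
      rewrite (app_removelast_last b1 (l := b1 :: r0 :: r')) in Hc' by easy.
      apply in_app_iff in Hc'; destruct Hc' as [?|[<-|[]]]; [now left|right].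
      rewrite <- R2; simpl; reflexivity. }
    + destruct r as [|r0 r']; [now destruct Hc|].
      destruct Hi as [<-|Hi]; [destruct B1 as [[_ Z] _]; rewrite Z in Lc; now destruct b|].
      destruct (HV c (R3 c Hi)) as [_ Z]; rewrite Z in Lc; now destruct b.
    + destruct B2 as [[_ Z] _]; rewrite Z in Lc; now destruct b.
  - intros c Uc; split.
    + intros [[_ Lc] Pc]; apply UC in Uc; destruct Uc as [[[_ Z] _]|Z]; [|congruence].
      rewrite Z in Lc; now destruct b.
    + assert (nD : ~ SD c).
      { intros [[_ Lc] Pc]; apply UC in Uc; destruct Uc as [[[_ Z] _]|Z]; [|congruence].
        rewrite Z in Lc; now destruct b. }
      intros Hi.
      destruct q as [|q0 q']; [destruct Hi as [<-|[]]; auto|].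
      rewrite (app_removelast_last a2 (l := a2 :: q0 :: q')) in Hi by easy.
      apply in_app_iff in Hi; destruct Hi as [[<-|Hi]|[<-|[]]]; auto.
      * apply UC in Uc; specialize (Q3 c Hi).
        destruct Uc as [[_ Z]|Z]; [congruence|].
        destruct (HP c Z) as [_ Z1]; destruct (HV c Q3) as [_ Z2].
        rewrite Z1 in Z2; now destruct b.
      * apply nD; change (SD (last (q0 :: q') a2)); now rewrite Q2.
  - apply KC; apply UC; auto. }
assert (HD' : forall p, SD p -> conn joined SD p a1 \/ conn joined SD p a2).
{ assert (sy := conn_sym joined joined_sym SD); assert (tr := conn_trans joined SD).
  intros p Sp; destruct (HD a1 A1), (HD a2 A2), (HD p Sp);
    try (now destruct N12; eauto); try (now left; eauto); now right; eauto. }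
assert (KD := conn_glue SD (fun c => V c = true) (cls L' (negb b)) a1 a2 a1 v1 a2 v2
  HD' VV (conn_refl _ _ _ A1) F1 V1 (conn_refl _ _ _ A2) F2 V2 UD).
assert (NC : exists c, cls L' b c) by (exists b1; apply UC; auto).
assert (ND : exists c, cls L' (negb b) c) by (exists a1; apply UD; auto).
intros b'; destruct b, b'; simpl in *; auto.
Qed.

Definition cmask (A B : N) (b : bool) : N := if b then A else B.

Definition matches (A B K : N) (L : cell -> bool) : Prop :=
  (forall b c, tb (cmask A B b) c = true -> cls L b c /\ inwin c) /\
  (forall c, tb K c = true -> tb A c = true \/ tb B c = true \/ Gb c = false).

Definition flipm (m : N) (L : cell -> bool) (c : cell) : bool := xorb (L c) (tb m c).

Lemma nonzeroP m : nonzero m = true -> exists c, tb m c = true /\ inwin c.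
Proof.
unfold nonzero; rewrite negb_true_iff, N.eqb_neq; intros Hm.
assert (X := N.bit_log2 _ Hm); rewrite N.land_spec, andb_true_iff in X.
destruct X as [X1 X2]; set (i := N.log2 _) in *.
destruct (N.lt_ge_cases i 90) as [Hi|Hi].
- apply N.ltb_lt in Hi; destruct (valid_idxP i Hi) as [Y1 Y2].
  exists (cell_of i); rewrite tb_cell_of by easy; split; [easy|].
  apply tb_win; now rewrite tb_cell_of.
- rewrite N.bits_above_log2 in X2; [easy|].
  apply N.lt_le_trans with 90%N; [now vm_compute|exact Hi].
Qed.

Lemma touchP m f : touch m f = true ->
  exists c d, tb m c = true /\ tb f d = true /\ (c = d \/ adjc c d).
Proof.
unfold touch; intros Ht; destruct (nonzeroP _ Ht) as (d & Hd & Wd).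
rewrite tb_land, andb_true_iff in Hd; destruct Hd as [H1 H2].
destruct (tb_grow_inv m d Wd H1) as [H3|(c & Hc & H3)]; [exists d, d|exists c, d]; auto.
Qed.

Lemma region_conn (S : cell -> Prop) i C :
  (forall c, tb C c = true -> S c /\ Gb c = true /\ inwin c) ->
  forall c, tb (region i C) c = true -> tb C c = true /\ conn joined S (cell_of i) c.
Proof.
intros HC; unfold region; apply flood_conn.
- intros c Hc; now destruct (HC c Hc) as (? & ? & ?).
- intros p q Hp Hq Ha; destruct (HC p Hp) as (? & ? & ?), (HC q Hq) as (? & ? & ?).
  apply joined_local; auto using inwin_box.
- intros c; rewrite tb_land, andb_true_iff; intros [H1 H2].
  apply tb_bit in H1; destruct H1 as [-> _]; split; [easy|].
  constructor; now apply HC.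
Qed.

Lemma known A B K L b c : matches A B K L -> tb K c = true -> cls L b c ->
  tb (cmask A B b) c = true.
Proof.
intros [M1 M2] Hk [Gc Lc]; destruct (M2 c Hk) as [X|[X|X]]; [| |congruence].
- destruct (M1 true c X) as [[_ Y] _]; now replace b with true by congruence.
- destruct (M1 false c X) as [[_ Y] _]; now replace b with false by congruence.
Qed.

Lemma contact A B K L b Vm : valid L -> matches A B K L ->
  subm Vm (N.land (cmask A B b) flip_mask) = true -> subm (grow Vm) K = true ->
  (exists v, tb Vm v = true) ->
  forall p, cls L b p /\ tb Vm p = false -> exists c,
    conn joined (fun c => cls L b c /\ tb Vm c = false) p c /\
    tb (N.land (grow Vm) (N.ldiff (cmask A B b) Vm)) c = true.
Proof.
intros HL HM HV HK [v Hv] p [Cp Vp].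
assert (HV' : forall c, tb Vm c = true -> cls L b c /\ inwin c).
{ intros c Hc; apply (proj1 HM); apply (subm_tb _ _ _ HV) in Hc.
  now rewrite tb_land, andb_true_iff in Hc. }
destruct (HL b) as [_ Hc].
destruct (conn_first_hit joined (cls L b) (tb Vm) p v) as (c & w & K1 & K2 & K3); auto.
{ apply Hc; [easy|now apply HV']. }
exists c; split; [easy|].
rewrite tb_land, tb_ldiff.
destruct (conn_r _ _ _ _ K1) as [K4 K5]; rewrite K5.
assert (G1 : tb (grow Vm) c = true).
{ apply (tb_grow Vm w c); [now apply HV'|apply adjc_sym, K2|easy]. }
rewrite G1, (known A B K L b c HM (subm_tb _ _ _ HK G1) K4); easy.
Qed.

Lemma region_set A B K L b Vm i : matches A B K L ->
  forall c, tb (region i (N.ldiff (cmask A B b) Vm)) c = true ->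
  tb (N.ldiff (cmask A B b) Vm) c = true /\
  conn joined (fun c => cls L b c /\ tb Vm c = false) (cell_of i) c.
Proof.
intros [M1 _]; apply region_conn; intros c.
rewrite tb_ldiff, andb_true_iff, negb_true_iff; intros [H1 H2].
destruct (M1 b c H1) as [[X1 X2] X3]; unfold cls; tauto.
Qed.

Lemma mask_connected A B K L b Vm i : matches A B K L ->
  subm Vm (N.land (cmask A B b) flip_mask) = true -> subm Vm (region i Vm) = true ->
  forall p q, tb Vm p = true -> tb Vm q = true -> conn joined (fun c => tb Vm c = true) p q.
Proof.
intros [M1 _] HV HR; apply (conn_class _ (cell_of i)).
intros p Hp; apply conn_sym; [apply joined_sym|].
apply (region_conn (fun c => tb Vm c = true) i Vm); [|now apply (subm_tb _ _ _ HR)].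
intros c Hc; split; [easy|].
apply (subm_tb _ _ _ HV) in Hc; rewrite tb_land, andb_true_iff in Hc.
now destruct (M1 b c (proj1 Hc)) as [[X1 X2] X3].
Qed.

Lemma last_map (l : list N) a : last (map cell_of l) (cell_of a) = cell_of (last l a).
Proof.
revert a; induction l as [|x l IH]; intros a; [easy|].
destruct l as [|y l]; [easy|]; apply (IH a).
Qed.

Lemma exch_sound A B K L e side Y b :
  valid L -> matches A B K L -> exch_ok A B K e side Y = true ->
  (let '(Ex V _ _ _ _ _) := e in N.testbit A (hd 0%N V) = b /\
   forall c d, tb Y c = true -> tb side d = true ->
   tb (N.ldiff (cmask A B b) (mask_of V)) c = true /\
   conn joined (fun c => cls L b c /\ tb (mask_of V) c = false) d c) ->
  valid (flipm (exch_mask e) L) /\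
  (forall c, tb (exch_mask e) c = true -> (tb A c = true \/ tb B c = true) /\ inflip c).
Proof.
intros HL HM; destruct e as [V P Q R d1 d2]; unfold exch_ok, exch_mask.
cbv zeta; intros Hok [Hb Hfact]; rewrite Hb in Hok.
replace (if b then A else B) with (cmask A B b) in Hok by easy.
replace (if b then B else A) with (cmask A B (negb b)) in Hok by now destruct b.
set (Vm := mask_of V) in *; set (Pm := mask_of P) in *.
set (C := cmask A B b) in *; set (D := cmask A B (negb b)) in *.
set (CV := N.ldiff C Vm) in *; set (DP := N.ldiff D Pm) in *.
set (a2 := hd 0%N Q) in *; set (a1 := last (tl Q) a2) in *.
set (b1 := hd 0%N R) in *; set (b2 := last (tl R) b1) in *.
rewrite !andb_true_iff in Hok.
destruct Hok as ((((((((((((((((((((O1 & O2) & O3) & O4) & O5) & O6) & O7) & O8) & O9)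
  & O10) & O11) & O12) & O13) & O14) & O15) & O16) & O17) & O18) & O19) & O20) & O21).
set (SC := fun c => cls L b c /\ tb Vm c = false).
set (SD := fun c => cls L (negb b) c /\ tb Pm c = false).
assert (VC : forall c, tb Vm c = true -> cls L b c /\ inwin c).
{ intros c Hc; apply (subm_tb _ _ _ O1) in Hc; rewrite tb_land, andb_true_iff in Hc.
  now apply HM. }
assert (PD : forall c, tb Pm c = true -> cls L (negb b) c /\ inwin c).
{ intros c Hc; apply (subm_tb _ _ _ O2) in Hc; rewrite tb_land, andb_true_iff in Hc.
  now apply HM. }
assert (CVS : forall c, tb CV c = true -> SC c /\ inwin c).
{ intros c; unfold CV; rewrite tb_ldiff, andb_true_iff, negb_true_iff; intros [X1 X2].
  destruct (proj1 HM b c X1); unfold SC; tauto. }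
assert (DPS : forall c, tb DP c = true -> SD c /\ inwin c).
{ intros c; unfold DP; rewrite tb_ldiff, andb_true_iff, negb_true_iff; intros [X1 X2].
  destruct (proj1 HM (negb b) c X1); unfold SD; tauto. }
assert (Hl : forall p q, adjc p q -> Gb p = true -> Gb q = true -> inwin p -> inwin q -> joined p q)
  by (intros; apply joined_local; auto using inwin_box).
assert (TP : forall x, tb CV (cell_of x) = true -> touch Pm (attach (region x CV) side Y) = true ->
  exists z p, conn joined SC (cell_of x) z /\ joined z p /\ tb Pm p = true).
{ intros x Hx Ht; destruct (touchP _ _ Ht) as (p & z & Hp & Hz & Ha).
  assert (Z : tb CV z = true /\ conn joined SC (cell_of x) z).
  { unfold attach in Hz; destruct (nonzero _) eqn:En;
      [|now apply (region_set A B K L b Vm x HM)].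
    rewrite tb_lor, orb_true_iff in Hz; destruct Hz as [Hz|Hz];
      [now apply (region_set A B K L b Vm x HM)|].
    destruct (nonzeroP _ En) as (d & Hd & _); rewrite tb_land, andb_true_iff in Hd.
    destruct Hd as [Hd1 Hd2]; destruct (Hfact z d Hz Hd2) as [F1 F2]; split; [easy|].
    eapply conn_trans; [|exact F2].
    now apply (region_set A B K L b Vm x HM). }
  destruct Z as [Z1 Z2]; exists z, p; split; [easy|]; split; [|easy].
  destruct (CVS z Z1) as [[[Gz Lz] _] Wz]; destruct (PD p Hp) as [[Gp Lp] Wp].
  destruct Ha as [->|Ha]; [rewrite Lz in Lp; now destruct b|].
  apply Hl; auto using adjc_sym. }
assert (TV : forall x, touch Vm (N.land (bit x) DP) = true ->
  exists v, joined (cell_of x) v /\ tb Vm v = true).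
{ intros x Ht; destruct (touchP _ _ Ht) as (v & z & Hv & Hz & Ha).
  rewrite tb_land, andb_true_iff in Hz; destruct Hz as [Hz1 Hz2].
  apply tb_bit in Hz1; destruct Hz1 as [-> _].
  exists v; split; [|easy].
  destruct (DPS _ Hz2) as [[[Gz Lz] _] Wz]; destruct (VC v Hv) as [[Gp Lp] Wp].
  destruct Ha as [->|Ha]; [rewrite Lz in Lp; now destruct b|].
  apply Hl; auto using adjc_sym. }
destruct (TP b1 O9 O17) as (x1 & p1 & X1 & X2 & X3).
destruct (TP b2 O10 O18) as (x2 & p2 & X4 & X5 & X6).
destruct (TV a1 O20) as (v1 & W1 & W2); destruct (TV a2 O21) as (v2 & W3 & W4).
split.
- apply (exchange_valid L _ b (tb Vm) (tb Pm) (cell_of a1) (cell_of a2) (map cell_of (tl Q))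
    (cell_of b1) (cell_of b2) (map cell_of (tl R)) (cell_of d1) (cell_of d2)
    x1 p1 x2 p2 v1 v2); auto; try (now apply CVS); try (now apply DPS).
  + intros c Hc; now apply VC.
  + intros c Hc; now apply PD.
  + intros c; unfold flipm; now rewrite tb_lor.
  + intros p Sp; destruct (contact A B K L b Vm HL HM O1 O3 (ex_intro _ v1 W2) p Sp)
      as (c & K1 & K2).
    apply (subm_tb _ _ _ O16) in K2; rewrite tb_lor, orb_true_iff in K2.
    destruct K2 as [K2|K2]; [left|right]; (eapply conn_trans; [exact K1|]);
      (apply conn_sym; [apply joined_sym|]); now apply (region_set A B K L b Vm _ HM).
  + intros p Sp; destruct (contact A B K L (negb b) Pm HL HM O2 O4 (ex_intro _ p1 X3) p Sp)
      as (c & K1 & K2).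
    apply (subm_tb _ _ _ O19) in K2; rewrite tb_lor, orb_true_iff in K2.
    destruct K2 as [K2|K2]; [left|right]; (eapply conn_trans; [exact K1|]);
      (apply conn_sym; [apply joined_sym|]); now apply (region_set A B K L (negb b) Pm _ HM).
  + exact (mask_connected A B K L (negb b) Pm (hd 0%N P) HM O2 O6).
  + exact (mask_connected A B K L b Vm (hd 0%N V) HM O1 O5).
  + now apply chainbP.
  + apply last_map.
  + now apply forallb_forall.
  + now apply chainbP.
  + apply last_map.
  + now apply forallb_forall.
- intros c; rewrite tb_lor, orb_true_iff; intros Hc.
  assert (X : forall b', tb (cmask A B b') c = true -> tb A c = true \/ tb B c = true)
    by (intros []; auto).
  destruct Hc as [Hc|Hc]; [apply (subm_tb _ _ _ O1) in Hc|apply (subm_tb _ _ _ O2) in Hc];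
    rewrite tb_land, andb_true_iff in Hc; destruct Hc as [Hc1 Hc2];
    (split; [now apply X in Hc1|now apply tb_flip]).
Qed.

End Surgery.

Section PlanSound.
Variables xl xr yb yt : Z.
Variable Fr : cell -> cell -> Prop.
Hypothesis Fr_sym : forall p q, Fr p q -> Fr q p.

Local Notation inG := (Gb xl xr yb yt).
Local Notation incls := (cls xl xr yb yt).
Local Notation isvalid := (valid xl xr yb yt Fr).
Local Notation ismatch := (matches xl xr yb yt).
Local Notation isconn := (conn (joined xl xr yb yt Fr)).

Definition phi (L : cell -> bool) : nat :=
  length (filter (fun c => inG c && negb (L c)) flip_cells).

Definition progress (L0 : cell -> bool) : Prop :=
  exists L, isvalid L /\ (forall c, ~ inflip c -> L c = L0 c) /\
    (L (0, 0) = L (1, 0) \/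
     L (0, 0) = true /\ L (1, 0) = false /\ (phi L < phi L0)%nat).

Lemma matches_disjoint A B K L c : ismatch A B K L ->
  tb A c = true -> tb B c = true -> False.
Proof.
intros [M _] HA HB.
destruct (M true c HA) as [[_ E1] _]; destruct (M false c HB) as [[_ E2] _]; congruence.
Qed.

Lemma matches_flip A B K L m : ismatch A B K L ->
  (forall c, tb m c = true -> tb A c = true \/ tb B c = true) ->
  ismatch (N.lxor A m) (N.lxor B m) K (flipm m L).
Proof.
intros HM Hm; assert (HM' := HM); destruct HM' as [M1 M2]; split.
- intros b c Hc.
  assert (E : tb (cmask A B b) c <> tb m c).
  { destruct b; simpl in *; rewrite tb_lxor in Hc; now destruct (tb _ c), (tb m c). }
  unfold flipm, incls; destruct (tb m c) eqn:Em.
  + assert (X : tb (cmask A B (negb b)) c = true)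
      by (destruct (Hm c Em), b; simpl in *; congruence).
    destruct (M1 _ _ X) as [[X1 X2] X3]; repeat split; try easy; try apply X3.
    rewrite X2; now destruct b.
  + assert (X : tb (cmask A B b) c = true) by now destruct (tb (cmask A B b) c).
    destruct (M1 _ _ X) as [[X1 X2] X3]; repeat split; try easy; try apply X3.
    rewrite X2; now destruct b.
- intros c Hc; rewrite !tb_lxor.
  assert (D := matches_disjoint A B K L c HM).
  destruct (tb m c) eqn:Em.
  + destruct (Hm c Em) as [X|X]; rewrite X in *; simpl; auto.
    * destruct (tb B c); [now destruct D|auto].
    * destruct (tb A c); [now destruct D|auto].
  + rewrite !xorb_false_r; now apply M2.
Qed.

Lemma phi_flip A B K L m : ismatch A B K L ->
  (forall c, tb m c = true -> tb A c = true \/ tb B c = true) ->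
  (phi L + count_flip (N.lxor B m) = phi (flipm m L) + count_flip B)%nat.
Proof.
intros HM Hm; unfold phi, count_flip; induction flip_cells as [|c l IH]; [easy|].
cbn [filter]; rewrite tb_lxor; change (flipm m L c) with (xorb (L c) (tb m c)).
destruct HM as [M1 M2]; destruct (tb m c) eqn:Em.
- destruct (tb B c) eqn:EB; [destruct (M1 false c EB) as [[-> ->] _]; simpl; lia|].
  destruct (Hm c Em) as [X|X]; [|congruence].
  destruct (M1 true c X) as [[-> ->] _]; simpl; lia.
- rewrite !xorb_false_r.
  destruct (tb B c), (inG c && negb (L c)); simpl; lia.
Qed.

Lemma checkerboard_absurd L b x y : isvalid L ->
  incls L b (x, y) -> incls L b (x + 1, y + 1) ->
  incls L (negb b) (x + 1, y) -> incls L (negb b) (x, y + 1) -> False.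
Proof.
intros HL A1 A2 B1 B2.
destruct (HL b) as [_ KA]; destruct (HL (negb b)) as [_ KB].
set (V := fun c => ceqb c (x, y + 1)).
destruct (conn_first_hit _ _ V (x + 1, y) (x, y + 1) (KB _ _ B1 B2)) as (c & v & C1 & C2 & C3).
{ unfold V; destruct (ceqbP (x + 1, y) (x, y + 1)) as [E|]; [injection E; lia|easy]. }
{ unfold V; now destruct (ceqbP (x, y + 1) (x, y + 1)). }
unfold V in C3; destruct (ceqbP v (x, y + 1)) as [->|]; [|easy].
destruct (conn_r _ _ _ _ C1) as [[Gc Lc] Vc].
assert (Nc : c <> (x, y) /\ c <> (x + 1, y + 1)).
{ split; intros ->; destruct A1 as [_ E1], A2 as [_ E2];
    (rewrite E1 in Lc || rewrite E2 in Lc); now destruct b. }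
assert (Hc : c = (x - 1, y + 1) \/ c = (x, y + 2)).
{ destruct C2 as [Ha _]; destruct c as [cx cy]; unfold adjc in Ha; simpl in Ha.
  destruct Nc as [N1 N2]; destruct Ha as [[-> [Ha|Ha]]|[-> [Ha|Ha]]].
  - exfalso; apply N1; f_equal; lia.
  - right; f_equal; lia.
  - left; f_equal; lia.
  - exfalso; apply N2; f_equal; lia. }
assert (LL : forall p, incls L b p -> incls L (negb b) p -> False)
  by (intros p [_ E1] [_ E2]; rewrite E1 in E2; now destruct b).
apply (conn_cross _ (joined_adj xl xr yb yt Fr) (incls L b)
  (fun p => incls L (negb b) p /\ V p = false)
  (x, y) (x + 1, y + 1) [(x, y + 1); (x, y)]
  (x + 1, y) c [(x, y); (x, y + 1); c]).
- simpl; unfold adjc; simpl; lia.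
- easy.
- destruct C2 as [Ha _]; apply adjc_sym in Ha; simpl; split; [|split; [|easy]];
    unfold adjc; simpl; lia.
- easy.
- intros p Hp Sp; apply (LL p Sp).
  cbn [keys] in Hp; unfold key in Hp; simpl in Hp.
  destruct (Z.eqb_spec (x + 1) x); [lia|]; rewrite Z.eqb_refl in Hp.
  destruct Hc as [-> | ->]; simpl in Hp.
  + destruct (Z.eqb_spec x (x - 1)); [lia|].
    destruct Hp as [<-|[<-|[<-|[]]]].
    * now replace (Z.max (x + 1) x) with (x + 1) by lia.
    * now replace (Z.max y (y + 1)) with (y + 1) by lia.
    * now replace (Z.max x (x - 1)) with x by lia.
  + rewrite Z.eqb_refl in Hp; destruct Hp as [<-|[<-|[<-|[]]]].
    * now replace (Z.max (x + 1) x) with (x + 1) by lia.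
    * now replace (Z.max y (y + 1)) with (y + 1) by lia.
    * now replace (Z.max (y + 1) (y + 2)) with (y + 2) by lia.
- intros p [Hp Vp]; split; [intros X; now apply (LL p)|].
  intros [<-|[<-|[<-|[]]]]; [now apply (LL (x + 1, y + 1))| |now apply (LL (x, y))].
  unfold V in Vp; now destruct (ceqbP (x, y + 1) (x, y + 1)).
- destruct Hc as [-> | ->]; unfold crossing, swept, key, key', is_edge, ceqb;
    cbn [wsum fst snd];
    repeat match goal with
    | |- context [Z.eqb ?a ?b] =>
        (replace (Z.eqb a b) with true by (symmetry; apply Z.eqb_eq; lia)) ||
        (replace (Z.eqb a b) with false by (symmetry; apply Z.eqb_neq; lia));
        cbn [wsum fst snd]
    end; reflexivity.
- now apply KA.
- exact C1.
Qed.

Lemma closed_absurd A B K L b s t : isvalid L -> ismatch A B K L ->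
  let C := cmask A B b in let f := region s C in
  tb C (cell_of s) = true -> tb f (cell_of s) = true ->
  subm (grow f) K = true -> subm (N.land (grow f) C) f = true ->
  tb C (cell_of t) = true -> tb f (cell_of t) = false -> False.
Proof.
intros HL HM C f Hs Hfs H1 H2 Ht Hft.
assert (M1 := proj1 HM).
destruct (HL b) as [_ KC].
assert (X := KC _ _ (proj1 (M1 b _ Hs)) (proj1 (M1 b _ Ht))).
assert (Y : forall c, isconn (incls L b) (cell_of s) c -> tb f c = true).
{ induction 1 as [|q r C1 IH E Sr]; [easy|].
  assert (Cq : tb C q = true).
  { apply (region_conn xl xr yb yt Fr (incls L b) s C); [|exact IH].
    intros c Hc; destruct (M1 b c Hc) as [[? ?] ?]; unfold cls; tauto. }
  assert (Gr : tb (grow f) r = true)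
    by (apply (tb_grow f q r); [now apply (M1 b)|apply E|easy]).
  apply (subm_tb _ _ _ H2); rewrite tb_land, Gr.
  exact (known xl xr yb yt A B K L b r HM (subm_tb _ _ _ H1 Gr) Sr). }
rewrite (Y _ X) in Hft; easy.
Qed.

Lemma flip_sound A B K L i s b : isvalid L -> ismatch A B K L ->
  let m := bit i in let C := cmask A B b in let Cm := N.ldiff C m in
  tb m (cell_of i) = true -> subm m (N.land C flip_mask) = true ->
  subm (grow m) K = true ->
  tb Cm (cell_of s) = true -> subm (N.land (grow m) Cm) (region s Cm) = true ->
  touch m (cmask A B (negb b)) = true ->
  isvalid (flipm m L).
Proof.
intros HL HM m C Cm Hi Hm Hg Hs Hr Ht.
assert (M1 := proj1 HM).
assert (Ei : forall c, tb m c = true <-> c = cell_of i).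
{ intros c; split; [|now intros ->]; intros Hc; now apply tb_bit in Hc. }
assert (Ci : incls L b (cell_of i) /\ inwin (cell_of i)).
{ apply M1; apply (subm_tb _ _ _ Hm) in Hi; now rewrite tb_land, andb_true_iff in Hi. }
destruct Ci as [Ci Wi].
set (SC := fun c => incls L b c /\ tb m c = false).
assert (UC : forall c, incls (flipm m L) b c <-> SC c).
{ intros c; unfold SC, flipm, incls; destruct (tb m c) eqn:Em.
  - apply Ei in Em; subst c; destruct Ci as [_ ->]; split; intros [X Y]; [|easy].
    now destruct b.
  - rewrite xorb_false_r; tauto. }
assert (UD : forall c, incls (flipm m L) (negb b) c <-> incls L (negb b) c \/ tb m c = true).
{ intros c; unfold flipm, incls; destruct (tb m c) eqn:Em.
  - apply Ei in Em; subst c; destruct Ci as [Gi ->]; rewrite Gi; split; [now right|].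
    intros _; split; [easy|now destruct b].
  - rewrite xorb_false_r; split; [now left|now intros [X|X]]. }
assert (KC : forall p q, SC p -> SC q -> isconn SC p q).
{ apply (conn_class _ _ _ _ _ Fr_sym _ (cell_of s)).
  intros p Sp; destruct (contact xl xr yb yt Fr A B K L b m HL HM Hm Hg (ex_intro _ _ Hi) p Sp)
    as (c & K1 & K2).
  apply (subm_tb _ _ _ Hr) in K2; eapply conn_trans; [exact K1|].
  apply conn_sym; [now apply joined_sym|].
  now apply (region_set xl xr yb yt Fr A B K L b m s HM). }
destruct (touchP _ _ Ht) as (c & d & Hc & Hd & Ha).
apply Ei in Hc; subst c.
destruct (M1 _ _ Hd) as [Cd Wd].
assert (Hid : joined xl xr yb yt Fr d (cell_of i)).
{ destruct Ha as [<-|Ha]; [destruct Cd as [_ E1], Ci as [_ E2]; rewrite E1 in E2; now destruct b|].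
  destruct Cd, Ci; apply joined_local; auto using adjc_sym, inwin_box. }
assert (ND : isconn (fun c => tb m c = true) (cell_of i) (cell_of i)) by now constructor.
assert (KD : forall p q, incls (flipm m L) (negb b) p -> incls (flipm m L) (negb b) q ->
  isconn (incls (flipm m L) (negb b)) p q).
{ destruct (HL (negb b)) as [_ KL].
  apply (conn_glue xl xr yb yt Fr Fr_sym (incls L (negb b)) (fun c => tb m c = true) _
    d d d (cell_of i) d (cell_of i)); auto; try (now constructor).
  intros p q Hp Hq; apply Ei in Hp; apply Ei in Hq; now subst. }
assert (NC : exists c, incls (flipm m L) b c).
{ exists (cell_of s); apply UC; unfold Cm in Hs; rewrite tb_ldiff, andb_true_iff, negb_true_iff in Hs.
  destruct Hs; split; [now apply M1|easy]. }
assert (NN : exists c, incls (flipm m L) (negb b) c) by (exists d; apply UD; now left).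
assert (KC' : forall p q, incls (flipm m L) b p -> incls (flipm m L) b q ->
  isconn (incls (flipm m L) b) p q).
{ intros p q Hp Hq; apply (conn_mono _ SC); [intros; now apply UC|].
  apply KC; now apply UC. }
intros b'; destruct b, b'; simpl in *; auto.
Qed.

Lemma plan_sound L0 B0 K p : forall A B L,
  isvalid L -> ismatch A B K L -> plan_ok B0 K A B p = true ->
  (forall c, ~ inflip c -> L c = L0 c) ->
  (phi L0 + count_flip B = phi L + count_flip B0)%nat -> progress L0.
Proof.
assert (Step : forall A B L m, isvalid (flipm m L) -> ismatch A B K L ->
  (forall c, tb m c = true -> (tb A c = true \/ tb B c = true) /\ inflip c) ->
  (forall c, ~ inflip c -> L c = L0 c) ->
  (phi L0 + count_flip B = phi L + count_flip B0)%nat ->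
  ismatch (N.lxor A m) (N.lxor B m) K (flipm m L) /\
  (forall c, ~ inflip c -> flipm m L c = L0 c) /\
  (phi L0 + count_flip (N.lxor B m) = phi (flipm m L) + count_flip B0)%nat).
{ intros A B L m Hv HM Hm HO HP; split; [|split].
  - now apply matches_flip; [|intros c Hc; apply Hm].
  - intros c Hc; unfold flipm; destruct (tb m c) eqn:E; [now destruct (Hm c E)|].
    rewrite xorb_false_r; now apply HO.
  - assert (X := phi_flip A B K L m HM (fun c Hc => proj1 (Hm c Hc))); lia. }
induction p as [|i|s t|i s p IH|e p IH|V y s1 s2 e1 p1 IH1 e2 p2 IH2];
  intros A B L HL HM Hok HO HP; cbn [plan_ok] in Hok.
- exists L; split; [easy|split; [easy|]].
  assert (TA : forall b c, inbox c = true -> N.testbit (cmask A B b) (idx c) = true -> L c = b).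
  { intros b c Hb Hc; apply (proj1 HM b c); unfold tb; now rewrite Hb. }
  rewrite !orb_true_iff, !andb_true_iff in Hok.
  change uidx with (idx (0, 0)) in Hok; change vidx with (idx (1, 0)) in Hok.
  destruct Hok as [[[X1 X2]|[X1 X2]]|[[X1 X2] X3]].
  + left; now rewrite (TA true (0, 0)), (TA true (1, 0)).
  + left; now rewrite (TA false (0, 0)), (TA false (1, 0)).
  + right; rewrite (TA true (0, 0)), (TA false (1, 0)) by easy.
    apply Nat.ltb_lt in X3; repeat split; lia.
- exfalso; destruct HM as [M1 _]; destruct (cell_of i) as [x z]; simpl in Hok.
  rewrite !orb_true_iff, !andb_true_iff in Hok.
  destruct Hok as [[[[X1 X2] X3] X4]|[[[X1 X2] X3] X4]].
  + apply (checkerboard_absurd L true x z HL); now apply M1.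
  + apply (checkerboard_absurd L false x z HL); now apply M1.
- exfalso; set (b := N.testbit A s) in *.
  change (if b then A else B) with (cmask A B b) in Hok; cbv zeta in Hok.
  rewrite !andb_true_iff, negb_true_iff in Hok.
  destruct Hok as (((((X1 & X2) & X3) & X4) & X5) & X6).
  exact (closed_absurd A B K L b s t HL HM X1 X2 X3 X4 X5 X6).
- set (b := N.testbit A i) in *; cbv zeta in Hok.
  change (if b then A else B) with (cmask A B b) in Hok.
  replace (if b then B else A) with (cmask A B (negb b)) in Hok by now destruct b.
  rewrite !andb_true_iff in Hok.
  destruct Hok as ((((((X1 & X2) & X3) & X4) & X5) & X6) & X7).
  assert (Hv := flip_sound A B K L i s b HL HM X1 X2 X3 X4 X5 X6).
  destruct (Step A B L (bit i) Hv HM) as (S1 & S2 & S3); auto.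
  { intros c Hc; apply (subm_tb _ _ _ X2) in Hc; rewrite tb_land, andb_true_iff in Hc.
    destruct Hc as [Hc1 Hc2]; split; [destruct b; auto|now apply tb_flip]. }
  exact (IH _ _ _ Hv S1 X7 S2 S3).
- cbv zeta in Hok; rewrite andb_true_iff in Hok; destruct Hok as [X1 X2].
  destruct (exch_sound xl xr yb yt Fr Fr_sym A B K L e 0 0
    (let '(Ex V _ _ _ _ _) := e in N.testbit A (hd 0%N V)) HL HM X1) as [Hv Hm].
  { destruct e; split; [easy|]; intros c d Hc; now rewrite tb_0 in Hc. }
  destruct (Step A B L _ Hv HM) as (S1 & S2 & S3); auto.
  exact (IH _ _ _ Hv S1 X2 S2 S3).
- set (b := N.testbit A y) in *; cbv zeta in Hok.
  change (if b then A else B) with (cmask A B b) in Hok.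
  set (C := cmask A B b) in *; set (Vm := mask_of V) in *.
  set (CV := N.ldiff C Vm) in *.
  rewrite !andb_true_iff in Hok.
  destruct Hok as ((((((((X1 & X2) & X3) & X4) & X5) & X6) & X7) & X8) & X9).
  destruct (nonzeroP _ X2) as (v & Hv & _).
  set (SC := fun c => incls L b c /\ tb Vm c = false).
  assert (Reg : forall j c, tb (region j CV) c = true ->
    tb CV c = true /\ isconn SC (cell_of j) c)
    by (intros j; exact (region_set xl xr yb yt Fr A B K L b Vm j HM)).
  assert (Sy : SC (cell_of y)).
  { unfold CV in X4; rewrite tb_ldiff, andb_true_iff, negb_true_iff in X4.
    destruct X4; split; [now apply HM|easy]. }
  destruct (contact xl xr yb yt Fr A B K L b Vm HL HM X1 X3 (ex_intro _ v Hv) _ Sy)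
    as (c & K1 & K2).
  apply (subm_tb _ _ _ X5) in K2; rewrite tb_lor, orb_true_iff in K2.
  assert (Main : forall e p s,
    (forall A B L, isvalid L -> ismatch A B K L -> plan_ok B0 K A B p = true ->
      (forall c, ~ inflip c -> L c = L0 c) ->
      (phi L0 + count_flip B = phi L + count_flip B0)%nat -> progress L0) ->
    tb (region s CV) c = true ->
    (let '(Ex V' _ _ _ _ _) := e in
     eqb (N.testbit A (hd 0%N V')) b && subm (mask_of V') Vm &&
     exch_ok A B K e (region s CV) (region y CV)) = true ->
    plan_ok B0 K (N.lxor A (exch_mask e)) (N.lxor B (exch_mask e)) p = true -> progress L0).
  { clear IH1 IH2; intros e p s IH Hs He Hp.
    destruct e as [V' P' Q' R' d1 d2].
    rewrite !andb_true_iff, eqb_true_iff in He; destruct He as [[E1 E2] E3].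
    destruct (exch_sound xl xr yb yt Fr Fr_sym A B K L _ _ _ b HL HM E3) as [Hv' Hm].
    { split; [easy|]; intros d d' Hd Hd'.
      apply Reg in Hd; apply Reg in Hd'; apply Reg in Hs.
      assert (SS : forall c, SC c -> incls L b c /\ tb (mask_of V') c = false).
      { intros x [Z1 Z2]; split; [easy|].
        destruct (tb (mask_of V') x) eqn:Z3; [|easy].
        apply (subm_tb _ _ _ E2) in Z3; congruence. }
      destruct Hd as [Hd1 Hd2]; split.
      - unfold CV in Hd1; rewrite tb_ldiff, andb_true_iff, negb_true_iff in Hd1.
        destruct Hd1 as [Hd3 Hd4].
        rewrite tb_ldiff, andb_true_iff, negb_true_iff; split; [exact Hd3|].
        apply SS; split; [exact (proj1 (proj1 HM b d Hd3))|exact Hd4].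
      - apply (conn_mono _ SC); [exact SS|].
        assert (tr := conn_trans (joined xl xr yb yt Fr) SC).
        assert (sy := conn_sym _ (joined_sym xl xr yb yt Fr Fr_sym) SC).
        exact (tr _ _ _ (sy _ _ (proj2 Hd')) (tr _ _ _ (proj2 Hs)
          (tr _ _ _ (sy _ _ K1) Hd2))). }
    destruct (Step A B L _ Hv' HM Hm HO HP) as (S1 & S2 & S3).
    exact (IH _ _ _ Hv' S1 Hp S2 S3). }
  destruct K2 as [K2|K2].
  + exact (Main e1 p1 s1 IH1 K2 X6 X7).
  + exact (Main e2 p2 s2 IH2 K2 X8 X9).
Qed.

End PlanSound.

(** * Patterns and the case distinction *)

(* [Pat A B er et eb ar at' ab p]: the cells of [A] (resp. [B]) have label true
   (resp. false), at least [er] columns exist to the right of [(1, 0)] and [et]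
   (resp. [eb]) rows above (resp. below); where nonzero, [ar], [at'] and [ab]
   are the distances of the first missing column and rows. *)
Inductive pattern := Pat (A B er et eb ar at' ab : N) (p : plan).

Definition right_masks := Eval vm_compute in
  [0%N; rect_mask 2 5 (-4) 4; rect_mask 3 5 (-4) 4; rect_mask 4 5 (-4) 4;
   rect_mask 5 5 (-4) 4].
Definition top_masks := Eval vm_compute in
  [0%N; rect_mask (-4) 5 1 4; rect_mask (-4) 5 2 4; rect_mask (-4) 5 3 4;
   rect_mask (-4) 5 4 4].
Definition bottom_masks := Eval vm_compute in
  [0%N; rect_mask (-4) 5 (-4) (-1); rect_mask (-4) 5 (-4) (-2);
   rect_mask (-4) 5 (-4) (-3); rect_mask (-4) 5 (-4) (-4)].

Definition line_mask (l : list N) (k : N) : N := nth (N.to_nat k) l 0%N.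

Definition pattern_ok (p : pattern) : bool :=
  let '(Pat A B er et eb ar at' ab p) := p in
  let M := N.lor A B in
  let K := N.lor M (N.lor (line_mask right_masks ar) (N.lor (line_mask top_masks at') (line_mask bottom_masks ab))) in
  subm A win_mask && subm B win_mask &&
  N.ltb er 4 && N.ltb et 4 && N.ltb eb 4 && N.ltb ar 5 && N.ltb at' 5 && N.ltb ab 5 &&
  N.eqb (N.land M (line_mask right_masks (er + 1))) 0 &&
  N.eqb (N.land M (line_mask top_masks (et + 1))) 0 &&
  N.eqb (N.land M (line_mask bottom_masks (eb + 1))) 0 &&
  plan_ok B K A B p.

(* The variables of the case distinction: bit [i < 90] is the label of
   [cell_of i], bits [90 + k], [95 + k], [100 + k] say that the [k]-th line to
   the right, above, below exists.  A clause [(T, F)] describes a partial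
   assignment. *)
Definition line (base k : N) : N := if N.eqb k 0 then 0%N else bit (base + k).

Definition clause_of (p : pattern) : N * N :=
  let '(Pat A B er et eb ar at' ab _) := p in
  (N.lor A (N.lor (line 90 er) (N.lor (line 95 et) (line 100 eb))),
   N.lor B (N.lor (line 90 ar) (N.lor (line 95 at') (line 100 ab)))).

Definition reflect_idx (i : N) : N := ((8 - i / 10) * 10 + i mod 10)%N.

Definition reflect_mask (m : N) : N :=
  fold_right N.lor 0%N
    (map (fun k => N.shiftl (N.land (N.shiftr m (10 * k)) 1023) (10 * (8 - k)))
      [0; 1; 2; 3; 4; 5; 6; 7; 8]%N).

Definition reflect_exch (e : exch) : exch :=
  let '(Ex V P Q R d1 d2) := e in
  let f := map reflect_idx in
  Ex (f V) (f P) (f Q) (f R) (reflect_idx d1) (reflect_idx d2).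

Fixpoint reflect_plan (p : plan) : plan :=
  match p with
  | Done => Done
  | Checkerboard i => Checkerboard (reflect_idx i - 10)
  | Closed s t => Closed (reflect_idx s) (reflect_idx t)
  | Flip i s p => Flip (reflect_idx i) (reflect_idx s) (reflect_plan p)
  | Exchange e p => Exchange (reflect_exch e) (reflect_plan p)
  | Dichotomy V y s1 s2 e1 p1 e2 p2 =>
      Dichotomy (map reflect_idx V) (reflect_idx y) (reflect_idx s1) (reflect_idx s2)
        (reflect_exch e1) (reflect_plan p1) (reflect_exch e2) (reflect_plan p2)
  end.

Definition reflect_pattern (p : pattern) : pattern :=
  let '(Pat A B er et eb ar at' ab p) := p in
  Pat (reflect_mask A) (reflect_mask B) er eb et ar ab at' (reflect_plan p).

Definition checkerboards : list pattern :=
  flat_map (fun x => flat_map (fun y =>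
    let i := idx (x, y) in
    let a := N.lor (bit i) (bit (i + 11)) in
    let b := N.lor (bit (i + 1)) (bit (i + 10)) in
    let p a b := Pat a b (Z.to_N x) (Z.to_N (y + 1)) (Z.to_N (- y)) 0 0 0 (Checkerboard i) in
    [p a b; p b a]) [-3; -2; -1; 0; 1; 2]) [-3; -2; -1; 0; 1; 2; 3].

Definition base_clauses : list (N * N) :=
  [(0%N, bit 44); (bit 45, 0%N);
   (bit 92, bit 91); (bit 93, bit 92); (bit 94, bit 93);
   (bit 97, bit 96); (bit 98, bit 97); (bit 99, bit 98);
   (bit 102, bit 101); (bit 103, bit 102); (bit 104, bit 103);
   (0%N, N.lor (bit 99) (bit 104))].

(* A decision tree in prefix notation: [i < 200] branches on bit [i], true branch
   first, and [200 + n] is a leaf where the [n]-th clause holds; [st] is the stack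
   of pending branches. *)
Fixpoint dtree_ok (cl : list (N * N)) (d : list N) (st : list (N * N)) : bool :=
  match d, st with
  | [], [] => true
  | i :: d', (T, F) :: st' =>
      if N.ltb i 200 then dtree_ok cl d' ((N.lor T (bit i), F) :: (T, N.lor F (bit i)) :: st')
      else match nth_error cl (N.to_nat (i - 200)) with
           | Some c => subm (fst c) T && subm (snd c) F && dtree_ok cl d' st'
           | None => false
           end
  | _, _ => false
  end.

(* The patterns and the decision tree were found by a computer search that
   repeatedly asked for a labelling matching none of the patterns known so far. *)
Definition patterns : list pattern := (
[Pat 0x100000000000 0x80200000000000 0 1 0 1 0 1 (Flip 45 55 Done);
Pat 0x180000000000 0x18260000000000 0 1 0 0 0 1 (Flip 42 41 Done);
Pat 0x180000000000 0x40200000000000 0 1 0 0 0 1 (Flip 44 43 Done);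
Pat 0x1a0000000000 0x10240000000000 0 1 0 0 0 1 (Flip 42 52 Done);
Pat 0x140080000000 0x200300000000 0 0 1 0 0 2 (Flip 32 33 Done);
Pat 0x180100000000 0x200600000000 0 0 1 0 0 2 (Flip 33 34 Done);
Pat 0x100200000000 0x200c00000000 0 0 1 0 0 2 (Flip 34 35 Done);
Pat 0x100400000000 0x200800000000 0 0 1 1 0 2 (Flip 35 45 Done);
Pat 0x40100000000000 0x280000000000 0 1 0 0 0 1 (Flip 44 54 Done);
Pat 0x180400000000 0x200300000000 0 0 1 0 0 2 (Flip 33 32 Done);
Pat 0x100500000000 0x280200000000 0 0 1 0 0 2 (Flip 33 43 Done);
Pat 0x180500000000 0x200200000000 0 0 1 0 0 2 (Closed 33 45);
Pat 0x60180000000000 0x200000000000 0 1 0 0 0 1 (Flip 44 43 Done);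
Pat 0x80100000000000 0x20200000000000 0 1 0 1 0 1 (Closed 45 53);
Pat 0x100000000000 0x180600000000000 1 1 0 0 0 1 (Flip 45 46 Done);
Pat 0x500000000000 0x201800000000 1 0 1 2 0 2 (Flip 36 35 Done);
Pat 0x500000000000 0x80200000000000 1 1 0 0 0 1 (Flip 45 55 Done);
Pat 0x100400000000 0x601800000000 1 0 1 0 0 2 (Flip 35 36 Done);
Pat 0x80100000000000 0x600000000000 1 1 0 0 0 1 (Flip 45 46 Done);
Pat 0x80500000000000 0x20200000000000 1 1 0 0 0 1 (Closed 45 53);
Pat 0x101000000000 0x600800000000 1 0 1 2 0 2 (Closed 36 44);
Pat 0x100100000000000 0x40280000000000 1 1 0 0 0 1 (Closed 44 56);
Pat 0x101400000000 0x200800000000 1 0 1 0 0 2 (Flip 35 45 Done);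
Pat 0x900000000000 0x203000000000 2 0 1 3 0 2 (Flip 37 36 Done);
Pat 0x101000000000 0x602800000000 2 0 1 0 0 2 (Closed 36 44);
Pat 0x101000000000 0xa02000000000 2 0 1 3 0 2 (Flip 37 47 Done);
Pat 0x502000000000 0x201800000000 2 0 1 0 0 2 (Flip 36 35 Done);
Pat 0x102800000000 0x601000000000 2 0 1 0 0 2 (Flip 36 46 Done);
Pat 0x140000000000 0x200380e00000 0 0 2 0 0 0 (Flip 32 22 Done);
Pat 0x140080000000 0x200300c00000 0 0 2 0 0 0 (Flip 32 22 Done);
Pat 0x10100000000000 0x4028240000000000 0 2 0 0 0 0 (Closed 52 44);
Pat 0x100200000000 0x200c03000000 0 0 2 0 0 0 (Flip 34 24 Done);
Pat 0x20140000000000 0x6018200000000000 0 2 0 0 0 0 (Flip 52 51 Done);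
Pat 0x28140000000000 0x4010200000000000 0 2 0 0 0 0 (Flip 52 62 Done);
Pat 0x100400000000 0x2c0300c00000 0 0 2 0 0 0 (Flip 33 23 Done);
Pat 0x180400000000 0x200300c00000 0 0 2 0 0 0 (Flip 33 23 Done);
Pat 0x50180000000000 0x8020200000000000 0 2 0 0 0 0 (Flip 53 63 Done);
Pat 0x100000200000 0x200300c00000 0 0 2 0 0 3 (Flip 22 23 Done);
Pat 0x4000100000000000 0x382e0000000000 0 2 0 0 0 0 (Flip 52 42 Done);
Pat 0x4008100000000000 0x302c0000000000 0 2 0 0 0 0 (Flip 52 42 Done);
Pat 0x4008140000000000 0x30200000000000 0 2 0 0 0 0 (Flip 52 53 Done);
Pat 0x4020100000000000 0x18260000000000 0 2 0 0 0 0 (Flip 52 42 Done);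
Pat 0x100200400000 0x200001800000 0 0 2 0 0 3 (Flip 23 24 Done);
Pat 0x140200400000 0x200180000000 0 0 2 0 0 0 (Flip 32 31 Done);
Pat 0x4028100000000000 0x10240000000000 0 2 0 0 0 0 (Flip 52 42 Done);
Pat 0x4028140000000000 0x10200000000000 0 2 0 0 0 0 (Closed 52 45);
Pat 0x4040180000000000 0x100a0240000000000 0 2 0 0 0 1 (Closed 43 62);
Pat 0x8040100000000000 0x302c0000000000 0 2 0 0 0 0 (Flip 53 43 Done);
Pat 0x100400800000 0x200003000000 0 0 2 0 0 3 (Flip 24 25 Done);
Pat 0x180400800000 0x200300000000 0 0 2 0 0 0 (Flip 33 32 Done);
Pat 0x8050100000000000 0x20280000000000 0 2 0 0 0 0 (Flip 53 43 Done);
Pat 0x180500800000 0x200200000000 0 0 2 0 0 0 (Closed 33 45);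
Pat 0x100001000000 0x200802000000 0 0 2 1 0 3 (Flip 25 35 Done);
Pat 0x100201000000 0x200c00000000 0 0 2 0 0 0 (Flip 34 35 Done);
Pat 0x100201000000 0x200000c00000 0 0 2 0 0 3 (Flip 23 22 Done);
Pat 0x100001400000 0x200200800000 0 0 2 0 0 3 (Flip 23 33 Done);
Pat 0x100002000000 0x200801000000 0 0 2 1 0 3 (Closed 25 44);
Pat 0x100402000000 0x200800000000 0 0 2 1 0 0 (Flip 35 45 Done);
Pat 0x100402000000 0x200001800000 0 0 2 0 0 3 (Flip 24 23 Done);
Pat 0x100002800000 0x200401000000 0 0 2 0 0 3 (Flip 24 34 Done);
Pat 0x500000000000 0x60180200000000000 1 2 0 2 0 0 (Flip 56 55 Done);
Pat 0x100400000000 0x601806000000 1 0 2 0 0 0 (Flip 35 25 Done);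
Pat 0x101000000000 0x600804000000 1 0 2 2 0 0 (Closed 36 44);
Pat 0x1401c0000000000 0x380a0200000000000 1 2 0 0 0 1 (Exchange (Ex [55] [43;44] [54;55;56]
[45;55;65] 42 54) Done);
Pat 0x100402000000 0x601800000000 1 0 2 0 0 0 (Flip 35 36 Done);
Pat 0x101402000000 0x200800000000 1 0 2 0 0 0 (Flip 35 45 Done);
Pat 0x100004000000 0x601800000000 1 0 2 2 0 0 (Flip 36 35 Done);
Pat 0x40000500000000000 0x180200000000000 1 2 0 2 0 0 (Flip 56 55 Done);
Pat 0x100804000000 0x200003000000 1 0 2 0 0 3 (Flip 25 24 Done);
Pat 0x100005000000 0x200802000000 1 0 2 0 0 3 (Flip 25 35 Done);
Pat 0x100800000000 0xe0300c000000 2 0 2 0 0 0 (Flip 36 26 Done);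
Pat 0x100100000000000 0x40280600000000000 2 2 0 0 0 0 (Closed 56 44);
Pat 0x102000000000 0x20000c000000 2 0 2 3 0 3 (Flip 27 26 Done);
Pat 0x200500000000000 0x60180200000000000 2 2 0 0 0 0 (Flip 56 55 Done);
Pat 0x100004000000 0xe03800000000 2 0 2 0 0 0 (Flip 36 35 Done);
Pat 0x100004000000 0x202008000000 2 0 2 3 0 3 (Flip 27 37 Done);
Pat 0x40080100000000000 0x300e00000000000 2 2 0 0 0 0 (Flip 56 46 Done);
Pat 0x40200100000000000 0x180600000000000 2 2 0 0 0 0 (Flip 56 46 Done);
Pat 0x102004000000 0x200008000000 2 0 2 3 0 3 (Closed 27 45);
Pat 0x502004000000 0x201800000000 2 0 2 0 0 0 (Flip 36 35 Done);
Pat 0x40280100000000000 0x100600000000000 2 2 0 0 0 0 (Flip 56 46 Done);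
Pat 0x900008000000 0x203000000000 2 0 2 3 0 0 (Flip 37 36 Done);
Pat 0x80100100000000000 0x200a00000000000 2 2 0 3 0 0 (Flip 57 47 Done);
Pat 0x101008000000 0x200006000000 2 0 2 0 0 3 (Flip 26 25 Done);
Pat 0x300100000000000 0xc0480e00000000000 3 2 0 0 0 0 (Closed 56 44);
Pat 0x107001000000 0xe0080e000000 3 0 2 0 0 3 (Exchange (Ex [25;26] [37] [24;25;26;36] [27;26;25;35]
36 38) Done);
Pat 0x102004000000 0x200018000000 3 0 2 0 0 3 (Flip 27 28 Done);
Pat 0x100008000000 0x1e07000000000 3 0 2 0 0 0 (Flip 37 36 Done);
Pat 0x104008000000 0xe03000000000 3 0 2 0 0 0 (Flip 37 36 Done);
Pat 0x80400900000000000 0x300200000000000 3 2 0 0 0 0 (Flip 57 56 Done);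
Pat 0x102014000000 0x200008000000 3 0 2 0 0 3 (Closed 27 45);
Pat 0x100400000000 0x20000380e000 0 0 3 0 0 0 (Flip 24 14 Done);
Pat 0x100001000000 0x200300c03000 0 0 3 0 0 0 (Flip 23 13 Done);
Pat 0x140401c0000000000 0x2008038200000000000 0 3 0 0 0 1 (Dichotomy [43;44] 62 42 54 (Ex [43;44] [63]
[45;44;43;53] [42;43;44;54] 53 73) Done (Ex [43;44] [52] [45;44;43;53] [42;43;44;54] 51 53) Done);
Pat 0x14048180000000000 0x20080b0260000000000 0 3 0 0 0 1 (Dichotomy [44;54] 62 43 64 (Ex [44;54] [63]
[45;44;54;53] [43;44;54;64] 53 73) Done (Ex [44;54] [42;52] [45;44;54;53] [43;44;54;64] 41 53)
Done);
Pat 0x100402000000 0x200001806000 0 0 3 0 0 0 (Flip 24 14 Done);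
Pat 0x100000001000 0x200380e00000 0 0 3 0 0 0 (Flip 22 21 Done);
Pat 0x100000201000 0x200300c00000 0 0 3 0 0 0 (Flip 22 23 Done);
Pat 0x100a000100000000000 0x4010200000000000 0 3 0 0 0 0 (Flip 62 52 Done);
Pat 0x2010000100000000000 0xc030200000000000 0 3 0 0 0 0 (Flip 63 53 Done);
Pat 0x2010020100000000000 0xc000200000000000 0 3 0 0 0 0 (Flip 63 62 Done);
Pat 0x100001402000 0x200200800000 0 0 3 0 0 0 (Flip 23 33 Done);
Pat 0x100400804000 0x200003000000 0 0 3 0 0 0 (Flip 24 25 Done);
Pat 0x100402004000 0x200001800000 0 0 3 0 0 0 (Flip 24 23 Done);
Pat 0x4028000100000000000 0x10040200000000000 0 3 0 0 0 0 (Flip 64 54 Done);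
Pat 0x100001008000 0x200802000000 0 0 3 1 0 0 (Flip 25 35 Done);
Pat 0x100801000000 0x200006018000 1 0 3 0 0 0 (Flip 25 15 Done);
Pat 0x40080100000000000 0xc030000200000000000 1 3 0 0 0 0 (Flip 65 64 Done);
Pat 0x50080100000000000 0x8020000200000000000 1 3 0 0 0 0 (Flip 65 75 Done);
Pat 0x100804008000 0x200003000000 1 0 3 0 0 0 (Flip 25 24 Done);
Pat 0x100005008000 0x200802000000 1 0 3 0 0 0 (Flip 25 35 Done);
Pat 0x40100100000000000 0x100a0280600000000000 2 3 0 0 0 0 (Closed 56 44);
Pat 0x102004000000 0x200008020000 2 0 3 3 0 0 (Flip 27 17 Done);
Pat 0x10080100100000000000 0x60000200000000000 2 3 0 0 0 0 (Flip 66 65 Done);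
Pat 0x102004020000 0x200008000000 2 0 3 3 0 0 (Closed 27 45);
Pat 0x40300100000000000 0x100a0480e00000000000 3 3 0 0 0 0 (Closed 56 44);
Pat 0x102014000000 0x200008020000 3 0 3 0 0 0 (Flip 27 17 Done);
Pat 0x102004020000 0x200018000000 3 0 3 0 0 0 (Flip 27 28 Done);
Pat 0x20140200100000000000 0x80000200000000000 3 3 0 0 0 0 (Closed 67 45);
Pat 0x100800000000 0xe03000000000 2 0 1 0 0 2 (Flip 36 37 Done);
Pat 0x100000000000 0x302c0300000000 0 1 1 0 0 0 (Flip 43 33 Done);
Pat 0x10100000000000 0x40280400000000 0 1 1 0 0 0 (Closed 44 52);
Pat 0x20100000000000 0x2c0300000000 0 1 1 0 0 0 (Flip 43 33 Done);
Pat 0x100400000000 0x40280000000000 0 1 1 0 0 0 (Flip 44 34 Done);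
Pat 0x100800000000 0x80200000000000 0 1 1 1 0 0 (Flip 45 55 Done);
Pat 0x120100000000 0x302c0000000000 0 1 1 0 0 0 (Flip 42 43 Done);
Pat 0x140000000000 0x102a0100000000 0 1 1 0 0 0 (Closed 42 44);
Pat 0x140000000000 0x40280400000000 0 1 1 0 0 0 (Closed 44 42);
Pat 0x20140000000000 0x280200000000 0 1 1 0 0 0 (Flip 43 33 Done);
Pat 0x180000000000 0x18260180000000 0 1 1 0 0 0 (Flip 42 32 Done);
Pat 0x180000000000 0x40200400000000 0 1 1 0 0 0 (Flip 44 43 Done);
Pat 0x10180000000000 0x260180000000 0 1 1 0 0 0 (Flip 42 32 Done);
Pat 0x180400000000 0x60240200000000 0 1 1 0 0 0 (Flip 43 44 (Flip 44 34 Done));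
Pat 0x60180000000000 0x200400000000 0 1 1 0 0 0 (Flip 44 43 Done);
Pat 0x101a0000000000 0x240100000000 0 1 1 0 0 0 (Flip 42 32 Done);
Pat 0x10120100000000 0x2c0000000000 0 1 1 0 0 0 (Flip 42 43 Done);
Pat 0x20100200000000 0x2c0000000000 0 1 1 0 0 0 (Flip 43 42 Done);
Pat 0x20140200000000 0x280000000000 0 1 1 0 0 0 (Closed 43 45);
Pat 0x60180600000000 0x200000000000 0 1 1 0 0 0 (Flip 44 34 Done);
Pat 0x80100800000000 0x200200000000 0 1 1 1 0 0 (Closed 45 33);
Pat 0x80100800000000 0x280000000000 0 1 1 1 0 0 (Closed 45 43);
Pat 0x100000000000 0x180601800000000 1 1 1 0 0 0 (Flip 45 35 Done);
Pat 0x80100000000000 0x601800000000 1 1 1 0 0 0 (Flip 45 35 Done);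
Pat 0x100100000000000 0x601800000000 1 1 1 2 0 0 (Flip 46 36 Done);
Pat 0x500000000000 0x100201000000000 1 1 1 2 0 0 (Closed 46 44);
Pat 0x80500000000000 0x200800000000 1 1 1 0 0 0 (Flip 45 35 Done);
Pat 0x80100800000000 0x600000000000 1 1 1 0 0 0 (Flip 45 46 Done);
Pat 0x80500800000000 0x10200000000000 1 1 1 0 0 0 (Closed 45 52);
Pat 0x80500800000000 0x280000000000 1 1 1 0 0 0 (Closed 45 43);
Pat 0x100101000000000 0x600000000000 1 1 1 2 0 0 (Flip 46 45 Done);
Pat 0x102000000000 0x300e00000000000 2 1 1 3 0 0 (Flip 47 46 Done);
Pat 0x500000000000 0x100a01000000000 2 1 1 0 0 0 (Closed 46 44);
Pat 0x200500000000000 0xa02000000000 2 1 1 3 0 0 (Flip 47 37 Done);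
Pat 0x901000000000 0x180600000000000 2 1 1 0 0 0 (Flip 46 45 Done);
Pat 0xd00000000000 0x300203000000000 2 1 1 3 0 0 (Closed 46 44);
Pat 0x100901000000000 0x600000000000 2 1 1 0 0 0 (Flip 46 45 Done);
Pat 0x200102000000000 0xe00000000000 2 1 1 3 0 0 (Flip 47 46 Done);
Pat 0xd00000000000 0x301203000000000 3 1 1 0 0 0 (Closed 46 44);
Pat 0x201100000000000 0xe03000000000 3 1 1 0 0 0 (Flip 47 37 Done);
Pat 0x1d00000000000 0x380203800000000 3 1 1 0 0 0 (Exchange (Ex [45] [47] [44;45;46] [35;45;55] 46
48) Done);
Pat 0x201102000000000 0xe00000000000 3 1 1 0 0 0 (Flip 47 46 Done);
Pat 0x28180400000000 0x1c050240200000000 0 2 1 0 0 0 (Exchange (Ex [52] [43;44] [51;52;53]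
[42;52;62] 34 53) Done);
Pat 0x40180600000000 0x100a0200000000000 0 2 1 0 0 0 (Flip 54 44 (Flip 44 34 Done));
Pat 0x40100500000000 0x280a03800000 0 1 2 0 0 0 (Exchange (Ex [33] [44] [32;33;34] [23;33;43] 34 54)
Done);
Pat 0x70100500000000 0x2e0200800000 0 1 2 0 0 0 (Dichotomy [44] 32 34 54 (Ex [44] [42] [43;44;45]
[34;44;54] 41 43) Done (Ex [44] [33] [43;44;45] [34;44;54] 23 43) Done);
Pat 0x68100400000000 0x1c0902c0000000000 0 2 1 0 0 0 (Exchange (Ex [52] [44;54] [51;52;53]
[42;52;62] 34 53) Done);
Pat 0x40180680000000 0x20240903c00000 0 1 2 0 0 0 (Exchange (Ex [32] [43;44] [31;32;33] [22;32;42]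
33 54) Done);
Pat 0x40100400400000 0x280a03800000 0 1 2 0 0 3 (Exchange (Ex [23;24] [44] [22;23;24;34]
[25;24;23;33] 34 54) Done);
Pat 0x20180400400000 0x40240a03800000 0 1 2 0 0 3 (Exchange (Ex [23;24] [43;44] [22;23;24;34]
[25;24;23;33] 34 53) Done);
Pat 0x40180400400000 0x20240a03800000 0 1 2 0 0 3 (Exchange (Ex [23;24] [43;44] [22;23;24;34]
[25;24;23;33] 34 54) Done);
Pat 0x1c0400400000 0x78220380000000 0 1 2 0 0 0 (Exchange (Ex [32] [43;44] [22;32;42] [31;32;33] 34
42) Done);
Pat 0x1c0400400000 0x60200383800000 0 1 2 0 0 3 (Dichotomy [43;44] 22 34 42 (Ex [43;44] [32] [33;43;53]
[34;44;43;42] 31 33) Done (Ex [43] [23;24] [33;43;53] [42;43;44] 25 33) Done);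
Pat 0x1c0400400000 0x60200a03800000 0 1 2 0 0 3 (Exchange (Ex [23;24] [43;44] [22;23;24;34]
[25;24;23;33] 34 42) Done);
Pat 0x301c0400400000 0x40200a03800000 0 1 2 0 0 3 (Exchange (Ex [23;24] [43;44] [22;23;24;34]
[25;24;23;33] 34 42) Done);
Pat 0x20180480400000 0x40240b03800000 0 1 2 0 0 0 (Exchange (Ex [32;33] [43;44] [22;32;33;34]
[23;33;32;42] 34 53) Done);
Pat 0x4048180300000000 0x8030260400000000 0 2 1 0 0 0 (Dichotomy [43;44] 62 33 54 (Ex [43;44] [52;53]
[42;43;44;45] [33;43;44;54] 42 63) Done (Ex [43;44] [42;52] [34;44;43;53] [33;43;44;54] 41 53)
Done);
Pat 0x4048180700000000 0x8030260000000000 0 2 1 0 0 0 (Dichotomy [43;44] 62 33 54 (Ex [43;44] [52;53]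
[42;43;44;45] [33;43;44;54] 42 63) Done (Ex [43;44] [42;52] [45;44;43;53] [33;43;44;54] 41 53)
Done);
Pat 0x10050100600000000 0x80a02e0180000000 0 2 1 0 0 0 (Dichotomy [44;54] 52 34 64 (Ex [44] [53]
[43;44;45] [34;44;54] 43 63) Done (Ex [44;54] [42;43] [45;44;54;53] [34;44;54;64] 32 53) Done);
Pat 0x10050120600000000 0x80a02c0100000000 0 2 1 0 0 0 (Dichotomy [44;54] 52 34 64 (Ex [44] [53]
[43;44;45] [34;44;54] 43 63) Done (Ex [44;54] [42;43] [45;44;54;53] [34;44;54;64] 32 53) Done);
Pat 0x14048180600000000 0x80b0260180000000 0 2 1 0 0 0 (Dichotomy [43;44;54] 62 33 64 (Ex [43;44]
[52;53] [42;43;44;45] [33;43;44;54] 42 63) Done (Ex [44;54] [42;52] [45;44;54;53] [34;44;54;64] 32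
53) Done);
Pat 0x140481a0600000000 0x80b0240100000000 0 2 1 0 0 0 (Dichotomy [43;44;54] 62 33 64 (Ex [43;44]
[52;53] [42;43;44;45] [33;43;44;54] 42 63) Done (Ex [44;54] [42;52] [45;44;54;53] [34;44;54;64] 32
53) Done);
Pat 0x1c1000000000 0x380a0200e00000000 1 2 1 0 0 2 (Exchange (Ex [34;35] [43] [36;35;34;44]
[33;34;35;45] 42 44) Done);
Pat 0x5c0000000000 0xe0200a03800000 1 1 2 0 0 0 (Exchange (Ex [45] [43] [44;45;46] [35;45;55] 42 44)
Done);
Pat 0x160180c00000000 0x601207000000 1 1 2 2 0 0 (Exchange (Ex [36;46] [34;44] [35;36;46;56]
[26;36;46;45] 35 43) Done);
Pat 0x140100400000000 0x380a0280000000000 1 2 1 0 0 0 (Exchange (Ex [55] [44] [54;55;56] [45;55;65]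
34 54) Done);
Pat 0x1c1400000000 0x60200a03800000 1 1 2 0 0 0 (Exchange (Ex [35] [43;44] [34;35;36] [25;35;45] 34
42) Done);
Pat 0x301c1400000000 0x40200a03800000 1 1 2 0 0 0 (Exchange (Ex [35] [43;44] [34;35;36] [25;35;45]
34 42) Done);
Pat 0x1c01e1000000000 0x30030200f00000000 1 2 1 0 0 2 (Dichotomy [42;43;44;54;55] 36 41 56 (Ex [42]
[34;35] [32;42;52] [41;42;43] 33 45) Done (Ex [55] [34;35] [45;55;65] [54;55;56] 33 45) Done);
Pat 0x10140500400000000 0x200a0280800000000 1 2 1 0 0 0 (Dichotomy [44;54] 46 34 64 (Ex [44] [55]
[43;44;45] [34;44;54] 45 65) Done (Ex [54] [45] [53;54;55] [44;54;64] 35 55) Done);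
Pat 0x40181202000000 0x20240d01c00000 1 1 2 0 0 0 (Exchange (Ex [34;35] [43;44] [33;34;35;36]
[24;34;35;45] 33 54) Done);
Pat 0x28120180c00000000 0x100d0640200000000 1 2 1 0 0 0 (Dichotomy [43;44;53] 56 34 63 (Ex [43;44]
[54;55] [33;43;44;45] [34;44;43;53] 45 64) Done (Ex [43;53] [45;55] [33;43;53;54] [44;43;53;63] 46
54) Done);
Pat 0x80101004000000 0x600800000000 1 1 2 2 0 0 (Flip 36 26 (Flip 45 35 Done));
Pat 0x801c1000000000 0x78320e00e00000000 2 2 1 0 0 0 (Exchange (Ex [45;46] [43] [36;46;45;44]
[35;45;46;47] 42 44) Done);
Pat 0x809c1000000000 0x78120600e00000000 2 2 1 0 0 0 (Exchange (Ex [45;46] [43] [44;45;46;47]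
[35;45;46;56] 42 44) Done);
Pat 0xc0981600000000 0xf0320600000000000 2 2 1 0 0 0 (Exchange (Ex [46;56] [44;54] [36;46;56;55]
[45;46;56;57] 34 55) Done);
Pat 0x100500000000000 0x40280a01000000000 2 2 1 0 0 0 (Closed 46 44);
Pat 0x140101c00000000 0x20080e80000000000 2 2 1 0 0 0 (Dichotomy [44] 56 34 54 (Ex [44] [55] [43;44;45]
[34;44;54] 45 65) Done (Ex [44] [46] [43;44;45] [34;44;54] 45 47) Done);
Pat 0x140500400000000 0x20080283800000000 2 2 1 0 0 2 (Dichotomy [44] 46 34 54 (Ex [44] [55] [43;44;45]
[34;44;54] 45 65) Done (Ex [44] [35;36] [43;44;45] [34;44;54] 37 45) Done);
Pat 0x140900c00000000 0x20080683000000000 2 2 1 0 0 2 (Dichotomy [44] 56 34 54 (Ex [44] [55] [43;44;45]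
[34;44;54] 45 65) Done (Ex [44] [36;46] [43;44;45] [34;44;54] 37 45) Done);
Pat 0x100181c00000000 0x40e0220f000000 2 1 2 0 0 0 (Exchange (Ex [46] [34;44] [36;46;56] [45;46;47]
35 43) Done);
Pat 0x2c0180000000000 0x70120600400000000 2 2 1 0 0 0 (Exchange (Ex [56] [44;54] [55;56;57]
[46;56;66] 43 55) Done);
Pat 0x60182c00000000 0x601207000000 2 1 2 0 0 0 (Exchange (Ex [36] [34;44] [35;36;37] [26;36;46] 35
43) Done);
Pat 0x80103000000000 0x600804000000 2 1 2 0 0 0 (Flip 36 37 (Flip 45 35 Done));
Pat 0x40502403000000 0x80281a04000000 2 1 2 0 0 0 (Dichotomy [34;44] 46 24 54 (Ex [34] [45] [33;34;35]
[24;34;44] 35 55) Done (Ex [34;44] [35;36] [33;34;44;45] [24;34;44;54] 26 45) Done);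
Pat 0x60582403000000 0x80201a04000000 2 1 2 0 0 0 (Dichotomy [34;44] 46 24 43 (Ex [34] [45] [33;34;35]
[24;34;44] 35 55) Done (Ex [34;44] [35;36] [33;34;44;45] [24;34;44;43] 26 45) Done);
Pat 0x80101004000000 0x602800000000 2 1 2 0 0 0 (Flip 36 26 (Flip 45 35 Done));
Pat 0x501004000000 0x380a02800000000 2 1 2 0 0 0 (Exchange (Ex [45] [36] [44;45;46] [35;45;55] 26
46) Done);
Pat 0x60180c08000000 0x601207000000 2 1 2 0 0 3 (Exchange (Ex [25;26] [34;44] [27;26;25;35]
[24;25;26;36] 35 43) Done);
Pat 0xc0300100800000000 0x80600000000000 2 2 1 0 0 0 (Flip 56 57 (Flip 45 46 Done));
Pat 0x200d00000000000 0x80501203000000000 3 2 1 0 0 0 (Closed 46 44);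
Pat 0x1d02000000000 0x380205808000000 3 1 2 0 0 0 (Exchange (Ex [45] [37;47] [44;45;46] [35;45;55]
46 48) Done);
Pat 0xd06000000000 0x381201808000000 3 1 2 0 0 0 (Exchange (Ex [45] [37;47] [44;45;46] [35;45;55] 38
46) Done);
Pat 0x1d06000000000 0x380201808000000 3 1 2 0 0 0 (Exchange (Ex [45] [37;47] [44;45;46] [35;45;55]
38 46) Done);
Pat 0x40300900800000000 0x80481607000000000 3 2 1 0 0 0 (Exchange (Ex [45;46] [56;57] [35;45;46;47]
[36;46;45;55] 47 66) Done);
Pat 0x40301900800000000 0x80480603000000000 3 2 1 0 0 0 (Dichotomy [47;56;57] 44 48 66 (Ex [47;57]
[45;46] [37;47;57;58] [48;47;57;56] 36 55) Done (Ex [56;57] [45;46] [55;56;57;58] [47;57;56;66] 36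
55) Done);
Pat 0x40701900800000000 0x80080603000000000 3 2 1 0 0 0 (Dichotomy [47;56;57] 44 48 66 (Ex [47;57]
[45;46] [37;47;57;67] [48;47;57;56] 36 55) Done (Ex [56;57] [45;46] [55;56;57;67] [47;57;56;66] 36
55) Done);
Pat 0x60300900800000000 0x804c0601000000000 3 2 1 0 0 0 (Dichotomy [56;57] 44 47 66 (Ex [56;57] [45;55]
[46;56;57;58] [47;57;56;66] 46 54) Done (Ex [56;57] [45;46] [55;56;57;58] [47;57;56;66] 36 55)
Done);
Pat 0x50100400000000 0xe0280a0280000000000 0 3 1 0 0 0 (Exchange (Ex [53] [44] [52;53;54] [43;53;63]
34 54) Done);
Pat 0x40100680000000 0x2c0901407000 0 1 3 0 0 0 (Exchange (Ex [32] [34;44] [31;32;33] [22;32;42] 33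
54) Done);
Pat 0x40180680000000 0x20240903407000 0 1 3 0 0 0 (Exchange (Ex [32] [43;44] [31;32;33] [22;32;42]
33 54) Done);
Pat 0x20180400400000 0x40240b03806000 0 1 3 0 0 0 (Exchange (Ex [23;33] [43;44] [22;23;33;34]
[13;23;33;32] 34 53) Done);
Pat 0x40180400400000 0x20240b03806000 0 1 3 0 0 0 (Exchange (Ex [23;33] [43;44] [22;23;33;34]
[13;23;33;32] 34 54) Done);
Pat 0x401e0400400000 0x30200b83806000 0 1 3 0 0 0 (Dichotomy [42;43] 22 41 44 (Ex [42] [23;33]
[32;42;52] [41;42;43] 13 32) Done (Ex [43] [32] [33;43;53] [42;43;44] 31 33) (Exchange (Ex [23;33]
[44] [22;23;33;34] [13;23;33;43] 34 54) Done));
Pat 0x1e0c00400000 0xf0200301806000 0 1 3 0 0 0 (Dichotomy [23;33] 45 13 32 (Ex [23;33] [42]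
[22;23;33;34] [13;23;33;32] 41 43) Done (Ex [23;33] [34;44] [22;23;33;43] [13;23;33;32] 35 43)
Done);
Pat 0x40100401400000 0x280a0280e000 0 1 3 0 0 0 (Exchange (Ex [23] [34;44] [22;23;24] [13;23;33] 24
54) Done);
Pat 0x180401400000 0x40200a0280e000 0 1 3 0 0 0 (Exchange (Ex [23] [34;44] [22;23;24] [13;23;33] 24
43) Done);
Pat 0x40180401400000 0x20240a0280e000 0 1 3 0 0 0 (Exchange (Ex [23] [43;44] [22;23;24] [13;23;33]
34 54) Done);
Pat 0x60180401400000 0x200a0280e000 0 1 3 0 0 0 (Exchange (Ex [23] [34;44] [22;23;24] [13;23;33] 24
43) Done);
Pat 0x1c0401400000 0x60200380802000 0 1 3 0 0 0 (Dichotomy [43;44] 22 34 42 (Ex [43;44] [32] [33;43;53]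
[34;44;43;42] 31 33) Done (Ex [43;44] [23] [33;43;53] [34;44;43;42] 13 33) Done);
Pat 0x1c0401400000 0x40200b80802000 0 1 3 0 0 0 (Dichotomy [34;44] 22 24 43 (Ex [34;44] [32] [33;34;35]
[24;34;44;43] 31 33) Done (Ex [34;44] [23] [33;34;35] [24;34;44;43] 13 33) Done);
Pat 0x140401c0300000000 0x2008038200400000000 0 3 1 0 0 0 (Dichotomy [43;44] 62 33 54 (Ex [43;44] [63]
[34;44;43;53] [33;43;44;54] 53 73) Done (Ex [43;44] [52] [34;44;43;53] [33;43;44;54] 51 53) Done);
Pat 0x601c0401400000 0x200b80802000 0 1 3 0 0 0 (Dichotomy [34;44] 22 24 43 (Ex [34;44] [32] [33;34;35]
[24;34;44;43] 31 33) Done (Ex [34;44] [23] [33;34;35] [24;34;44;43] 13 33) Done);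
Pat 0x40180202800000 0x20240501407000 0 1 3 0 0 0 (Exchange (Ex [24] [43;44] [23;24;25] [14;24;34]
33 54) Done);
Pat 0x1c0c03400000 0x40200380802000 0 1 3 0 0 0 (Dichotomy [34;44] 22 24 43 (Ex [34;44] [32]
[33;34;44;45] [24;34;44;43] 31 33) Done (Ex [34;44] [23] [33;34;44;45] [24;34;44;43] 13 33) Done);
Pat 0x601c0c03400000 0x200380802000 0 1 3 0 0 0 (Dichotomy [34;44] 22 24 43 (Ex [34;44] [32]
[33;34;44;45] [24;34;44;43] 31 33) Done (Ex [34;44] [23] [33;34;44;45] [24;34;44;43] 13 33) Done);
Pat 0x40100400002000 0x280b03c0c000 0 1 3 0 0 0 (Exchange (Ex [23;24] [44] [13;23;24;34]
[14;24;23;22] 34 54) Done);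
Pat 0x40100400402000 0x280a0380c000 0 1 3 0 0 0 (Exchange (Ex [23;24] [44] [13;23;24;34]
[14;24;23;33] 34 54) Done);
Pat 0x2004040180200000000 0x380b0240400000000 0 3 1 0 0 0 (Exchange (Ex [53;63] [43;44]
[54;53;63;62] [52;53;63;64] 33 54) Done);
Pat 0x40180400402000 0x20240b03800000 0 1 3 0 0 0 (Exchange (Ex [23;33] [43;44] [13;23;33;34]
[24;23;33;32] 34 54) Done);
Pat 0x20040401c0000000000 0xc0380a0200600000000 0 3 1 0 0 0 (Exchange (Ex [63;64] [43;44]
[54;64;63;62] [53;63;64;65] 42 54) Done);
Pat 0x301c0400402000 0x40200a0380c000 0 1 3 0 0 0 (Exchange (Ex [23;24] [43;44] [13;23;24;34]
[14;24;23;33] 34 42) Done);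
Pat 0x20040401e0000000000 0x18038200f00000000 0 3 1 0 0 0 (Dichotomy [52;53;63] 45 51 64 (Ex [52]
[43;44] [42;52;62] [51;52;53] 42 54) Done (Ex [53;63] [42] [43;53;63;62] [52;53;63;64] 41 43) Done);
Pat 0x401e0400402000 0x30200b83800000 0 1 3 0 0 0 (Dichotomy [42;43] 22 41 44 (Ex [42] [23;33]
[32;42;52] [41;42;43] 24 32) Done (Ex [43] [32] [33;43;53] [42;43;44] 31 33) (Exchange (Ex [23;33]
[44] [13;23;33;34] [24;23;33;43] 34 54) Done));
Pat 0x180c02402000 0x40200301804000 0 1 3 0 0 0 (Dichotomy [34;44] 22 35 43 (Ex [34;44] [23;33]
[24;34;44;45] [35;34;44;43] 24 32) Done (Ex [34;44] [23;24] [33;34;44;45] [35;34;44;43] 14 33)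
Done);
Pat 0x40100400004000 0x280a03800000 0 1 3 0 0 0 (Exchange (Ex [24] [44] [14;24;34] [23;24;25] 34 54)
Done);
Pat 0x20180400004000 0x40240a03800000 0 1 3 0 0 0 (Exchange (Ex [24] [43;44] [14;24;34] [23;24;25]
34 53) Done);
Pat 0x40180400004000 0x20240a03800000 0 1 3 0 0 0 (Exchange (Ex [24] [43;44] [14;24;34] [23;24;25]
34 54) Done);
Pat 0x1c0400004000 0x60200a03800000 0 1 3 0 0 0 (Exchange (Ex [24] [43;44] [14;24;34] [23;24;25] 34
42) Done);
Pat 0x40000401c0300000000 0x380a0200400000000 0 3 1 0 0 0 (Exchange (Ex [64] [43;44] [54;64;74]
[63;64;65] 33 54) Done);
Pat 0x60100501004000 0x2c0a02800000 0 1 3 0 0 0 (Dichotomy [24;34;44] 32 14 54 (Ex [24] [33;43]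
[23;24;25] [14;24;34] 23 42) Done (Ex [44] [33] [43;44;45] [34;44;54] 23 43) Done);
Pat 0x40140501004000 0x20280a02800000 0 1 3 0 0 0 (Dichotomy [33;43] 45 23 53 (Ex [33] [44] [32;33;34]
[23;33;43] 34 54) Done (Ex [33;43] [24] [32;33;34] [23;33;43;53] 14 34) Done);
Pat 0x4014040180600000000 0x280b8260000000000 0 3 1 0 0 0 (Dichotomy [43;44;54;64] 62 33 74 (Ex [43;44]
[52;53] [42;43;44;45] [33;43;44;54] 42 63) Done (Ex [64] [52;53] [63;64;65] [54;64;74] 42 63) Done);
Pat 0x20180481404000 0x40240b02802000 0 1 3 0 0 0 (Dichotomy [24;34;43;44] 22 14 53 (Ex [24] [32;33]
[23;24;25] [14;24;34] 23 42) Done (Ex [34;44] [23] [33;34;35] [24;34;44;43] 13 33) Done);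
Pat 0x4014048180400000000 0x280b0240200000000 0 3 1 0 0 0 (Dichotomy [43;44;54;64] 62 34 74 (Ex [43;44]
[52;53] [33;43;44;45] [34;44;54] 42 63) Done (Ex [64] [52;53] [63;64;65] [54;64;74] 42 63) Done);
Pat 0x4014048180600000000 0x280b0240000000000 0 3 1 0 0 0 (Dichotomy [43;44;54;64] 62 33 74 (Ex [43;44]
[52;53] [42;43;44;45] [33;43;44;54] 42 63) Done (Ex [64] [52;53] [63;64;65] [54;64;74] 42 63) Done);
Pat 0x1c0400406000 0x60200383800000 0 1 3 0 0 0 (Dichotomy [43;44] 22 34 42 (Ex [43;44] [32] [33;43;53]
[34;44;43;42] 31 33) Done (Ex [43] [23;24] [33;43;53] [42;43;44] 25 33) Done);
Pat 0x40100400008000 0x280a03800000 0 1 3 1 0 0 (Exchange (Ex [25;35] [44] [15;25;35;34]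
[24;25;35;45] 34 54) Done);
Pat 0x80000401c0000000000 0x380a0200600000000 0 3 1 1 0 0 (Exchange (Ex [55;65] [43;44]
[54;55;65;75] [45;55;65;64] 42 54) Done);
Pat 0x80000401c0300000000 0x380a0200400000000 0 3 1 1 0 0 (Exchange (Ex [55;65] [43;44]
[54;55;65;75] [45;55;65;64] 33 54) Done);
Pat 0x160180400000000 0xe02c090240200000000 1 3 1 0 0 0 (Exchange (Ex [55] [43;44] [54;55;56]
[45;55;65] 34 53) Done);
Pat 0x1c0c01400000 0x40201382802000 1 1 3 0 0 0 (Dichotomy [34;35] 22 24 44 (Ex [34;35] [32]
[33;34;35;36] [24;34;44] 31 33) (Flip 44 43 Done) (Ex [34;35] [23] [33;34;35;36] [24;34;44] 13 33)
(Flip 44 43 Done));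
Pat 0x601c0c01400000 0x201382802000 1 1 3 0 0 0 (Dichotomy [34;35] 22 24 44 (Ex [34;35] [32]
[33;34;35;36] [24;34;44] 31 33) (Flip 44 43 Done) (Ex [34;35] [23] [33;34;35;36] [24;34;44] 13 33)
(Flip 44 43 Done));
Pat 0x40181202802000 0x30240d01400000 1 1 3 0 0 0 (Dichotomy [34;35] 53 24 45 (Ex [34;35] [43;44]
[33;34;35;36] [24;34;35;45] 33 54) Done (Ex [34;35] [23] [33;34;35;36] [24;34;35;45] 13 33) Done);
Pat 0x1c0400004000 0x60601207800000 1 1 3 0 0 0 (Exchange (Ex [24] [43;44] [14;24;34] [23;24;25] 34
42) Done);
Pat 0xe0181401004000 0x640a02800000 1 1 3 0 0 0 (Dichotomy [24;34;43;44] 36 14 53 (Ex [24] [35;45]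
[23;24;25] [14;24;34] 25 46) Done (Ex [43;44] [35] [33;43;44;45] [34;44;43;53] 25 45) Done);
Pat 0x4010140580600000000 0x280a0240800000000 1 3 1 0 0 0 (Dichotomy [43;44;54;64] 46 33 74 (Ex [43;44]
[55] [42;43;44;45] [33;43;44;54] 45 65) Done (Ex [54] [45] [53;54;55] [44;54;64] 35 55) Done);
Pat 0x40581601004000 0xb0240902c00000 1 1 3 0 0 0 (Dichotomy [35;45] 53 25 55 (Ex [35] [43;44]
[34;35;36] [25;35;45] 33 54) Done (Ex [35;45] [24] [34;35;36] [25;35;45;55] 14 34) Done);
Pat 0x1c1c04404000 0x6020038380a000 1 1 3 0 0 0 (Dichotomy [34;35;43;44] 14 36 42 (Ex [35] [24]
[25;35;45] [34;35;36] 23 25) (Dichotomy [24;34;43;44] 22 14 42 (Ex [24] [32;33] [23;24;25] [14;24;34] 23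
31) Done (Ex [34;44] [23] [33;34;35] [24;34;44;43] 13 33) Done) (Ex [34;35] [24;25] [33;34;35;45]
[36;35;34;44] 15 23) (Flip 44 43 Done));
Pat 0x60300900800000000 0x100800c0601000000000 2 3 1 0 0 0 (Dichotomy [56;66] 44 57 65 (Ex [56;66]
[45;55] [46;56;66;67] [57;56;66;65] 46 54) Done (Ex [56;66] [45;46] [55;56;66;67] [57;56;66;65] 36
55) Done);
Pat 0x180181206800000 0xe00d0100c000 2 1 3 0 0 0 (Dichotomy [33] 36 23 43 (Ex [33] [35;45] [32;33;34]
[23;33;43] 34 46) Done (Ex [33] [24] [32;33;34] [23;33;43] 14 34) (Dichotomy [25] 44 24 26 (Ex [25]
[45;46] [15;25;35] [24;25;26] 35 47) Done (Ex [25] [33;34] [15;25;35] [24;25;26] 32 35) Done));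
Pat 0x80103006008000 0x600c09010000 2 1 3 0 0 0 (Dichotomy [35;45] 27 34 46 (Ex [35;45] [26;36]
[25;35;45;44] [34;35;45;46] 25 37) Done (Ex [35;45] [25;26] [36;35;45;44] [34;35;45;46] 15 36)
Done);
Pat 0x200101004010000 0xe0280a000000 2 1 3 3 0 0 (Exchange (Ex [37;47] [26] [36;37;47;57]
[27;37;47;46] 16 36) Done);
Pat 0x18060300100800000000 0x900c0600000000000 2 3 1 0 0 0 (Dichotomy [56;65;66] 44 57 75 (Ex [56;66]
[45;55] [46;56;66;67] [57;56;66;65] 46 54) Done (Ex [65;66] [45;55] [64;65;66;67] [56;66;65;75] 46
54) Done);
Pat 0x180107000000000 0xe0080a038000 3 1 3 0 0 0 (Exchange (Ex [45;46] [37] [36;46;45;44]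
[35;45;46;47] 36 38) Done);
Pat 0x80907000000000 0x30160080a038000 3 1 3 0 0 0 (Exchange (Ex [45;46] [37;47] [36;46;45;44]
[35;45;46;56] 36 38) Done);
Pat 0x80107400000000 0xe0080a038000 3 1 3 0 0 0 (Exchange (Ex [35;45] [37] [34;35;36] [25;35;45;46]
36 38) Done);
Pat 0x10040100101800000000 0x1a0481e00000000000 3 3 1 0 0 0 (Exchange (Ex [45;46] [66] [35;45;46;56]
[47;46;45;55] 56 76) Done);
Pat 0x80101404010000 0x1e0481a000000 3 1 3 0 0 0 (Exchange (Ex [35;45] [26] [34;35;36] [25;35;45;46]
16 36) Done);
Pat 0x180107004010000 0xe0080a000000 3 1 3 0 0 0 (Dichotomy [45;46] 27 35 47 (Ex [45;46] [37]
[36;46;45;44] [35;45;46;47] 36 38) Done (Ex [45;46] [26] [36;46;45;44] [35;45;46;47] 16 36) Done);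
Pat 0x10040700900800000000 0xa0081603000000000 3 3 1 0 0 0 (Dichotomy [47;56;57;66] 44 58 76 (Ex [47;57]
[45;46] [37;47;57;67] [56;57;58] 36 55) Done (Ex [56;66] [45;46] [55;56;66;67] [57;56;66;76] 36 55)
Done);
Pat 0x80107404010000 0xe0080a000000 3 1 3 0 0 0 (Dichotomy [35;45] 27 25 46 (Ex [35;45] [37] [34;35;36]
[25;35;45;46] 36 38) Done (Ex [35;45] [26] [34;35;36] [25;35;45;46] 16 36) Done);
Pat 0x80907006010000 0x201600c09008000 3 1 3 0 0 0 (Dichotomy [35;45] 27 34 46 (Ex [35;45] [37;47]
[25;35;45;44] [34;35;45;46] 36 38) Done (Ex [35;45] [25;26] [36;35;45;44] [34;35;45;46] 16 36)
Done);
Pat 0x400900000000000 0xc0300200000000000 3 2 0 0 0 0 (Flip 57 56 Done);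
Pat 0x40180400400000 0x20641207800000 1 1 2 0 0 3 (Exchange (Ex [23;24] [43;44] [22;23;24;34]
[25;24;23;33] 34 54) Done);
Pat 0x40181400000000 0x20240a03800000 1 1 2 0 0 0 (Exchange (Ex [35] [43;44] [34;35;36] [25;35;45]
34 54) Done);
Pat 0x40181600000000 0x20240903c00000 1 1 2 0 0 0 (Exchange (Ex [35] [43;44] [34;35;36] [25;35;45]
33 54) Done);
Pat 0x580403000000 0xc0203a0c000000 2 1 2 0 0 0 (Dichotomy [34;44] 46 24 43 (Ex [34] [45] [33;34;35]
[24;34;44] 35 55) Done (Ex [34;44] [35;36] [33;34;44;45] [24;34;44;43] 26 45) Done);
Pat 0x70040580000000000 0x3a0200c00000000 2 2 1 0 0 0 (Dichotomy [44;54] 46 43 64 (Ex [44;54] [55;56]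
[34;44;54;53] [43;44;54;64] 45 57) Done (Ex [54] [45] [53;54;55] [44;54;64] 35 55) Done);
Pat 0x30240580000000000 0x401a0200c00000000 2 2 1 0 0 0 (Dichotomy [44;54] 46 43 64 (Ex [44;54] [55;56]
[34;44;54;53] [43;44;54;64] 45 66) Done (Ex [54] [45] [53;54;55] [44;54;64] 35 55) Done);
Pat 0x200d00000000000 0x80100203000000000 2 2 1 3 0 0 (Closed 46 44);
Pat 0x60580403000000 0x80203a0c000000 2 1 2 0 0 0 (Dichotomy [34;44] 46 24 43 (Ex [34] [45] [33;34;35]
[24;34;44] 35 55) Done (Ex [34;44] [35;36] [33;34;44;45] [24;34;44;43] 26 45) Done);
Pat 0x60580407000000 0x80203a00000000 2 1 2 0 0 0 (Dichotomy [34;44] 46 24 43 (Ex [34] [45] [33;34;35]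
[24;34;44] 35 55) Done (Ex [34;44] [35;36] [33;34;44;45] [24;34;44;43] 37 45) Done);
Pat 0x140580600000000 0x200a0243800000000 2 2 1 0 0 2 (Dichotomy [43;44] 46 33 54 (Ex [43;44] [55]
[42;43;44;45] [33;43;44;54] 45 65) Done (Ex [43;44] [35;36] [42;43;44;45] [33;43;44;54] 37 45)
Done);
Pat 0x28020180000000000 0xd8220b83800000 0 2 2 1 0 0 (Exchange (Ex [45;55] [53] [44;45;55;65]
[35;45;55;54] 43 63) Done);
Pat 0x1a0401000000 0x1c050240b00000000 0 2 2 0 0 0 (Exchange (Ex [42] [34;44] [41;42;43] [32;42;52]
24 43) Done);
Pat 0x1c0202000000 0x380a0200d00800000 0 2 2 1 0 0 (Exchange (Ex [35;45] [33;43] [25;35;45;44]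
[34;35;45;55] 42 44) Done);
Pat 0x1c0400400000 0x380a0200a03800000 0 2 2 0 0 3 (Exchange (Ex [23;24] [43] [22;23;24;34]
[25;24;23;33] 42 44) Done);
Pat 0x1e0202000000 0x380b0200d01c00000 0 2 2 0 0 3 (Exchange (Ex [24;34] [42] [25;24;34;33]
[23;24;34;35] 41 43) Done);
Pat 0x401c0202000000 0x100b0220500800000 0 2 2 0 0 0 (Closed 33 25);
Pat 0x50140500000000 0x8020280200800000 0 2 2 0 0 0 (Dichotomy [44] 42 34 54 (Ex [44] [53] [43;44;45]
[34;44;54] 43 63) Done (Ex [44] [33] [43;44;45] [34;44;54] 23 43) Done);
Pat 0x601a0401000000 0x3c090240b00000000 0 2 2 0 0 0 (Exchange (Ex [42] [34;44] [41;42;43]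
[32;42;52] 24 43) Done);
Pat 0x4040180400000000 0x100a0240a01000000 0 2 2 0 0 0 (Closed 34 62);
Pat 0x80201c0400400000 0xd8220b83800000 0 2 2 0 0 0 (Exchange (Ex [32;33] [53] [22;32;42]
[23;33;32;31] 43 63) Done);
Pat 0x40401c0400000000 0x100b0220b01000000 0 2 2 0 0 0 (Closed 34 62);
Pat 0x100401c0400400000 0xb8220b83800000 0 2 2 0 0 0 (Exchange (Ex [32;33] [54] [22;32;42]
[23;33;32;31] 44 64) Done);
Pat 0x100401c0400400000 0xa0200a03800000 0 2 2 0 0 3 (Dichotomy [23;24] 53 25 33 (Ex [23;24] [43]
[22;23;24;34] [25;24;23;33] 42 44) Done (Ex [23;24] [54] [22;23;24;34] [25;24;23;33] 44 64) Done);
Pat 0x10040180202800000 0xb0240d00000000 0 2 2 1 0 0 (Dichotomy [35;45] 53 34 55 (Ex [35;45] [54]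
[25;35;45;44] [34;35;45;55] 44 64) Done (Ex [35;45] [33] [25;35;45;44] [34;35;45;55] 23 43) Done);
Pat 0x10050140400800000 0x80a0280300000000 0 2 2 0 0 0 (Dichotomy [44;54] 42 34 64 (Ex [44] [53]
[43;44;45] [34;44;54] 43 63) Done (Ex [44;54] [33;43] [45;44;54;53] [34;44;54;64] 32 53) Done);
Pat 0x18040140401800000 0xb0280b00000000 0 2 2 0 0 0 (Dichotomy [34;44;54] 42 24 64 (Ex [34] [43;53]
[33;34;35] [24;34;44] 33 52) Done (Ex [44;54] [33;43] [45;44;54;53] [34;44;54;64] 32 53) Done);
Pat 0x201201e0000000000 0x1c0d0200b03800000 1 2 2 0 0 0 (Exchange (Ex [54;55] [42] [44;54;55;56]
[45;55;54;64] 41 43) Done);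
Pat 0x500401000000 0x1c0d0240b00000000 1 2 2 0 0 0 (Exchange (Ex [45] [34] [44;45;46] [35;45;55] 24
44) Done);
Pat 0x580200800000 0x380b8220d80000000 1 2 2 0 0 0 (Exchange (Ex [45] [33] [44;45;46] [35;45;55] 23
43) Done);
Pat 0x5c0200000000 0x380a0200d00800000 1 2 2 0 0 0 (Exchange (Ex [45] [33;43] [44;45;46] [35;45;55]
42 44) Done);
Pat 0x5c0300000000 0x380a0200c00800000 1 2 2 0 0 0 (Exchange (Ex [45] [33;43] [44;45;46] [35;45;55]
32 44) Done);
Pat 0x5c0300800000 0x380b8220c80400000 1 2 2 0 0 0 (Exchange (Ex [45] [32;33] [44;45;46] [35;45;55]
23 42) Done);
Pat 0x5c0300c00000 0x380a0200c00000000 1 2 2 0 0 0 (Exchange (Ex [45] [33;43] [44;45;46] [35;45;55]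
23 44) Done);
Pat 0x100405c0000000000 0xa0200a03800000 1 2 2 0 0 0 (Dichotomy [45] 53 35 55 (Ex [45] [54] [44;45;46]
[35;45;55] 44 64) Done (Ex [45] [43] [44;45;46] [35;45;55] 42 44) Done);
Pat 0x5e0200800000 0x380b0200d00000000 1 2 2 0 0 0 (Dichotomy [45] 32 35 55 (Ex [45] [42] [44;45;46]
[35;45;55] 41 43) Done (Ex [45] [33] [44;45;46] [35;45;55] 23 43) Done);
Pat 0x5e0300800000 0x380b0200c80400000 1 2 2 0 0 0 (Dichotomy [45] 22 35 55 (Ex [45] [32;42] [44;45;46]
[35;45;55] 33 41) Done (Ex [45] [32;33] [44;45;46] [35;45;55] 23 42) Done);
Pat 0x5e0380800000 0x380b0200c00400000 1 2 2 0 0 0 (Dichotomy [45] 22 35 55 (Ex [45] [32;42] [44;45;46]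
[35;45;55] 31 33) Done (Ex [45] [32;33] [44;45;46] [35;45;55] 23 31) Done);
Pat 0x1401c0200000000 0x380a0601d00800000 1 2 2 0 0 0 (Exchange (Ex [45;55] [33;43] [44;45;55;56]
[35;45;55;65] 42 44) Done);
Pat 0x801c1400000000 0x78120600a03800000 1 2 2 0 0 0 (Exchange (Ex [35;45] [43] [34;35;36]
[25;35;45;46] 42 44) Done);
Pat 0x100401c0400400000 0xb8621387800000 1 2 2 0 0 0 (Exchange (Ex [32;33] [54] [22;32;42]
[23;33;32;31] 44 64) Done);
Pat 0x100401c0400400000 0xa0601387800000 1 2 2 0 0 3 (Dichotomy [23;24;32;33] 53 25 31 (Ex [23;24] [43]
[22;23;24;34] [25;24;23;33] 42 44) Done (Ex [23;24] [54] [22;23;24;34] [25;24;23;33] 44 64) Done);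
Pat 0x10040580200800000 0xa0240d00000000 1 2 2 0 0 0 (Dichotomy [33;43;44;54] 46 23 64 (Ex [33] [45]
[32;33;34] [23;33;43] 35 55) Done (Ex [54] [45] [53;54;55] [44;54;64] 35 55) Done);
Pat 0x10060500401000000 0x8090280a00000000 1 2 2 0 0 0 (Dichotomy [34;44;53;54] 46 24 64 (Ex [34] [45]
[33;34;35] [24;34;44] 35 55) Done (Ex [53;54] [45] [43;53;54;55] [44;54;64] 35 55) Done);
Pat 0x18060500401000000 0x90280a00000000 1 2 2 0 0 0 (Dichotomy [34;44;53;54] 46 24 63 (Ex [34] [45]
[33;34;35] [24;34;44] 35 55) Done (Ex [53;54] [45] [43;53;54;55] [44;54;53;63] 35 55) Done);
Pat 0x10040580403000000 0xa0241a00000000 1 2 2 0 0 0 (Dichotomy [34;43;44;54] 46 24 64 (Ex [34] [45]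
[33;34;35] [24;34;44] 35 55) Done (Ex [54] [35;45] [53;54;55] [44;54;64] 36 55) Done);
Pat 0x10040580601800000 0xb0240900000000 1 2 2 0 0 0 (Dichotomy [45] 53 35 55 (Ex [45] [54] [44;45;46]
[35;45;55] 44 64) Done (Ex [45] [33;34] [44;45;46] [35;45;55] 23 43) Done);
Pat 0x100c0101400000000 0x20138620b83800000 1 2 2 0 0 0 (Exchange (Ex [35;45] [54;55] [34;35;36]
[25;35;45;46] 44 64) Done);
Pat 0x140100c02000000 0x380b8621381000000 1 2 2 0 0 0 (Exchange (Ex [45;55] [34;35] [44;45;55;56]
[46;45;55;65] 25 44) Done);
Pat 0x30040581600000000 0x401a0240802000000 1 2 2 2 0 0 (Dichotomy [43;44;54] 46 33 64 (Ex [43;44]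
[55;56] [42;43;44;45] [33;43;44;54] 45 66) Done (Ex [43;44] [35] [42;43;44;45] [33;43;44;54] 25 45)
Done);
Pat 0x140100c03000000 0x380b8621380000000 1 2 2 0 0 0 (Exchange (Ex [45;55] [34;35] [44;45;55;56]
[46;45;55;65] 24 44) Done);
Pat 0x140900c00000000 0x2008068300c000000 2 2 2 0 0 0 (Dichotomy [44] 56 34 54 (Ex [44] [55] [43;44;45]
[34;44;54] 45 65) Done (Ex [44] [36;46] [43;44;45] [34;44;54] 26 45) Done);
Pat 0x100c09c1000000000 0x20120600a03800000 2 2 2 0 0 0 (Dichotomy [45;46] 53 35 56 (Ex [45;46] [54;55]
[44;45;46;47] [35;45;46;56] 44 64) Done (Ex [45;46] [43] [44;45;46;47] [35;45;46;56] 42 44) Done);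
Pat 0x200c09c1000000000 0x10120600a03800000 2 2 2 0 0 0 (Dichotomy [45;46] 53 35 56 (Ex [45;46] [54;55]
[44;45;46;47] [35;45;46;56] 44 65) Done (Ex [45;46] [43] [44;45;46;47] [35;45;46;56] 42 44) Done);
Pat 0x300c09c1000000000 0x120600a03800000 2 2 2 0 0 0 (Dichotomy [45;46] 53 35 56 (Ex [45;46] [54;55]
[44;45;46;47] [35;45;46;56] 44 64) Done (Ex [45;46] [43] [44;45;46;47] [35;45;46;56] 42 44) Done);
Pat 0x140580402000000 0x200a0243a0c000000 2 2 2 0 0 0 (Dichotomy [43;44] 46 34 54 (Ex [43;44] [55]
[33;43;44;45] [34;44;54] 45 65) Done (Ex [43;44] [35;36] [33;43;44;45] [34;44;54] 26 45) Done);
Pat 0x400c0901400000000 0x300680802000000 2 2 2 0 0 0 (Dichotomy [44] 36 34 54 (Ex [44] [46;56]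
[43;44;45] [34;44;54] 45 57) Done (Ex [44] [35] [43;44;45] [34;44;54] 25 45) Done);
Pat 0x140902c00000000 0x20080681004000000 2 2 2 0 0 0 (Dichotomy [44] 56 34 54 (Ex [44] [55] [43;44;45]
[34;44;54] 45 65) Done (Ex [44] [36;46] [43;44;45] [34;44;54] 26 45) Done);
Pat 0x2c0981400000000 0x40120640a02000000 2 2 2 0 0 0 (Dichotomy [43;44] 36 34 54 (Ex [43;44] [46;56]
[33;43;44;45] [34;44;54] 45 66) Done (Ex [43;44] [35] [33;43;44;45] [34;44;54] 25 45) Done);
Pat 0x160982c00000000 0x20080601205000000 2 2 2 0 0 0 (Dichotomy [34;44] 56 35 43 (Ex [34;44] [55]
[24;34;44;45] [35;34;44;43] 45 65) Done (Ex [34;44] [36;46] [24;34;44;45] [35;34;44;43] 26 45)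
Done);
Pat 0x2c0981600000000 0x40120640802000000 2 2 2 0 0 0 (Dichotomy [43;44] 36 33 54 (Ex [43;44] [46;56]
[42;43;44;45] [33;43;44;54] 45 66) Done (Ex [43;44] [35] [42;43;44;45] [33;43;44;54] 25 45) Done);
Pat 0x20120181c00000000 0x100c0e00201000000 2 2 2 0 0 0 (Dichotomy [34;44] 56 35 43 (Ex [34;44] [54;55]
[24;34;44;45] [35;34;44;43] 45 64) Done (Ex [34;44] [46] [24;34;44;45] [35;34;44;43] 45 47) Done);
Pat 0x160181c00000000 0x20080e00201000000 2 2 2 0 0 0 (Dichotomy [34;44] 56 35 43 (Ex [34;44] [55]
[24;34;44;45] [35;34;44;43] 45 65) Done (Ex [34;44] [46] [24;34;44;45] [35;34;44;43] 45 47) Done);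
Pat 0x1c0400400000 0x380a0e0220f800000 2 2 2 0 0 3 (Exchange (Ex [23;24] [43] [22;23;24;34]
[25;24;23;33] 42 44) Done);
Pat 0x100401c0400400000 0xa0e0238f800000 2 2 2 0 0 3 (Dichotomy [23;24;32;33] 53 25 31 (Ex [23;24] [43]
[22;23;24;34] [25;24;23;33] 42 44) Done (Ex [23;24] [54] [22;23;24;34] [25;24;23;33] 44 64) Done);
Pat 0x200c0901401000000 0x10138620b80000000 2 2 2 0 0 0 (Dichotomy [45;46] 33 35 56 (Ex [45;46] [54;55]
[44;45;46;47] [35;45;46;56] 44 65) Done (Ex [45;46] [34] [44;45;46;47] [35;45;46;56] 24 44) Done);
Pat 0x101409c0800000000 0xa0601207800000 2 2 2 0 0 0 (Dichotomy [45;46] 53 36 55 (Ex [45;46] [54]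
[35;45;46;47] [36;46;45;55] 44 64) Done (Ex [45;46] [43] [35;45;46;47] [36;46;45;55] 42 44) Done);
Pat 0x600c0981600000000 0x10320600802000000 2 2 2 0 0 0 (Dichotomy [44;54;55] 36 34 65 (Ex [44;54]
[46;56] [45;44;54;53] [34;44;54;55] 45 57) Done (Ex [44;54] [35] [45;44;54;53] [34;44;54;55] 25 45)
Done);
Pat 0x160980c07000000 0x20080603200000000 2 2 2 0 0 0 (Dichotomy [34;44] 56 24 43 (Ex [34;44] [55]
[33;34;44;45] [24;34;44;43] 45 65) Done (Ex [34;44] [36;46] [33;34;44;45] [24;34;44;43] 37 45)
Done);
Pat 0x3c0103000000000 0x60001e00c03000000 3 2 2 0 0 0 (Dichotomy [55;56] 36 54 57 (Ex [55] [46;47]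
[45;55;65] [54;55;56] 45 48) Done (Ex [55;56] [35;45] [46;56;55;65] [54;55;56;57] 25 46) Done);
Pat 0x3c0103002000000 0x60001e00c00000000 3 2 2 0 0 0 (Dichotomy [55;56] 36 54 57 (Ex [55] [46;47]
[45;55;65] [54;55;56] 45 48) Done (Ex [55;56] [35;45] [46;56;55;65] [54;55;56;57] 34 46) Done);
Pat 0x340103c00000000 0x20081e00006000000 3 2 2 0 0 0 (Dichotomy [35;36] 56 34 37 (Ex [35] [46;47]
[25;35;45] [34;35;36] 45 48) Done (Ex [35;36] [45;55] [25;35;36;46] [34;35;36;37] 46 65) Done);
Pat 0x140401a0600800000 0x20080b8240901000000 0 3 2 0 0 0 (Dichotomy [42] 45 32 52 (Ex [42] [44;54]
[41;42;43] [32;42;52] 34 64) Done (Ex [42] [33;34] [41;42;43] [32;42;52] 23 43) (Dichotomy [43;44] 62 42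
54 (Ex [43;44] [63] [33;43;53] [42;43;44;54] 53 73) Done (Ex [43;44] [52] [33;43;53] [42;43;44;54]
51 53) Done));
Pat 0x140401a0601000000 0x20080b8240900800000 0 3 2 0 0 0 (Dichotomy [42] 45 32 52 (Ex [42] [44;54]
[41;42;43] [32;42;52] 34 64) Done (Ex [42] [33;34] [41;42;43] [32;42;52] 24 43) (Dichotomy [43;44] 62 42
54 (Ex [43;44] [63] [33;43;53] [42;43;44;54] 53 73) Done (Ex [43;44] [52] [33;43;53] [42;43;44;54]
51 53) Done));
Pat 0x180601a0401400000 0x90240b80802000 0 2 3 0 0 0 (Dichotomy [42] 45 32 52 (Ex [42] [53;54]
[41;42;43] [32;42;52] 43 63) (Dichotomy [34;44] 22 24 43 (Ex [34;44] [32] [33;34;35] [24;34;44;43] 31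
33) Done (Ex [34;44] [23] [33;34;35] [24;34;44;43] 13 33) Done) (Ex [42] [34] [41;42;43] [32;42;52]
24 44) (Flip 44 43 Done));
Pat 0x1e0202800000 0x380b0200d01407000 0 2 3 0 0 0 (Exchange (Ex [24;34] [42] [23;24;25]
[14;24;34;35] 41 43) Done);
Pat 0x280201e0000000000 0x40100d0200b03800000 0 3 2 1 0 0 (Dichotomy [45;54;55;64] 52 35 74 (Ex [45;55]
[53] [44;45;55;65] [35;45;55;54] 43 63) Done (Ex [45;55] [42] [44;45;55;65] [35;45;55;54] 41 43)
Done);
Pat 0x18040160401404000 0xb0280b82802000 0 2 3 0 0 0 (Dichotomy [24;34;44;54] 42 14 64 (Ex [24] [43]
[23;24;25] [14;24;34] 33 53) (Flip 53 52 Done) (Ex [54] [43] [53;54;55] [44;54;64] 33 53) (Dichotomy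
[24;34;42;43;44] 22 14 41 (Ex [24] [32;33] [23;24;25] [14;24;34] 23 31) Done (Ex [34;44] [23]
[33;34;35] [24;34;44;43] 13 33) Done));
Pat 0xc0201a0401404000 0x58240b82802000 0 2 3 0 0 0 (Dichotomy [24;34;43;44;53] 41 14 63 (Ex [24] [42]
[23;24;25] [14;24;34] 32 52) (Flip 52 51 Done) (Ex [53] [42] [52;53;54] [43;53;63] 32 52) (Dichotomy
[24;34;42;43;44] 22 14 41 (Ex [24] [32;33] [23;24;25] [14;24;34] 23 31) Done (Ex [34;44] [23]
[33;34;35] [24;34;44;43] 13 33) Done));
Pat 0x5c0380000000 0x380b0220c01407000 1 2 3 0 0 0 (Exchange (Ex [45] [32;42] [44;45;46] [35;45;55]
31 33) Done);
Pat 0x801c1400000000 0x1c058120600a03800000 1 3 2 0 0 0 (Exchange (Ex [35;45] [43] [34;35;36]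
[25;35;45;46] 42 44) Done);
Pat 0x10040500200802000 0xb0240903400000 1 2 3 0 0 0 (Dichotomy [45] 53 35 55 (Ex [45] [54] [44;45;46]
[35;45;55] 44 64) Done (Ex [45] [23] [44;45;46] [35;45;55] 13 33) Done);
Pat 0x5c0380802000 0x380b0220c01400000 1 2 3 0 0 0 (Dichotomy [45] 22 35 55 (Ex [45] [32;42] [44;45;46]
[35;45;55] 31 33) Done (Ex [45] [23] [44;45;46] [35;45;55] 13 33) Done);
Pat 0x10040501600802000 0xa0280903400000 1 2 3 0 0 0 (Dichotomy [23;33;34;44;54] 46 13 64 (Ex [23]
[35;45] [22;23;24] [13;23;33] 25 55) Done (Ex [44] [35] [43;44;45] [34;44;54] 25 45) Done);
Pat 0x20280201e0000000000 0x141d0600b03800000 1 3 2 0 0 0 (Dichotomy [54;55] 52 45 64 (Ex [54;55] [63]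
[44;54;55;65] [45;55;54;64] 53 73) Done (Ex [54;55] [42] [44;54;55;65] [45;55;54;64] 41 43) Done);
Pat 0x1e1202802000 0x380b0200d01400000 1 2 3 0 0 0 (Dichotomy [34;35] 32 24 45 (Ex [34;35] [42]
[33;34;35;36] [24;34;35;45] 41 43) Done (Ex [34;35] [23] [33;34;35;36] [24;34;35;45] 13 33) Done);
Pat 0x4010140180200800000 0x280a0641d00000000 1 3 2 0 0 0 (Dichotomy [33;43;44;54;64] 56 23 74 (Ex [33]
[45;55] [32;33;34] [23;33;43] 35 65) Done (Ex [54;64] [45;55] [53;54;64;65] [44;54;64;74] 35 65)
Done);
Pat 0x1401e0802008000 0x380b0601305800000 1 2 3 0 0 0 (Dichotomy [45;55] 33 46 65 (Ex [45;55] [42]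
[35;45;55;56] [46;45;55;65] 41 43) Done (Ex [45;55] [25] [35;45;55;56] [46;45;55;65] 15 35) Done);
Pat 0x10040500403008000 0xb0241904c04000 1 2 3 0 0 0 (Dichotomy [35;45] 53 36 55 (Ex [35;45] [54]
[25;35;45;46] [36;35;45;55] 44 64) Done (Ex [35;45] [24;25] [34;35;45;46] [36;35;45;55] 15 34)
Done);
Pat 0x1004050040300c000 0xb0241904c00000 1 2 3 0 0 0 (Dichotomy [35;45] 53 36 55 (Ex [35;45] [54]
[25;35;45;46] [36;35;45;55] 44 64) Done (Ex [35;45] [24;25] [34;35;45;46] [36;35;45;55] 14 34)
Done);
Pat 0x1201c1800000000 0x80d0e0220e80e000 2 2 3 0 0 0 (Exchange (Ex [45;46] [43;53] [35;45;46;56]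
[47;46;45;55] 42 44) Done);
Pat 0xb0260580401000000 0x10048190240b00000000 2 3 2 0 0 0 (Dichotomy [45;55;56;66] 33 35 76 (Ex [45]
[53;54] [44;45;46] [35;45;55] 43 64) Done (Ex [45] [34] [44;45;46] [35;45;55] 24 44) Done);
Pat 0x4010340181600000000 0x680a0e40802000000 2 3 2 0 0 0 (Dichotomy [43;44;54;64] 56 33 74 (Ex [43;44]
[55] [42;43;44;45] [33;43;44;54] 45 65) Done (Ex [64] [55] [63;64;65] [54;64;74] 45 65) (Dichotomy
[43;44;54;55;56] 36 33 57 (Ex [43;44] [46] [42;43;44;45] [33;43;44;54] 45 47) Done (Ex [43;44] [35]
[42;43;44;45] [33;43;44;54] 25 45) Done));
Pat 0x201201c1c01404000 0x100c0e00382802000 2 2 3 0 0 0 (Dichotomy [35] 56 34 36 (Ex [35] [46]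
[25;35;45] [34;35;36] 45 47) (Dichotomy [24;34;44] 22 14 43 (Ex [24] [32;33] [23;24;25] [14;24;34] 23
31) Done (Ex [34;44] [23] [33;34;35] [24;34;44;43] 13 33) Done) (Ex [35] [54;55] [25;35;45]
[34;35;36] 45 64) Done);
Pat 0x160181405004000 0x20080e00a02808000 2 2 3 0 0 0 (Dichotomy [24;34] 36 14 44 (Ex [24] [35]
[23;24;25] [14;24;34] 25 45) (Dichotomy [34;44] 56 35 43 (Ex [34;44] [55] [24;34;44;45] [35;34;44;43] 45
65) Done (Ex [34;44] [46] [24;34;44;45] [35;34;44;43] 45 47) Done) (Ex [34] [25] [33;34;35]
[24;34;44] 15 35) (Flip 44 43 Done));
Pat 0x10020000100000000000 0x40100200000000000 1 3 0 2 0 0 (Flip 66 56 Done);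
Pat 0x20000000100000000000 0xc0300200000000000 2 3 0 3 0 0 (Flip 67 57 Done);
Pat 0x20000100000000000 0x300c0300200000000000 2 3 0 0 0 0 (Flip 66 56 Done);
Pat 0x10020000100000000000 0xc0300200000000000 2 3 0 0 0 0 (Flip 66 56 Done);
Pat 0x100a0000100000000000 0x40100200000000000 2 3 0 0 0 0 (Flip 66 56 Done);
Pat 0x100000020000 0x20701c000000 3 0 3 0 0 0 (Flip 27 26 Done);
Pat 0x20100000100000000000 0xc0300200000000000 3 3 0 0 0 0 (Flip 67 57 Done);
Pat 0x1e0c00402000 0x70200301800000 0 1 3 0 0 0 (Dichotomy [34;42;43;44] 22 35 41 (Ex [34;44] [23;33]
[24;34;44;45] [35;34;44;43] 24 32) Done (Ex [42] [23;33] [32;42;52] [41;42;43] 24 32) Done);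
Pat 0x401e0401400000 0x30200b8280e000 0 1 3 0 0 0 (Dichotomy [34] 22 24 44 (Ex [34] [32] [33;34;35]
[24;34;44] 31 33) (Flip 23 13 Done) (Ex [34] [23] [33;34;35] [24;34;44] 13 33) (Dichotomy [42;43;44] 24
41 54 (Ex [42] [33;34] [32;42;52] [41;42;43] 32 35) Done (Ex [43;44] [32] [33;43;53] [42;43;44;54]
31 33) Done));
Pat 0x401e0401404000 0x30200b82802000 0 1 3 0 0 0 (Dichotomy [24;34] 22 14 44 (Ex [24] [32] [23;24;25]
[14;24;34] 31 33) (Flip 33 23 Done) (Ex [34] [23] [33;34;35] [24;34;44] 13 33) (Dichotomy [42;43;44] 24
41 54 (Ex [42] [33;34] [32;42;52] [41;42;43] 32 35) Done (Ex [43;44] [32] [33;43;53] [42;43;44;54]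
31 33) Done));
Pat 0x500403000000 0x80201a04010000 1 1 3 2 0 0 (Dichotomy [34] 46 24 44 (Ex [34] [45] [33;34;35]
[24;34;44] 35 55) Done (Ex [34] [26;36] [33;34;35] [24;34;44] 16 35) Done);
Pat 0x40101400000000 0x280a0280e000 1 1 3 0 0 0 (Exchange (Ex [35] [44] [34;35;36] [25;35;45] 34 54)
Done);
Pat 0x4010140180c00000000 0x280a0640200000000 1 3 1 0 0 0 (Dichotomy [43;44;54;64] 56 34 74 (Ex [43;44]
[55] [33;43;44;45] [34;44;54] 45 65) Done (Ex [54;64] [45;55] [53;54;64;65] [44;54;64;74] 46 65)
Done);
Pat 0xe0181405004000 0x600a02808000 1 1 3 0 0 0 (Dichotomy [24;34;44] 36 14 43 (Ex [24] [35;45]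
[23;24;25] [14;24;34] 25 46) Done (Ex [34;44] [25] [33;34;35] [24;34;44;43] 15 35) Done);
Pat 0x100980c0240a000 0x601305804000 2 1 3 0 0 0 (Dichotomy [25;34;35] 22 15 44 (Ex [25] [23;33]
[24;25;26] [15;25;35] 24 32) Done (Ex [34;35] [23;24] [33;34;35;36] [25;35;34;44] 14 33) (Flip 46 36
Done));
Pat 0x40401c0401000000 0x100b0220b02804000 0 2 3 0 0 0 (Closed 24 62);
Pat 0x10040180400402000 0xb8220b83800000 0 2 3 0 0 0 (Exchange (Ex [23;33] [54] [13;23;33;34]
[24;23;33;32] 44 64) Done);
Pat 0x40401c0401000000 0xe0280b8220b80000000 0 3 2 0 0 0 (Exchange (Ex [52;53] [34] [42;52;62]
[51;52;53;63] 24 44) Done);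
Pat 0x100401e0400402000 0xb060130581c000 1 2 3 0 0 0 (Dichotomy [23;33] 53 24 32 (Ex [23;33] [42]
[13;23;33;34] [24;23;33;32] 41 43) Done (Ex [23;33] [54] [13;23;33;34] [24;23;33;32] 44 64) Done);
Pat 0x140401c0400004000 0x2008038200a03800000 0 3 3 0 0 0 (Dichotomy [43] 62 42 44 (Ex [43] [63]
[33;43;53] [42;43;44] 53 73) (Exchange (Ex [24] [44] [14;24;34] [23;24;25] 34 54) Done) (Ex [43]
[52] [33;43;53] [42;43;44] 51 53) (Exchange (Ex [24] [44] [14;24;34] [23;24;25] 34 54) Done));
Pat 0x140401c0401400000 0x2008038200b80802000 0 3 3 0 0 0 (Dichotomy [34] 22 24 44 (Ex [34] [32]
[33;34;35] [24;34;44] 31 33) (Dichotomy [43;44] 62 42 54 (Ex [43;44] [63] [33;43;53] [42;43;44;54] 53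
73) Done (Ex [43;44] [52] [33;43;53] [42;43;44;54] 51 53) Done) (Ex [34] [23] [33;34;35] [24;34;44]
13 33) (Dichotomy [43;44] 62 42 54 (Ex [43;44] [63] [33;43;53] [42;43;44;54] 53 73) Done (Ex [43;44]
[52] [33;43;53] [42;43;44;54] 51 53) Done));
Pat 0x20240401c0401400000 0x4018038200b8280e000 0 3 3 0 0 0 (Dichotomy [34] 22 24 44 (Ex [34] [32]
[33;34;35] [24;34;44] 31 33) (Flip 23 13 Done) (Ex [34] [23] [33;34;35] [24;34;44] 13 33) (Dichotomy
[43;44] 62 42 54 (Ex [43] [63;64] [33;43;53] [42;43;44] 53 74) Done (Ex [43;44] [52] [33;43;53]
[42;43;44;54] 51 53) Done));
Pat 0x20240401c0401404000 0x4018038200b82802000 0 3 3 0 0 0 (Dichotomy [24;34] 22 14 44 (Ex [24] [32]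
[23;24;25] [14;24;34] 31 33) (Flip 33 23 Done) (Ex [34] [23] [33;34;35] [24;34;44] 13 33) (Dichotomy
[43;44] 62 42 54 (Ex [43] [63;64] [33;43;53] [42;43;44] 53 74) Done (Ex [43;44] [52] [33;43;53]
[42;43;44;54] 51 53) Done));
Pat 0x40000401c0400004000 0x380a0200a03800000 0 3 3 0 0 0 (Exchange (Ex [24] [43] [14;24;34]
[23;24;25] 42 44) (Exchange (Ex [64] [34;44] [54;64;74] [63;64;65] 24 54) Done));
Pat 0x4010040100581006000 0x280a02c0a02c00000 0 3 3 0 0 0 (Dichotomy [24;34;44;54;64] 32 14 74 (Ex [24]
[33] [23;24;25] [14;24;34] 23 43) (Dichotomy [32;33;34;44;54;64] 14 31 74 (Ex [32] [23;24] [22;32;42]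
[31;32;33] 22 25) Done (Ex [34;44] [23] [24;34;44;43] [33;34;44;54] 22 24) Done) (Ex [34;44] [23;33]
[35;34;44;43] [24;34;44;54] 22 43) Done);
Pat 0x4010050100501404000 0x280a02e0a02802000 0 3 3 0 0 0 (Dichotomy [24;34;44;54;64] 32 14 74 (Ex [24]
[33] [23;24;25] [14;24;34] 23 43) (Dichotomy [34;44] 52 33 54 (Ex [34;44] [53] [24;34;44;43]
[33;34;44;54] 43 63) Done (Ex [34;44] [42] [24;34;44;43] [33;34;44;54] 41 43) Done) (Ex [34] [23]
[33;34;35] [24;34;44] 13 33) (Flip 44 54 Done));
Pat 0x4010050100581004000 0x280a02e0a02c00000 0 3 3 0 0 0 (Dichotomy [24;34;44;54;64] 32 14 74 (Ex [24]
[33] [23;24;25] [14;24;34] 23 43) (Dichotomy [32;33;34;44;54;64] 52 31 74 (Ex [32] [43;53] [22;32;42]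
[31;32;33] 42 63) Done (Ex [34;44] [42] [24;34;44;43] [33;34;44;54] 41 43) Done) (Ex [44] [33]
[43;44;45] [34;44;54] 23 43) Done);
Pat 0x4014040140401404000 0x20280b8280b82802000 0 3 3 0 0 0 (Dichotomy [24;34;44;54;64] 42 14 74 (Ex
[24;34] [43] [23;24;25] [14;24;34;44] 33 53) (Dichotomy [43;44] 62 42 54 (Ex [43;44] [63] [33;43;53]
[42;43;44;54] 53 73) Done (Ex [43;44] [52] [33;43;53] [42;43;44;54] 51 53) Done) (Ex [54;64] [43]
[53;54;55] [44;54;64;74] 33 53) (Dichotomy [34;44] 22 24 43 (Ex [34;44] [32] [33;34;35] [24;34;44;43] 31
33) Done (Ex [34;44] [23] [33;34;35] [24;34;44;43] 13 33) Done));
Pat 0x40140401a0401404000 0x20280b8240b82802000 0 3 3 0 0 0 (Dichotomy [24;34;43;44;54;64] 41 14 74 (Ex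
[24;34] [42] [23;24;25] [14;24;34;44] 32 52) (Dichotomy [43;44] 62 42 54 (Ex [43;44] [63] [33;43;53]
[42;43;44;54] 53 73) Done (Ex [43;44] [52] [33;43;53] [42;43;44;54] 51 53) Done) (Ex [54] [42]
[53;54;55] [44;54;64] 32 52) (Dichotomy [24;34;42;43;44] 22 14 41 (Ex [24] [32;33] [23;24;25] [14;24;34]
23 31) Done (Ex [34;44] [23] [33;34;35] [24;34;44;43] 13 33) Done))])%N.

Definition decision_tree : list N := (
[44;45;201;96;101;43;34;33;54;53;434;52;97;63;753;332;713;97;63;751;62;98;91;
46;64;73;803;42;51;336;55;35;443;441;933;32;41;836;51;472;833;55;35;443;441;
35;847;56;65;767;74;561;75;258;929;92;57;66;781;65;906;369;102;23;24;624;25;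
251;103;14;398;51;41;476;31;22;746;13;659;12;224;515;475;41;650;31;22;746;13;
659;12;224;515;425;344;22;226;36;25;361;24;103;13;802;14;562;15;249;961;350;
581;47;37;26;375;25;24;103;16;15;14;667;666;261;27;1075;93;38;48;508;507;48;
506;911;991;350;251;775;93;48;455;453;450;447;36;318;47;37;322;93;48;455;453;
319;447;36;102;25;361;66;363;65;627;356;318;440;55;35;443;441;458;35;55;442;56;
65;767;64;73;803;42;51;336;933;74;966;75;258;929;458;844;36;102;25;361;92;37;
47;56;451;55;26;27;910;66;65;57;376;64;1052;645;268;103;93;57;42;51;336;64;73;
803;65;936;963;1043;638;38;48;917;16;981;15;260;17;273;570;48;916;58;290;915;
17;410;408;93;28;386;382;374;498;449;93;55;26;27;910;103;38;16;576;15;260;17;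
273;571;28;287;48;288;16;573;817;28;386;382;498;64;73;803;56;65;767;75;74;66;
812;57;42;51;336;933;670;367;258;74;66;1078;57;42;51;336;933;670;367;929;65;
766;66;57;373;776;763;458;57;452;56;67;378;55;26;27;910;103;17;410;408;374;498;
65;767;66;76;973;407;367;446;47;276;26;55;501;64;73;803;56;65;767;75;74;66;
812;57;42;51;336;933;670;367;258;74;66;1078;57;42;51;336;933;670;367;929;65;
766;66;57;373;776;763;458;773;26;56;445;55;487;845;358;318;55;438;102;25;360;
56;26;92;37;779;47;855;370;362;357;437;313;55;35;841;826;35;420;65;759;102;25;
353;64;73;803;75;807;74;51;42;336;550;42;933;41;32;836;24;23;1058;651;23;650;
22;226;1002;547;929;458;303;99;207;104;103;102;64;757;65;760;55;35;91;46;443;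
442;841;91;46;441;36;25;361;66;770;56;92;47;451;1046;445;92;57;903;67;909;47;
490;772;885;438;826;458;209;210;211;737;711;835;32;102;23;347;738;307;102;23;
345;22;35;91;46;55;849;847;55;442;56;92;57;97;66;67;504;98;93;77;68;414;819;
68;818;54;65;767;36;47;451;76;58;982;48;291;979;75;271;58;977;411;26;37;782;
47;48;58;511;510;38;289;58;76;575;75;271;976;509;778;103;47;37;53;42;31;742;
24;13;397;25;530;557;637;1044;42;31;742;63;52;753;751;52;332;62;51;336;64;73;
803;24;13;397;1099;25;14;399;13;15;687;16;261;41;691;1049;391;644;24;25;1038;
1036;25;1037;1023;737;1042;48;58;511;510;38;289;58;76;575;75;271;976;509;58;76;
982;75;271;977;48;291;76;979;411;24;351;25;354;53;37;497;27;503;47;896;366;42;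
31;742;64;619;63;245;1023;579;31;42;742;53;64;755;65;52;41;430;877;63;486;62;
233;891;733;428;42;24;103;13;397;53;64;755;65;25;529;52;932;36;47;451;14;671;
15;249;26;810;16;27;815;37;48;456;1054;63;74;400;75;76;568;972;971;668;402;556;
733;524;351;25;103;14;399;13;539;391;354;47;36;451;26;263;37;902;53;64;755;65;
58;76;48;511;75;568;983;564;512;733;895;53;64;755;65;36;639;26;263;37;902;27;
38;384;48;454;383;366;733;103;26;36;15;405;14;13;551;563;809;263;37;48;456;36;
65;1054;64;75;812;58;76;980;975;76;572;411;1053;902;36;27;275;495;894;467;53;
64;755;65;52;41;430;427;63;486;62;233;891;733;428;77;816;814;93;68;792;788;780;
904;98;206;99;207;104;103;54;724;53;708;52;707;42;31;742;51;706;41;24;13;397;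
524;13;680;14;25;399;36;889;26;263;559;519;466;428;210;211;97;66;907;367;726;
97;66;893;764;722;844;55;435;420;55;54;91;46;441;36;25;361;26;92;37;27;910;53;
24;103;13;397;15;406;14;686;523;351;864;52;97;63;753;332;713;97;63;751;62;103;
93;17;28;820;413;28;412;31;42;742;24;13;397;15;406;14;955;522;580;51;42;336;
24;13;397;15;406;14;1091;522;580;42;98;56;47;451;16;38;576;48;288;573;15;260;
38;571;817;66;65;57;376;47;64;73;803;24;13;397;693;632;24;13;397;15;406;41;14;
682;681;643;631;372;268;15;16;24;406;65;64;47;632;38;576;48;288;573;47;631;38;
576;48;288;573;64;47;630;38;576;48;288;573;617;260;24;13;397;64;73;803;693;65;
74;805;73;14;695;694;797;41;14;682;681;1024;64;73;803;14;692;13;41;538;65;1034;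
625;387;65;74;805;41;75;1071;76;270;658;1032;617;64;757;65;760;66;770;24;56;47;
451;67;785;57;48;456;1055;1048;1025;56;47;451;67;785;57;48;456;1055;1047;617;24;
13;397;15;406;14;1091;522;580;17;410;408;93;28;386;382;374;737;711;501;487;92;
37;498;773;358;438;826;254;97;25;24;91;36;361;103;13;397;46;92;37;26;375;54;
53;500;52;63;753;332;63;751;62;64;98;73;803;42;51;336;31;742;693;623;757;65;
256;42;1018;98;74;948;73;940;923;871;737;990;26;54;53;587;52;63;753;332;63;751;
62;64;98;73;803;42;51;336;31;742;693;623;757;65;256;42;1018;98;74;948;73;940;
923;871;737;989;16;27;1083;1082;27;93;42;31;742;54;53;527;63;52;753;751;52;332;
62;51;336;64;98;73;803;693;757;65;256;1018;737;525;52;53;41;430;31;54;878;877;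
427;231;53;54;63;64;1030;65;256;98;74;804;31;41;882;51;62;340;73;1065;72;235;
921;881;41;1056;51;62;340;73;1065;72;235;921;425;750;62;233;64;98;73;396;56;65;
767;74;968;75;258;555;47;57;66;781;65;76;75;74;1073;1072;270;67;669;58;48;914;
913;48;912;505;369;48;455;453;447;756;65;256;51;868;41;596;31;881;425;64;755;
63;1026;62;233;606;54;63;751;62;64;623;65;256;98;74;948;73;940;923;871;737;428;
47;377;56;57;448;66;908;491;447;17;93;28;1085;38;47;984;56;54;65;767;53;586;
42;31;742;63;52;753;751;52;332;62;51;336;64;98;73;803;693;757;1018;737;633;582;
447;678;1080;1081;26;769;16;1079;683;360;351;353;251;54;103;24;13;397;53;42;31;
742;527;52;41;430;31;878;427;31;14;956;15;249;523;41;64;63;652;1057;65;256;63;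
1056;62;233;596;14;953;15;249;523;52;63;753;332;63;751;62;14;98;65;64;91;56;
767;73;803;46;42;51;336;31;742;693;1029;766;759;256;42;51;336;31;742;41;682;64;
73;803;693;1006;31;955;64;73;803;74;51;549;41;701;425;75;258;928;74;948;73;940;
923;64;757;65;256;42;1007;871;15;249;42;51;336;31;742;41;681;64;1096;688;522;
737;53;864;52;63;753;332;63;751;62;98;13;42;51;336;31;742;41;538;64;689;599;
534;65;64;91;56;767;46;42;612;14;542;517;766;759;256;64;73;803;42;51;336;31;
742;14;692;41;518;600;14;542;517;42;51;336;31;742;41;73;944;14;74;696;924;518;
599;597;64;757;65;256;42;998;597;737;24;351;53;864;42;64;601;63;245;65;256;592;
465;31;42;742;53;24;103;13;397;14;548;15;249;521;351;470;428;24;103;13;397;42;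
525;53;64;755;65;52;41;430;427;62;63;51;340;41;14;656;15;249;521;337;233;63;
98;74;400;91;46;1026;73;56;964;36;14;1070;15;249;521;437;72;235;934;1008;761;
51;457;41;590;425;733;428;351;42;53;64;755;65;98;52;103;14;950;15;91;36;482;
46;63;74;400;62;1017;51;41;1021;73;1066;72;235;1063;41;1020;1016;1015;56;26;92;
37;779;47;855;370;362;357;437;960;13;536;387;469;91;46;63;41;1019;51;219;1013;
1014;36;62;51;341;745;51;329;61;63;72;394;74;400;41;73;56;1069;662;1059;598;41;
56;605;1022;1000;328;56;26;92;37;779;47;855;370;362;357;437;63;74;400;41;654;
51;219;589;997;91;63;761;62;744;52;36;482;46;1015;56;26;92;37;779;47;855;370;
362;357;437;41;999;1000;758;733;103;14;543;91;36;481;46;478;56;26;92;37;779;47;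
855;370;362;357;437;15;959;13;941;387;468;53;103;14;541;13;939;516;464;428;98;
206;99;207;104;103;54;91;56;724;46;92;57;728;93;53;24;13;397;36;25;361;42;31;
742;527;994;47;37;26;375;25;500;775;48;455;453;447;864;52;713;711;47;725;36;37;
854;26;502;897;447;717;719;709;53;708;52;707;42;31;742;51;706;41;24;13;397;525;
25;251;14;543;13;943;15;91;36;481;46;478;56;883;437;959;387;466;428;210;211;
331;305;35;253;54;53;429;52;97;63;753;332;713;97;63;751;62;102;55;91;46;441;
36;26;92;37;27;910;103;93;17;28;820;413;28;412;51;42;336;33;24;349;25;32;41;
836;471;23;892;22;226;485;327;834;42;64;98;73;803;33;24;349;25;65;935;32;526;
56;47;451;74;1077;75;258;66;404;76;67;409;57;48;456;648;23;14;806;15;16;974;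
566;565;1074;808;962;327;930;757;65;98;74;805;73;945;797;760;47;56;451;66;268;
57;496;33;24;349;25;38;16;48;917;15;974;577;970;918;327;489;33;24;349;25;56;
1045;66;268;57;496;67;58;790;48;860;789;772;327;98;66;56;75;811;74;73;957;969;
403;268;57;48;456;56;25;648;24;15;406;16;38;574;978;38;569;817;647;496;56;67;
280;901;488;873;33;24;349;25;32;41;836;833;23;892;22;226;485;327;834;17;410;
408;93;28;386;382;374;501;487;92;37;498;773;358;438;826;65;64;91;56;767;98;73;
803;46;42;51;336;931;33;24;349;32;41;836;51;471;833;23;620;22;226;1012;834;766;
757;759;256;51;42;336;33;64;98;73;803;74;954;75;258;927;757;876;834;64;98;73;
803;42;931;33;24;349;25;32;41;836;833;22;23;31;746;41;74;1062;75;258;927;743;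
226;23;103;14;806;91;46;620;13;36;558;56;74;664;75;258;927;437;12;224;528;602;
355;31;863;41;996;425;327;834;757;42;33;24;349;25;103;32;98;74;544;75;91;56;
888;46;23;14;806;22;611;31;41;615;13;660;12;224;657;41;614;610;609;36;66;92;
57;373;47;449;776;768;763;437;554;73;942;793;875;91;46;23;41;613;31;216;607;
608;56;22;31;747;339;31;735;21;23;12;800;14;806;41;13;36;663;1068;653;1004;41;
36;1011;616;594;734;36;66;92;57;373;47;449;776;768;763;437;23;14;806;41;1060;
31;216;995;591;91;23;355;22;338;32;56;888;46;609;36;66;92;57;373;47;449;776;
768;763;437;41;593;594;352;327;98;74;949;91;56;887;46;884;36;66;92;57;373;47;
449;776;768;763;437;75;553;73;535;793;874;33;98;74;947;73;533;922;870;834;103;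
209;104;210;99;98;33;302;32;301;42;51;336;31;300;41;73;64;803;537;64;930;55;
91;46;441;36;74;65;805;56;483;66;268;965;925;438;826;65;256;74;949;75;91;56;
887;46;884;36;477;437;553;793;872;834;207;211;737;711;426;34;54;91;46;35;55;
444;847;55;441;102;97;33;42;53;433;830;53;432;52;63;346;41;32;431;64;474;65;
256;865;32;866;64;31;22;746;24;23;1028;1027;25;251;23;103;14;398;36;13;661;12;
224;514;56;65;767;484;92;47;57;66;781;65;905;369;37;26;375;775;93;48;455;453;
450;447;440;344;867;473;65;256;865;824;53;42;424;32;23;752;41;52;431;24;880;25;
251;459;52;460;24;51;62;340;64;63;622;621;65;256;63;98;74;804;56;73;1067;72;
235;920;36;25;361;890;92;47;37;26;375;25;499;775;57;66;781;369;93;48;455;453;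
450;447;440;750;461;879;25;251;459;418;36;25;361;24;890;23;238;886;56;65;767;
64;484;63;245;480;92;47;37;26;375;25;24;499;251;775;57;66;781;65;64;905;256;
369;93;48;455;453;450;447;440;56;724;92;57;728;36;25;361;899;47;93;37;26;375;
25;24;33;42;53;433;830;53;432;52;712;824;499;251;775;48;455;453;725;447;717;
103;209;104;210;99;98;97;36;318;92;37;322;56;65;767;493;47;93;57;66;781;65;64;
53;42;33;433;424;33;432;32;306;418;905;256;369;48;455;453;319;447;311;206;207;
211;35;55;442;56;97;65;767;66;92;57;67;504;98;93;36;47;451;492;102;26;37;782;
47;1040;778;77;68;414;819;68;818;47;37;635;27;38;791;58;48;511;76;575;75;271;
976;48;510;509;629;58;76;982;75;271;977;48;291;76;979;411;37;323;47;494;415;77;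
816;814;93;68;792;788;780;907;893;92;57;904;367;764;724;844;36;102;25;361;92;
47;37;56;451;55;26;27;910;57;97;66;376;1041;729;97;66;634;67;93;58;385;103;38;
48;917;16;981;15;260;17;273;570;48;916;915;28;386;382;783;1035;900;498;449;276;
37;93;55;26;27;910;103;38;16;576;15;260;17;273;571;28;287;48;288;16;573;817;
28;386;382;498;97;65;56;767;766;56;33;42;53;433;830;53;432;52;63;346;64;98;74;
951;73;247;75;258;513;66;771;57;67;785;58;787;380;367;865;824;24;103;53;42;424;
32;23;752;14;545;13;236;15;249;919;418;64;98;23;32;752;42;52;63;346;603;41;63;
604;62;51;336;73;803;74;1061;75;258;926;73;395;51;731;72;61;799;798;794;422;
749;14;52;63;346;73;74;62;803;42;952;51;1103;326;247;42;74;952;75;258;513;22;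
13;397;32;41;431;74;698;75;258;513;31;741;41;827;740;32;31;41;431;74;699;75;
258;513;732;330;42;32;546;41;22;31;742;13;397;63;655;62;51;336;73;803;74;700;
75;258;926;73;395;51;731;72;61;799;798;794;13;801;31;325;12;21;393;392;388;422;
63;343;32;62;51;335;41;421;334;736;416;13;236;15;249;684;66;771;57;67;785;58;
787;380;367;63;245;480;26;365;27;379;38;381;786;23;238;886;66;57;373;776;763;
56;724;719;57;452;56;97;67;378;55;898;65;767;66;98;76;973;407;777;367;727;446;
26;55;501;97;56;65;767;103;33;42;53;433;830;53;432;52;63;346;64;98;74;951;73;
247;75;258;513;66;771;57;67;785;93;58;787;380;774;367;865;824;53;42;424;32;23;
752;24;15;406;14;545;13;236;919;459;418;64;98;24;15;406;23;32;752;42;52;63;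
346;603;41;63;604;62;51;336;73;803;74;1061;75;258;926;73;395;51;731;72;61;799;
798;794;422;749;14;52;63;346;73;74;62;803;42;952;51;1103;326;247;42;74;952;75;
258;513;22;13;397;32;41;431;74;698;75;258;513;31;741;41;827;740;32;31;41;431;
74;699;75;258;513;732;330;42;32;546;41;22;31;742;13;397;63;655;62;51;336;73;
803;74;700;75;258;926;73;395;51;731;72;61;799;798;794;13;801;31;325;12;21;393;
392;388;422;63;343;32;62;51;335;41;421;334;736;416;13;236;684;23;238;886;66;
771;57;67;785;93;58;787;380;774;367;63;245;480;104;210;99;98;24;365;23;344;33;
42;53;433;830;53;432;52;63;346;64;74;951;73;247;75;258;513;865;824;886;207;211;
65;766;66;57;373;776;763;56;724;719;773;26;56;445;55;487;845;358;318;55;438;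
102;25;360;56;26;92;37;779;47;855;370;362;357;437;313;97;102;25;35;55;436;420;
353;65;55;35;436;826;759;35;55;436;420;55;826;33;42;53;433;830;53;432;52;63;
346;64;98;75;807;74;951;73;247;513;754;865;824;53;42;424;32;23;752;24;103;15;
401;14;545;13;236;919;348;459;418;98;103;15;24;401;23;238;552;75;64;807;63;245;
958;24;64;23;32;752;42;52;63;346;603;41;63;604;62;51;336;73;803;74;1061;926;
73;395;51;731;72;61;799;798;794;422;749;14;52;63;346;13;22;397;32;42;595;31;
74;697;73;247;513;732;801;42;74;952;73;247;513;32;41;431;74;22;698;31;699;732;
73;247;513;22;31;741;41;827;740;330;42;32;546;41;22;31;742;13;397;63;655;62;
51;336;73;803;74;700;926;73;395;51;731;72;61;799;798;794;13;801;31;325;12;21;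
393;392;388;422;63;343;32;62;51;335;41;421;334;736;416;13;236;32;919;22;520;42;
31;325;12;21;393;392;388;330;63;245;52;865;74;946;73;62;938;937;793;23;238;32;
459;14;540;13;22;532;531;387;24;348;23;238;32;459;22;463;21;333;42;31;325;324;
330;64;754;63;245;52;865;62;869;61;739;42;51;731;730;736;35;55;436;420;303;55;
35;436;826;709;419;33;240;54;825;53;243;42;423;52;417;32;823;416;102;208;103;
209;104;210;99;98;97;55;54;43;53;308;91;46;315;314;309;304;254;91;46;312;56;
54;43;53;308;65;767;63;52;753;751;52;332;62;42;51;336;64;73;803;389;359;41;
299;51;64;73;803;390;342;297;737;304;43;298;317;310;296;206;207;211;97;205;98;
206;99;207;104;103;102;101;35;34;43;33;714;91;46;721;720;715;710;253;91;46;718;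
36;34;43;33;714;25;361;23;32;347;345;32;738;22;42;31;742;24;13;397;795;765;41;
705;31;24;13;397;796;748;703;331;710;43;704;723;716;702;208;209;210;211;200])%N.

Definition all_patterns : list pattern :=
  checkerboards ++ patterns ++ map reflect_pattern patterns.

Lemma all_patterns_ok : forallb pattern_ok all_patterns = true.
Proof. vm_compute; reflexivity. Qed.

Lemma decision_tree_ok :
  dtree_ok (base_clauses ++ map clause_of all_patterns) decision_tree [(0%N, 0%N)] = true.
Proof. vm_compute; reflexivity. Qed.

Definition holds (s : N -> bool) (c : N * N) : Prop :=
  (forall i, N.testbit (fst c) i = true -> s i = true) /\
  (forall i, N.testbit (snd c) i = true -> s i = false).

Lemma subm_testbit a b i : subm a b = true -> N.testbit a i = true -> N.testbit b i = true.
Proof.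
unfold subm; rewrite N.eqb_eq; intros E Ha.
assert (X := N.ldiff_spec a b i); rewrite E, N.bits_0, Ha in X.
now destruct (N.testbit b i).
Qed.

Lemma dtree_sound cl s d : forall st, dtree_ok cl d st = true ->
  forall x, In x st -> holds s x -> exists c, In c cl /\ holds s c.
Proof.
induction d as [|i d IH]; intros [|[T F] st]; try easy; cbn [dtree_ok].
intros Hd x Hx Hs; destruct (N.ltb i 200).
- destruct Hx as [<-|Hx]; [|apply (IH _ Hd x); [now right; right|easy]].
  destruct Hs as [HT HF]; destruct (s i) eqn:E.
  + apply (IH _ Hd (N.lor T (bit i), F)); [now left|]; split; [|exact HF]; simpl; intros j.
    rewrite N.lor_spec, testbit_bit, orb_true_iff, N.eqb_eq; intros [Hj|<-]; auto.
  + apply (IH _ Hd (T, N.lor F (bit i))); [now right; left|]; split; [exact HT|]; simpl; intros j.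
    rewrite N.lor_spec, testbit_bit, orb_true_iff, N.eqb_eq; intros [Hj|<-]; auto.
- destruct (nth_error cl _) as [c|] eqn:E; [|easy].
  rewrite !andb_true_iff in Hd; destruct Hd as [[H1 H2] H3].
  destruct Hx as [<-|Hx]; [|now apply (IH _ H3 x)].
  destruct Hs as [HT HF].
  exists c; split; [now apply nth_error_In in E|split]; intros j Hj.
  + now apply HT, (subm_testbit _ _ _ H1).
  + now apply HF, (subm_testbit _ _ _ H2).
Qed.

Section LocalSurgery.
Variables xl xr yb yt : Z.
Variable Fr : cell -> cell -> Prop.
Hypothesis Fr_sym : forall p q, Fr p q -> Fr q p.
Hypothesis xlP : xl <= -4.
Hypothesis xrP : 1 <= xr.
Hypothesis ybP : yb <= 0.
Hypothesis ytP : 0 <= yt.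
Hypothesis tallP : 4 <= yt \/ yb <= -4.

Local Notation inG := (Gb xl xr yb yt).
Local Notation incls := (cls xl xr yb yt).
Local Notation isvalid := (valid xl xr yb yt Fr).

Definition assignment (L : cell -> bool) (i : N) : bool :=
  if N.ltb i 90 then inG (cell_of i) && L (cell_of i)
  else if N.ltb i 95 then Z.of_N i - 89 <=? xr
  else if N.ltb i 100 then Z.of_N i - 95 <=? yt
  else yb <=? 100 - Z.of_N i.

Lemma tb_testbit m c : tb m c = true -> N.testbit m (idx c) = true /\ (idx c < 90)%N.
Proof.
unfold tb; rewrite andb_true_iff, inboxP; intros [Hb Hm]; split; [easy|unfold idx; lia].
Qed.

Lemma idx_label L m c v : (forall i, N.testbit m i = true -> assignment L i = v) ->
  tb m c = true -> inG c && L c = v.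
Proof.
intros Hm Hc; destruct (tb_testbit _ _ Hc) as [H1 H2].
assert (X := Hm _ H1); unfold assignment in X.
apply N.ltb_lt in H2; rewrite H2, cell_of_idx in X; [easy|].
now apply tb_inbox in Hc.
Qed.

Lemma line_holds L base k v : (forall i, N.testbit (line base k) i = true -> assignment L i = v) ->
  k = 0%N \/ assignment L (base + k) = v.
Proof.
unfold line; intros Hl; destruct (N.eqb_spec k 0) as [->|Hk]; [now left|right].
apply Hl; now rewrite testbit_bit, N.eqb_refl.
Qed.

Lemma right_maskP k c : (0 < k)%N -> (k < 5)%N -> inbox c = true ->
  tb (line_mask right_masks k) c = (Z.of_N k + 1 <=? fst c).
Proof.
intros H1 H2; assert (k = 1 \/ k = 2 \/ k = 3 \/ k = 4)%N as [-> |[-> |[-> | ->]]] by lia;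
  intros Hc; apply eqb_prop;
  match goal with |- eqb (tb (line_mask ?l ?k) c) (?a <=? _) = true =>
    exact (box_forall (fun c => eqb (tb (line_mask l k) c) (a <=? fst c)) eq_refl c Hc) end.
Qed.

Lemma top_maskP k c : (0 < k)%N -> (k < 5)%N -> inbox c = true ->
  tb (line_mask top_masks k) c = (Z.of_N k <=? snd c).
Proof.
intros H1 H2; assert (k = 1 \/ k = 2 \/ k = 3 \/ k = 4)%N as [-> |[-> |[-> | ->]]] by lia;
  intros Hc; apply eqb_prop;
  match goal with |- eqb (tb (line_mask ?l ?k) c) (?a <=? _) = true =>
    exact (box_forall (fun c => eqb (tb (line_mask l k) c) (a <=? snd c)) eq_refl c Hc) end.
Qed.

Lemma bottom_maskP k c : (0 < k)%N -> (k < 5)%N -> inbox c = true ->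
  tb (line_mask bottom_masks k) c = (snd c <=? - Z.of_N k).
Proof.
intros H1 H2; assert (k = 1 \/ k = 2 \/ k = 3 \/ k = 4)%N as [-> |[-> |[-> | ->]]] by lia;
  intros Hc; apply eqb_prop;
  match goal with |- eqb (tb (line_mask ?l ?k) c) (_ <=? ?a) = true =>
    exact (box_forall (fun c => eqb (tb (line_mask l k) c) (snd c <=? a)) eq_refl c Hc) end.
Qed.

Lemma pattern_progress L p : isvalid L -> pattern_ok p = true ->
  holds (assignment L) (clause_of p) -> progress xl xr yb yt Fr L.
Proof.
intros HL; destruct p as [A B er et eb ar at' ab p]; unfold pattern_ok, clause_of, holds.
cbn [fst snd]; cbv zeta; rewrite !andb_true_iff, !N.ltb_lt, !N.eqb_eq.
intros (((((((((((O1 & O2) & O3) & O4) & O5) & O6) & O7) & O8) & O9) & O10) & O11) & O12).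
intros [HT HF].
assert (T0 : forall i, N.testbit A i = true -> assignment L i = true)
  by (intros i Hi; apply HT; now rewrite N.lor_spec, Hi).
assert (T1 := line_holds L 90 er true
  (fun i Hi => HT i ltac:(now rewrite !N.lor_spec, Hi, ?orb_true_r))).
assert (T2 := line_holds L 95 et true
  (fun i Hi => HT i ltac:(now rewrite !N.lor_spec, Hi, ?orb_true_r))).
assert (T3 := line_holds L 100 eb true
  (fun i Hi => HT i ltac:(now rewrite !N.lor_spec, Hi, ?orb_true_r))).
assert (F0 : forall i, N.testbit B i = true -> assignment L i = false)
  by (intros i Hi; apply HF; now rewrite N.lor_spec, Hi).
assert (F1 := line_holds L 90 ar false
  (fun i Hi => HF i ltac:(now rewrite !N.lor_spec, Hi, ?orb_true_r))).
assert (F2 := line_holds L 95 at' false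
  (fun i Hi => HF i ltac:(now rewrite !N.lor_spec, Hi, ?orb_true_r))).
assert (F3 := line_holds L 100 ab false
  (fun i Hi => HF i ltac:(now rewrite !N.lor_spec, Hi, ?orb_true_r))).
clear HT HF.
assert (LR : forall k v, (k < 5)%N -> assignment L (90 + k) = v -> (Z.of_N k + 1 <=? xr) = v).
{ intros k v Hk; unfold assignment.
  destruct (N.ltb_spec (90 + k) 90); [lia|]; destruct (N.ltb_spec (90 + k) 95); [|lia].
  intros <-; f_equal; lia. }
assert (LT : forall k v, (k < 5)%N -> assignment L (95 + k) = v -> (Z.of_N k <=? yt) = v).
{ intros k v Hk; unfold assignment.
  destruct (N.ltb_spec (95 + k) 90); [lia|]; destruct (N.ltb_spec (95 + k) 95); [lia|].
  destruct (N.ltb_spec (95 + k) 100); [|lia].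
  intros <-; f_equal; lia. }
assert (LB : forall k v, (k < 5)%N -> assignment L (100 + k) = v -> (yb <=? - Z.of_N k) = v).
{ intros k v Hk; unfold assignment.
  destruct (N.ltb_spec (100 + k) 90); [lia|]; destruct (N.ltb_spec (100 + k) 95); [lia|].
  destruct (N.ltb_spec (100 + k) 100); [lia|].
  intros <-; f_equal; lia. }
assert (Ex : forall c, tb (N.lor A B) c = true -> inG c = true /\ inwin c).
{ intros c Hc.
  assert (Wc : inwin c).
  { apply tb_win; rewrite tb_lor, orb_true_iff in Hc.
    destruct Hc as [Hc|Hc]; now apply (subm_tb _ win_mask) in Hc. }
  assert (Bc := inwin_box c Wc); split; [|easy].
  assert (X1 := tb_land (N.lor A B) (line_mask right_masks (er + 1)) c).
  assert (X2 := tb_land (N.lor A B) (line_mask top_masks (et + 1)) c).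
  assert (X3 := tb_land (N.lor A B) (line_mask bottom_masks (eb + 1)) c).
  rewrite O9, tb_0, Hc, right_maskP in X1 by (easy || lia).
  rewrite O10, tb_0, Hc, top_maskP in X2 by (easy || lia).
  rewrite O11, tb_0, Hc, bottom_maskP in X3 by (easy || lia).
  simpl in X1, X2, X3; symmetry in X1, X2, X3; rewrite Z.leb_gt in X1, X2, X3.
  unfold inwin in Wc.
  assert (Y1 : Z.of_N er + 1 <= xr)
    by (destruct T1 as [->|T1]; [simpl; lia|apply LR in T1; [now apply Z.leb_le|lia]]).
  assert (Y2 : Z.of_N et <= yt)
    by (destruct T2 as [->|T2]; [simpl; lia|apply LT in T2; [now apply Z.leb_le|lia]]).
  assert (Y3 : yb <= - Z.of_N eb)
    by (destruct T3 as [->|T3]; [simpl; lia|apply LB in T3; [now apply Z.leb_le|lia]]).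
  unfold Gb; rewrite !andb_true_iff, !Z.leb_le; lia. }
apply (plan_sound xl xr yb yt Fr Fr_sym L B
  (N.lor (N.lor A B) (N.lor (line_mask right_masks ar) (N.lor (line_mask top_masks at') (line_mask bottom_masks ab))))
  p A B L); auto.
split.
- intros b c Hc.
  assert (Hc' : tb (N.lor A B) c = true)
    by (rewrite tb_lor; destruct b; simpl in Hc; rewrite Hc; auto using orb_true_r).
  destruct (Ex c Hc') as [Gc Wc]; split; [|easy]; split; [easy|].
  destruct b; simpl in Hc.
  + now assert (X := idx_label L A c true T0 Hc); rewrite Gc in X.
  + now assert (X := idx_label L B c false F0 Hc); rewrite Gc in X.
- intros c; rewrite !tb_lor, !orb_true_iff.
  assert (Z0 : forall l, tb (line_mask (0%N :: l) 0) c = true -> False)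
    by (intros l; unfold line_mask; simpl; now rewrite tb_0).
  intros [[Hc|Hc]|[Hc|[Hc|Hc]]]; auto; right; right;
    assert (Bc := tb_inbox _ _ Hc).
  + destruct (N.eq_dec ar 0) as [->|Ha]; [now apply Z0 in Hc|].
    destruct F1 as [F1|F1]; [easy|]; apply LR in F1; [|lia].
    rewrite right_maskP, Z.leb_le in Hc by (easy || lia); apply Z.leb_gt in F1.
    unfold Gb; replace (fst c <=? xr) with false by (symmetry; apply Z.leb_gt; lia).
    now rewrite andb_false_r.
  + destruct (N.eq_dec at' 0) as [->|Ha]; [now apply Z0 in Hc|].
    destruct F2 as [F2|F2]; [easy|]; apply LT in F2; [|lia].
    rewrite top_maskP, Z.leb_le in Hc by (easy || lia); apply Z.leb_gt in F2.
    unfold Gb; replace (snd c <=? yt) with false by (symmetry; apply Z.leb_gt; lia).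
    now rewrite andb_false_r.
  + destruct (N.eq_dec ab 0) as [->|Ha]; [now apply Z0 in Hc|].
    destruct F3 as [F3|F3]; [easy|]; apply LB in F3; [|lia].
    rewrite bottom_maskP, Z.leb_le in Hc by (easy || lia); apply Z.leb_gt in F3.
    unfold Gb; replace (yb <=? snd c) with false by (symmetry; apply Z.leb_gt; lia).
    now rewrite andb_false_r.
Qed.

Lemma base_clauses_absurd L c : L (0, 0) = true -> L (1, 0) = false ->
  In c base_clauses -> ~ holds (assignment L) c.
Proof.
intros Lu Lv Hc [HT HF].
assert (X : forall i, N.testbit (bit i) i = true) by (intros; now rewrite testbit_bit, N.eqb_refl).
assert (Gu : inG (0, 0) = true) by (unfold Gb; simpl; rewrite !andb_true_iff, !Z.leb_le; lia).
repeat (destruct Hc as [<-|Hc]; [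
  first
  [ assert (Y := HF 44%N (X 44%N)); unfold assignment in Y; simpl in Y;
    change (cell_of 44) with (0, 0) in Y; rewrite Gu, Lu in Y; easy
  | assert (Y := HT 45%N (X 45%N)); unfold assignment in Y; simpl in Y;
    change (cell_of 45) with (1, 0) in Y; rewrite Lv, andb_false_r in Y; easy
  | assert (Y1 := HT _ (X _)); assert (Y2 := HF _ (X _)); unfold assignment in Y1, Y2;
    simpl in Y1, Y2; rewrite Z.leb_le in Y1; rewrite Z.leb_gt in Y2; lia
  | assert (Y1 := HF 99%N eq_refl); assert (Y2 := HF 104%N eq_refl);
    unfold assignment in Y1, Y2; simpl in Y1, Y2; rewrite !Z.leb_gt in Y1, Y2; lia ] | ]).
easy.
Qed.

Theorem local_surgery L : isvalid L -> L (0, 0) = true -> L (1, 0) = false ->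
  exists L', isvalid L' /\ L' (0, 0) = L' (1, 0) /\ forall c, ~ inflip c -> L' c = L c.
Proof.
remember (phi xl xr yb yt L) as n eqn:En; revert L En.
induction n as [n IH] using (well_founded_induction lt_wf); intros L -> HL Lu Lv.
destruct (dtree_sound _ (assignment L) _ _ decision_tree_ok (0%N, 0%N)) as (c & Hc & Hh).
{ now left. }
{ split; intros i; simpl; rewrite ?N.bits_0; easy. }
apply in_app_iff in Hc; destruct Hc as [Hc|Hc].
{ now destruct (base_clauses_absurd L c Lu Lv Hc). }
apply in_map_iff in Hc; destruct Hc as (p & <- & Hp).
assert (Ok := all_patterns_ok); rewrite forallb_forall in Ok.
destruct (pattern_progress L p HL (Ok p Hp) Hh) as (L1 & V1 & O1 & [E|(U1 & W1 & P1)]).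
- now exists L1.
- destruct (IH _ P1 L1 eq_refl V1 U1 W1) as (L2 & V2 & E2 & O2).
  exists L2; split; [easy|split; [easy|]]; intros d Hd; rewrite O2; auto.
Qed.

End LocalSurgery.

(** * Lattice coordinates adapted to an edge of the grid *)

(* Coordinates with origin [(i0, j0)]: [ax] tells whether the first axis is the
   first coordinate, [fl] reverses it. *)
Definition coord (ax fl : bool) (i0 j0 i j : nat) : cell :=
  let dx := Z.of_nat i - Z.of_nat i0 in
  let dy := Z.of_nat j - Z.of_nat j0 in
  let x := if ax then dx else dy in
  let y := if ax then dy else dx in
  (if fl then - x else x, y).

Record bounds := Bounds { bl : Z; br : Z; bb : Z; bt : Z }.

Definition coord_bounds (ax fl : bool) (m n i0 j0 : nat) : bounds :=
  let a := if ax then i0 else j0 in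
  let b := if ax then j0 else i0 in
  let M := if ax then m else n in
  let N := if ax then n else m in
  let x0 := - Z.of_nat a in
  let x1 := Z.of_nat M - 1 - Z.of_nat a in
  Bounds (if fl then - x1 else x0) (if fl then - x0 else x1)
    (- Z.of_nat b) (Z.of_nat N - 1 - Z.of_nat b).

Definition roomy (b : bounds) : Prop :=
  bl b <= -4 /\ 1 <= br b /\ bb b <= 0 /\ 0 <= bt b /\ (4 <= bt b \/ bb b <= -4).

Definition origin : cell := (0, 0).
Definition right_of_origin : cell := (1, 0).

Definition in_bounds (b : bounds) : cell -> bool := Gb (bl b) (br b) (bb b) (bt b).

Lemma in_boundsP b c : in_bounds b c = true <->
  bl b <= fst c <= br b /\ bb b <= snd c <= bt b.
Proof. unfold in_bounds, Gb; rewrite !andb_true_iff, !Z.leb_le; lia. Qed.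

Lemma coord_in_bounds ax fl m n i0 j0 i j : (i < m)%nat -> (j < n)%nat ->
  in_bounds (coord_bounds ax fl m n i0 j0) (coord ax fl i0 j0 i j) = true.
Proof. intros; apply in_boundsP; destruct ax, fl; simpl; lia. Qed.

Lemma coord_surj ax fl m n i0 j0 p : (i0 < m)%nat -> (j0 < n)%nat ->
  in_bounds (coord_bounds ax fl m n i0 j0) p = true ->
  exists i j, (i < m)%nat /\ (j < n)%nat /\ coord ax fl i0 j0 i j = p.
Proof.
intros Hi Hj; rewrite in_boundsP; destruct p as [x y]; simpl; intros Hb.
set (x' := if fl then - x else x).
exists (Z.to_nat ((if ax then x' else y) + Z.of_nat i0)),
       (Z.to_nat ((if ax then y else x') + Z.of_nat j0)).
unfold coord; destruct ax, fl; unfold x' in *; simpl in *;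
  (split; [lia|split; [lia|f_equal; lia]]).
Qed.

Lemma coord_inj ax fl i0 j0 i j i' j' :
  coord ax fl i0 j0 i j = coord ax fl i0 j0 i' j' -> i = i' /\ j = j'.
Proof. unfold coord; destruct ax, fl; intros E; injection E; lia. Qed.

Lemma coord_adj ax fl i0 j0 i j i' j' :
  adjc (coord ax fl i0 j0 i j) (coord ax fl i0 j0 i' j') <->
  (i = i' /\ (S j = j' \/ S j' = j)) \/ (j = j' /\ (S i = i' \/ S i' = i)).
Proof. unfold adjc, coord; destruct ax, fl; simpl; lia. Qed.

Lemma coord_origin ax fl i j : coord ax fl i j i j = origin.
Proof. unfold coord, origin; destruct ax, fl; f_equal; lia. Qed.

(* The surgery needs room behind the origin; at least one of the two endpoints
   of the edge has it. *)
Lemma coord_exists m n i j i' j' : (10 <= m)%nat -> (10 <= n)%nat ->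
  (i < m)%nat -> (j < n)%nat -> (i' < m)%nat -> (j' < n)%nat ->
  (i = i' /\ (S j = j' \/ S j' = j)) \/ (j = j' /\ (S i = i' \/ S i' = i)) ->
  exists ax fl, exists swap : bool,
    let i0 := if swap then i' else i in let j0 := if swap then j' else j in
    let i1 := if swap then i else i' in let j1 := if swap then j else j' in
    let b := coord_bounds ax fl m n i0 j0 in
    coord ax fl i0 j0 i1 j1 = right_of_origin /\ roomy b.
Proof.
intros Hm Hn H1 H2 H3 H4 Ha.
assert (X : exists ax, (ax = true /\ j = j' /\ (S i = i' \/ S i' = i)) \/
                       (ax = false /\ i = i' /\ (S j = j' \/ S j' = j)))
  by (destruct Ha as [Ha|Ha]; [exists false|exists true]; tauto).
destruct X as [ax [(-> & <- & Hi)|(-> & <- & Hj)]].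
- exists true; destruct Hi as [<-|<-].
  + destruct (le_lt_dec 4 i); [exists false, false|exists true, true];
      cbv zeta; unfold roomy, right_of_origin, coord, coord_bounds; cbn [bl br bb bt]; (split; [f_equal; lia|lia]).
  + destruct (le_lt_dec 4 i'); [exists false, true|exists true, false];
      cbv zeta; unfold roomy, right_of_origin, coord, coord_bounds; cbn [bl br bb bt]; (split; [f_equal; lia|lia]).
- exists false; destruct Hj as [<-|<-].
  + destruct (le_lt_dec 4 j); [exists false, false|exists true, true];
      cbv zeta; unfold roomy, right_of_origin, coord, coord_bounds; cbn [bl br bb bt]; (split; [f_equal; lia|lia]).
  + destruct (le_lt_dec 4 j'); [exists false, true|exists true, false];
      cbv zeta; unfold roomy, right_of_origin, coord, coord_bounds; cbn [bl br bb bt]; (split; [f_equal; lia|lia]).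
Qed.

Lemma idx_inj c d : inbox c = true -> inbox d = true -> idx c = idx d -> c = d.
Proof. intros Hc Hd E; rewrite <- (cell_of_idx c Hc), E; now apply cell_of_idx. Qed.

Lemma idx_lt c : inbox c = true -> (N.to_nat (idx c) < 90)%nat.
Proof. rewrite inboxP; unfold idx; lia. Qed.

Lemma inflip_inbox c : inflip c -> inbox c = true.
Proof. rewrite inboxP; unfold inflip; lia. Qed.

Lemma inflip_adjc_inbox c d : inflip c -> adjc c d -> inbox d = true.
Proof. rewrite inboxP; unfold inflip, adjc; lia. Qed.

End Lattice.

Require Import Defs.
From mathcomp Require Import all_boot all_order all_algebra.
From mathcomp Require Import boolp reals sequences exp.
From mathcomp Require Import lra.

Import Lattice.

Set Implicit Arguments.
Unset Strict Implicit.
Unset Printing Implicit Defensive.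

Import Order.TTheory GRing.Theory Num.Theory.

(** * Spanning trees *)

Section SpanningTrees.
Variable T : finType.
Implicit Types (V S : {set T}) (E F : {set {set T}}).

Lemma edge_rel_sym F : symmetric (edge_rel F).
Proof. by move=> x y; rewrite /edge_rel setUC. Qed.

Lemma connect_edge_sym F : connect_sym (edge_rel F).
Proof. exact/sym_connect_sym/edge_rel_sym. Qed.

Lemma path_off_pair (e e' : rel T) x y z s :
  (forall a b, e' a b -> a \notin [:: x; y] -> e a b) ->
  all (fun a => a \notin [:: x; y]) (z :: s) ->
  path e' z (rcons s x) -> path e z (rcons s x).
Proof.
move=> ee'; elim: s z => [|w s IH] z /=.
  by move=> /andP[Hz _] /andP[H1 _]; rewrite ee'.
move=> /andP[Hz Hs] /andP[H1 H2]; rewrite ee' //=.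
exact: IH.
Qed.

Lemma acyclic_add_edge F a b : acyclic_graph F -> ~~ connect (edge_rel F) a b ->
  acyclic_graph ([set a; b] |: F).
Proof.
move=> acF nab [c [sc /andP[cc uc]]]; apply: acF.
case: (boolP (all (fun x => edge_rel F x (next c x)) c)) => [/allP al|].
  by exists c; split=> //; apply/andP; split=> //; apply: cycle_from_next.
case/allPn=> x xc nF; exfalso.
have exy : edge_rel ([set a; b] |: F) x (next c x) by exact: next_cycle.
rewrite /edge_rel in nF; move: exy; rewrite /edge_rel in_setU1 (negbTE nF) orbF => /eqP Exy.
have [i s Es] := rot_to xc.
have us : uniq (x :: s) by rewrite -Es rot_uniq.
have ss : 3 <= size (x :: s) by rewrite -Es size_rot.
have cs : cycle (edge_rel ([set a; b] |: F)) (x :: s) by rewrite -Es rot_cycle.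
have ns : next (x :: s) x = next c x by rewrite -Es next_rot.
case: s => [|y [|z s]] // in Es us ss cs ns *.
rewrite /= eqxx in ns; rewrite -{}ns in Exy.
have cyx : connect (edge_rel F) y x.
  apply/connectP; exists (rcons (z :: s) x); last by rewrite last_rcons.
  move: cs => /= /andP[_] /andP[H1 H2].
  have ee' u w : edge_rel ([set a; b] |: F) u w -> (u \notin [:: x; y]) || (w \notin [:: x; y]) ->
      edge_rel F u w.
    rewrite /edge_rel in_setU1 -Exy => /orP[/eqP Euw|//].
    have: u \in [set u; w] by rewrite !inE eqxx.
    have: w \in [set u; w] by rewrite !inE eqxx orbT.
    by rewrite Euw !inE => -> ->.
  move: us; rewrite /= !inE !negb_or => /and4P[/and3P[xy xz xs] /andP[yz ys] zs us].
  apply/andP; split.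
    by apply: ee' => //; rewrite !inE !negb_or [z == x]eq_sym [z == y]eq_sym xz yz orbT.
  apply: (path_off_pair (y := y) _ _ H2).
    by move=> u w H Hu; apply: ee'; rewrite // Hu.
  rewrite /= !inE !negb_or [z == x]eq_sym [z == y]eq_sym xz yz /=.
  apply/allP=> w ws; rewrite !inE negb_or.
  by apply/andP; split; apply: contraTneq ws => ->.
move: nab; have ax : [set a; b] = [set x; y] by [].
have: a \in [set x; y] by rewrite -ax !inE eqxx.
have: b \in [set x; y] by rewrite -ax !inE eqxx orbT.
rewrite !inE => /orP[]/eqP-> /orP[]/eqP->; rewrite ?connect0 //.
  by rewrite cyx.
by rewrite connect_edge_sym cyx.
Qed.

Lemma acyclicS F F' : F \subset F' -> acyclic_graph F' -> acyclic_graph F.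
Proof.
move=> /subsetP FF' ac [c [sc /andP[cc uc]]]; apply: ac; exists c; split=> //.
by apply/andP; split=> //; apply: sub_cycle cc => x y; apply: FF'.
Qed.

Lemma spanning_tree_extends V E F0 : F0 \subset E -> acyclic_graph F0 ->
  connected_graph V E -> exists2 F, spanning_tree V E F & F0 \subset F.
Proof.
move=> F0E ac0 [V0 cE].
pose P F := [&& F0 \subset F, F \subset E & `[< acyclic_graph F >]].
have P0 : P F0 by rewrite /P subxx F0E; apply/asboolP.
have [F /maxsetP[/and3P[F0F FE /asboolP acF] maxF] _] := maxset_exists P0.
exists F => //; split=> //; split=> // x y xV yV.
apply: (connect_sub _ (cE x y xV yV)) => a b abE.
apply/negPn/negP => nab.
rewrite /edge_rel in abE; have abF : [set a; b] |: F = F.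
  apply: maxF; last exact: subsetUr.
  rewrite /P (subset_trans F0F (subsetUr _ _)) subUset sub1set abE FE.
  by apply/asboolP/acyclic_add_edge.
by move/negP: nab; apply; apply/connect1; rewrite /edge_rel -abF setU11.
Qed.

End SpanningTrees.

(** * Surgery on pairs of spanning trees *)

Section GridSurgery.
Variables (T : finType) (E : {set {set T}}) (tau : T -> cell) (b : bounds).
Hypothesis tau_inj : injective tau.
Hypothesis tau_in : forall a, in_bounds b (tau a) = true.
Hypothesis tau_surj : forall p, in_bounds b p = true -> exists a, tau a = p.
Hypothesis E_adj : forall a c, [set a; c] \in E <-> adjc (tau a) (tau c).
Hypothesis E_pair : forall e, e \in E -> exists a c, e = [set a; c].
Hypothesis b_roomy : roomy b.

Definition flip_set : {set T} := [set a | `[< inflip (tau a) >]].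
Definition local_edges : {set {set T}} := [set e in E | [forall a in e, inbox (tau a)]].
Local Notation W := flip_set.
Local Notation K := local_edges.

Lemma notin_flip e a : e \in E -> e \notin K -> a \in e -> a \notin W.
Proof.
move=> eE eK ae; apply: contra eK => aW.
have [x [y exy]] := E_pair eE.
rewrite inE eE /=; apply/forallP => c; apply/implyP => ce.
move: aW; rewrite inE => /asboolP aW.
have [->|ca] := eqVneq c a; first exact: inflip_inbox.
apply: (inflip_adjc_inbox _ _ aW); apply/E_adj.
suff -> : [set a; c] = e by [].
move: ae ce ca; rewrite exy !inE => /orP[]/eqP-> /orP[]/eqP->; rewrite ?eqxx //.
by rewrite setUC.
Qed.

Lemma new_tree (V V' : {set T}) (F Fo : {set {set T}}) :
  F \subset induced_edges E V -> Fo \subset induced_edges E (~: V) ->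
  (forall a, a \notin W -> (a \in V') = (a \in V)) -> acyclic_graph F ->
  connected_graph V' [set e in (F :|: Fo) :|: K | e \subset V'] ->
  exists2 F', spanning_tree V' (induced_edges E V') F' & F' :\: K = F :\: K.
Proof.
move=> /subsetP FV /subsetP FoV VV' acF cV'.
have FoE e : e \in F :|: Fo -> e \in E.
  by rewrite inE => /orP[/FV|/FoV]; rewrite inE => /andP[].
have F0 : F :\: K \subset [set e in (F :|: Fo) :|: K | e \subset V'].
  apply/subsetP => e; rewrite in_setD => /andP[eK eF]; rewrite inE !in_setU eF /=.
  have eE := FoE e; rewrite in_setU eF in eE.
  apply/subsetP => a ae; rewrite (VV' a (notin_flip (eE isT) eK ae)).
  by have := FV e eF; rewrite inE => /andP[_ /subsetP]; apply.
have [F' [F'E cF' acF'] F0F'] := spanning_tree_extends F0 (acyclicS (subsetDl _ _) acF) cV'.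
exists F'.
  split=> //; apply: subset_trans F'E _; apply/subsetP => e.
  rewrite in_set in_setU => /andP[/orP[eF|eK] eV']; rewrite inE eV' andbT.
    exact: FoE.
  by move: eK; rewrite inE => /andP[].
apply/eqP; rewrite eqEsubset; apply/andP; split; apply/subsetP => e.
  rewrite in_setD => /andP[eK eF']; rewrite in_setD eK /=.
  have := subsetP F'E _ eF'; rewrite inE in_setU (negbTE eK) orbF => /andP[eFo eV'].
  move: (eFo); rewrite in_setU => /orP[//|eo].
  have [x [y exy]] := E_pair (FoE _ eFo).
  have xe : x \in e by rewrite exy !inE eqxx.
  have := VV' x (notin_flip (FoE _ eFo) eK xe).
  rewrite (subsetP eV' x xe) => /esym xV.
  have := FoV e eo; rewrite inE => /andP[_ /subsetP/(_ x xe)].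
  by rewrite inE xV.
move=> eFK; have := subsetP F0F' _ eFK => eF'.
by rewrite in_setD eF' andbT; move: eFK; rewrite in_setD => /andP[].
Qed.

Variables o w : T.
Hypothesis tau_o : tau o = origin.
Hypothesis tau_w : tau w = right_of_origin.

Lemma tree_surgery (S : {set T}) F1 F2 : (o \in S) != (w \in S) ->
  spanning_tree S (induced_edges E S) F1 ->
  spanning_tree (~: S) (induced_edges E (~: S)) F2 ->
  exists (S' : {set T}) (F1' F2' : {set {set T}}), [/\ (o \in S') = (w \in S'),
    spanning_tree S' (induced_edges E S') F1',
    spanning_tree (~: S') (induced_edges E (~: S')) F2',
    (forall a, a \notin W -> (a \in S') = (a \in S)) &
    F1' :\: K = F1 :\: K /\ F2' :\: K = F2 :\: K].
Proof.
move=> ow [F1E cF1 ac1] [F2E cF2 ac2].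
pose lab a := (a \in S) == (o \in S).
pose L p := [exists a, ceqb (tau a) p && lab a].
have L_tau a : L (tau a) = lab a.
  apply/existsP/idP => [[c /andP[/ceqbP/tau_inj ->]] //|la].
  by exists a; rewrite la andbT; apply/ceqbP.
pose Fr p q := exists a c, [/\ tau a = p, tau c = q & [set a; c] \in F1 :|: F2].
have Fr_sym p q : Fr p q -> Fr q p.
  by move=> [a [c [ap cq acF]]]; exists c, a; split=> //; rewrite setUC.
have edge_adj a c : [set a; c] \in F1 :|: F2 -> adjc (tau a) (tau c).
  by rewrite inE => acF; apply/E_adj; case/orP: acF => [/(subsetP F1E)|/(subsetP F2E)];
     rewrite inE => /andP[].
have conn_trees (V : {set T}) (F : {set {set T}}) b0 : F \subset F1 :|: F2 -> F \subset induced_edges E V ->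
    connected_graph V F -> (forall a, (a \in V) = (lab a == b0)) ->
    (exists c, cls (bl b) (br b) (bb b) (bt b) L b0 c) /\
    (forall p q, cls (bl b) (br b) (bb b) (bt b) L b0 p ->
       cls (bl b) (br b) (bb b) (bt b) L b0 q ->
       conn (joined (bl b) (br b) (bb b) (bt b) Fr) (cls (bl b) (br b) (bb b) (bt b) L b0) p q).
  move=> FF FV [V0 cV] Vlab.
  have clsV a : a \in V -> cls (bl b) (br b) (bb b) (bt b) L b0 (tau a).
    by rewrite Vlab => /eqP la; split; [exact: tau_in|rewrite L_tau].
  split; first by have /set0Pn[a aV] := V0; exists (tau a); apply: clsV.
  move=> p q [Gp Lp] [Gq Lq].
  have [a ap] := tau_surj Gp; have [c cq] := tau_surj Gq.
  have aV : a \in V by rewrite Vlab -L_tau ap Lp.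
  have cV' : c \in V by rewrite Vlab -L_tau cq Lq.
  rewrite -ap -cq; have /connectP[s ps ->] := cV a c aV cV'.
  elim: s a aV {ap} ps => [|x s IH] a aV /=; first by move=> _; constructor; apply: clsV.
  move=> /andP[ax ps].
  have xV : x \in V.
    have := subsetP FV _ ax; rewrite inE => /andP[_ /subsetP]; apply.
    by rewrite !inE eqxx orbT.
  have axF := subsetP FF _ ax.
  apply: (conn_trans _ _ _ (tau x)); last exact: IH.
  apply: conn_edge; try exact: clsV.
  split; first exact: edge_adj.
  split; first exact: tau_in.
  split; first exact: tau_in.
  by left; exists a, x.
have validL : valid (bl b) (br b) (bb b) (bt b) Fr L.
  move=> b0; case so: (o \in S); case: b0;
    [apply: (conn_trees S F1) | apply: (conn_trees (~: S) F2)
    |apply: (conn_trees (~: S) F2) | apply: (conn_trees S F1)];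
    rewrite ?subsetUl ?subsetUr //; move=> a; rewrite ?inE /lab so;
    by case: (a \in S).
have Lo : L origin = true by rewrite -tau_o L_tau /lab eqxx.
have Lw : L right_of_origin = false.
  by rewrite -tau_w L_tau /lab eq_sym (negbTE ow).
have [b_left [b_right [b_bottom [b_top b_tall]]]] := b_roomy.
have [L' [validL' [L'ow L'L]]] :=
  local_surgery _ _ _ _ _ Fr_sym b_left b_right b_bottom b_top b_tall L validL Lo Lw.
pose S' := [set a | L' (tau a) == (o \in S)].
have S'S a : a \notin W -> (a \in S') = (a \in S).
  rewrite !inE => /asboolP aW; rewrite L'L // L_tau /lab.
  by case: (a \in S); case: (o \in S).
have conn_new b1 : connected_graph [set a | L' (tau a) == b1]
    [set e in (F1 :|: F2) :|: K | e \subset [set a | L' (tau a) == b1]].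
  have [[c [Gc Lc]] cc] := validL' b1.
  split.
    by have [a ac] := tau_surj Gc; apply/set0Pn; exists a; rewrite inE ac Lc.
  move=> x y; rewrite !inE => /eqP Lx /eqP Ly.
  suff key q : conn (joined (bl b) (br b) (bb b) (bt b) Fr) (cls (bl b) (br b) (bb b) (bt b) L' b1)
      (tau x) q -> forall y, q = tau y -> connect (edge_rel
      [set e in F1 :|: F2 :|: K | e \subset [set a | L' (tau a) == b1]]) x y.
    exact: (key _ (cc (tau x) (tau y) (conj (tau_in x) Lx) (conj (tau_in y) Ly))).
  elim=> {y Ly} [_ y /tau_inj -> //|q1 q2 k1 IH h12 [G2 L2] y qy].
  have [G1 L1] := conn_r _ _ _ _ k1.
  have [z zq] := tau_surj G1.
  apply: (connect_trans (IH z (esym zq))); apply: connect1.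
  rewrite /edge_rel inE; apply/andP; split; last first.
    by apply/subsetP => t; rewrite !inE => /orP[]/eqP->; rewrite ?zq ?L1 -?qy ?L2.
  have [adj12 [_ [_ h]]] := h12.
  rewrite inE; case: h => [[a [c' [aq cq acF]]]|[i1 i2]]; apply/orP; [left|right].
    have -> : z = a by apply: tau_inj; rewrite zq aq.
    by have -> : y = c' by apply: tau_inj; rewrite -qy cq.
  rewrite inE; apply/andP; split; first by apply/E_adj; rewrite zq -qy.
  by apply/forallP => t; apply/implyP; rewrite !inE => /orP[]/eqP->; rewrite ?zq -?qy.
have cS' : connected_graph S' [set e in (F1 :|: F2) :|: K | e \subset S'] by exact: conn_new.
have cC : connected_graph (~: S') [set e in (F2 :|: F1) :|: K | e \subset ~: S'].
  have -> : ~: S' = [set a | L' (tau a) == ~~ (o \in S)].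
    by apply/setP => a; rewrite !inE; case: (L' _); case: (o \in S).
  by rewrite [F2 :|: F1]setUC; apply: conn_new.
have [F1' t1 k1] := new_tree F1E F2E S'S ac1 cS'.
have F1E' : F1 \subset induced_edges E (~: ~: S) by rewrite setCK.
have S'S' a : a \notin W -> (a \in ~: S') = (a \in ~: S).
  by move=> aW; rewrite [LHS]in_setC [RHS]in_setC S'S.
have [F2' t2 k2] := new_tree F2E F1E' S'S' ac2 cC.
exists S', F1', F2'; split=> //.
by rewrite !inE tau_o tau_w L'ow.
Qed.

Lemma card_box : #|[set a | inbox (tau a)]| <= 90.
Proof.
pose f a : 'I_90 := inord (BinNat.N.to_nat (idx (tau a))).
rewrite -(card_ord 90) -(@card_in_imset _ _ f [set a | inbox (tau a)]) ?max_card //.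
move=> x y; rewrite !inE => ix iy /(congr1 val) /=.
rewrite !inordK; try by apply/ssrnat.ltP; apply: idx_lt.
by move/(Nnat.N2Nat.inj _ _)/(idx_inj _ _ ix iy)/tau_inj.
Qed.

Lemma card_flip_set : #|W| <= 90.
Proof.
apply: leq_trans card_box; apply/subset_leq_card/subsetP => a.
by rewrite !inE => /asboolP/inflip_inbox.
Qed.

Lemma card_local_edges : #|K| <= 90 * 90.
Proof.
set B := [set a | inbox (tau a)].
have KB : K \subset [set [set p.1; p.2] | p in setX B B].
  apply/subsetP => e; rewrite inE => /andP[eE /forallP eB].
  have [x [y exy]] := E_pair eE.
  apply/imsetP; exists (x, y); last by [].
  by rewrite !inE /=; apply/andP; split; apply: (implyP (eB _)); rewrite exy !inE eqxx ?orbT.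
apply: leq_trans (subset_leq_card KB) _.
apply: leq_trans (leq_imset_card _ _) _.
by rewrite cardsX; apply: leq_mul; apply: card_box.
Qed.

End GridSurgery.

Local Open Scope ring_scope.

(** * Weighted counting of pairs of trees *)

Lemma ler_sum_fibers (R : realType) (I J : finType) (X : {set I}) (Y : {set J})
    (f : I -> J) (p : I -> R) (q : J -> R) (c : R) (M : nat) :
  (forall x, x \in X -> f x \in Y /\ p x <= c * q (f x)) ->
  (forall y, 0 <= q y) -> 0 <= c ->
  (forall y, (#|[set x in X | f x == y]| <= M)%N) ->
  \sum_(x in X) p x <= c * M%:R * \sum_(y in Y) q y.
Proof.
move=> fXY q0 c0 cM.
apply: (@le_trans _ _ (\sum_(x in X) c * q (f x))).
  by apply: ler_sum => x /fXY[].
rewrite (partition_big f (mem Y)) /=; last by move=> x /fXY[].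
rewrite mulr_sumr; apply: ler_sum => y _.
rewrite (eq_bigr (fun=> c * q y)); last by move=> x /andP[_ /eqP->].
rewrite sumr_const -[X in X <= _]mulr_natl [c * M%:R]mulrC -mulrA.
rewrite ler_wpM2r ?mulr_ge0 // ler_nat.
by apply: leq_trans (cM y); rewrite cardsE.
Qed.

Section Counting.
Variables (R : realType) (T : finType) (E : {set {set T}}) (lambda : R).
Hypothesis lambda_ge0 : 0 <= lambda.

Definition trees (S : {set T}) : {set {set {set T}}} :=
  [set F | `[< spanning_tree S (induced_edges E S) F >]].

Definition forests (Pr : pred {set T}) :
    {set {set T} * ({set {set T}} * {set {set T}})} :=
  [set x | Pr x.1 & x.2 \in setX (trees x.1) (trees (~: x.1))].

Definition weight (S : {set T}) : R :=
  expR (- (lambda * (`|#|S|%:R - #|~: S|%:R| / 2))).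

Lemma sum_forests Pr :
  \sum_(x in forests Pr) weight x.1 =
  \sum_(S | Pr S) (sp S (induced_edges E S) * sp (~: S) (induced_edges E (~: S)))%:R * weight S.
Proof.
transitivity (\sum_(S | Pr S) \sum_(p in setX (trees S) (trees (~: S))) weight S).
  by rewrite pair_big_dep /=; apply: eq_bigl => x; rewrite inE.
by apply: eq_bigr => S _; rewrite sumr_const cardsX mulr_natl.
Qed.

Lemma sum_ordered (pr : pred {set {set T}}) (g : {set {set T}} -> R) :
  \sum_(S : {set T} | [&& S != set0, S != setT & pr [set S; ~: S]]) g [set S; ~: S] =
  2 * \sum_(P in two_partitions T | pr P) g P.
Proof.
rewrite (partition_big (fun S => [set S; ~: S])
  (fun P => (P \in two_partitions T) && pr P)) /=; last first.
  move=> S /and3P[S0 ST ->]; rewrite andbT; apply/two_partitionsP; exists S, (~: S).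
  split=> //; last by rewrite setUCr.
    by apply: contra ST => /eqP SC; rewrite -[S]setCK SC setC0.
  by rewrite -subsets_disjoint.
rewrite mulr_sumr; apply: eq_bigr => P /andP[P2 prP].
have [A [B [A0 B0 dAB UAB PE]]] := two_partitionsP _ P2.
have BE : B = ~: A.
  apply/setP => x; rewrite inE; have := in_setT x; rewrite -UAB inE.
  by case: (boolP (x \in A)) => [xA _|//]; rewrite (disjointFr dAB xA).
have AT : A != setT by apply: contra B0 => /eqP AT; rewrite BE AT setCT.
have BT : B != setT by apply: contra A0 => /eqP BT; rewrite -[A]setCK -BE BT setCT.
rewrite (eq_bigr (fun=> g P)); last by move=> S /andP[_ /eqP ->].
rewrite sumr_const (eq_card (B := P)) => [|S].
  have : #|P| == 2%N by move: P2; rewrite inE => /andP[].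
  by move=> /eqP ->; rewrite mulr2n mulrDl mul1r.
apply/andP/idP => [[_ /eqP <-]|]; first by rewrite !inE eqxx.
rewrite PE !inE => /orP[]/eqP ->.
  by rewrite -BE -PE A0 AT prP eqxx.
by rewrite BE setCK setUC -BE -PE B0 BT prP eqxx.
Qed.

Lemma smooth_weightE (S : {set T}) : S != set0 ->
  smooth_weight E lambda [set S; ~: S] =
  (sp S (induced_edges E S) * sp (~: S) (induced_edges E (~: S)))%:R * weight S.
Proof.
move=> /set0Pn[x xS]; rewrite /smooth_weight.
have SS : S != ~: S by apply/eqP => /setP/(_ x); rewrite inE xS.
by rewrite sp_scoreE // imbE.
Qed.

Lemma same_partE (S : {set T}) u v :
  same_part [set S; ~: S] u v = ((u \in S) == (v \in S)).
Proof.
apply/existsP/eqP => [[A /and3P[]]|uv].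
  by rewrite !inE => /orP[]/eqP->; rewrite ?inE; [move=> -> ->|move=> /negbTE -> /negbTE ->].
case: (boolP (u \in S)) uv => [uS /esym vS|uS /esym vS]; [exists S|exists (~: S)];
  by rewrite !inE eqxx ?orbT ?uS ?vS.
Qed.

Lemma sum_smooth_weight (b : bool) u v :
  2 * \sum_(P in two_partitions T | same_part P u v == b) smooth_weight E lambda P =
  \sum_(x in forests (fun S => [&& S != set0, S != setT & ((u \in S) == (v \in S)) == b]))
    weight x.1.
Proof.
rewrite -(sum_ordered (fun P => same_part P u v == b)) sum_forests.
apply: eq_big => [S|S /and3P[S0 _ _]]; first by rewrite same_partE.
exact: smooth_weightE.
Qed.

Lemma weight_le (S S' W : {set T}) (a : nat) : (#|W| <= a)%N ->
  (forall x, x \notin W -> (x \in S') = (x \in S)) ->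
  weight S <= expR (lambda * a%:R) * weight S'.
Proof.
move=> Wa SS'; rewrite /weight -expRD ler_expR.
have le1 (A B : {set T}) : (forall x, x \notin W -> (x \in A) = (x \in B)) ->
    #|A|%:R <= #|B|%:R + a%:R :> R.
  move=> AB; rewrite -natrD ler_nat; apply: (@leq_trans #|B :|: W|).
    apply/subset_leq_card/subsetP => x xA; rewrite inE.
    by case: (boolP (x \in W)) => [_|xW]; rewrite ?orbT // -AB // xA.
  by apply: leq_trans (leq_card_setU _ _) _; rewrite leq_add2l.
have S1 := le1 _ _ SS'; have S2 := le1 _ _ (fun x xW => esym (SS' x xW)).
have C (A : {set T}) : #|A|%:R + #|~: A|%:R = #|T|%:R :> R by rewrite -natrD cardsC.
have CS := C S; have CS' := C S'.
rewrite -subr_ge0 opprK.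
have -> : lambda * a%:R - lambda * (`|#|S'|%:R - #|~: S'|%:R| / 2) +
    lambda * (`|#|S|%:R - #|~: S|%:R| / 2) =
  lambda * (a%:R - `|#|S'|%:R - #|~: S'|%:R| / 2 + `|#|S|%:R - #|~: S|%:R| / 2) :> R.
  by rewrite mulrDr mulrBr.
apply: mulr_ge0 => //.
have N1 := ler_norm (#|S|%:R - #|~: S|%:R : R).
have N2 := ler_norm (- (#|S|%:R - #|~: S|%:R) : R); rewrite normrN in N2.
suff : `|#|S'|%:R - #|~: S'|%:R| <= `|#|S|%:R - #|~: S|%:R| + 2 * a%:R :> R by lra.
by rewrite ler_norml; apply/andP; split; lra.
Qed.

Lemma card_fiber (X : {set {set T} * ({set {set T}} * {set {set T}})})
    (f : {set T} * ({set {set T}} * {set {set T}}) -> {set T} * ({set {set T}} * {set {set T}}))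
    (W : {set T}) (K : {set {set T}}) (a c : nat) :
  (#|W| <= a)%N -> (#|K| <= c)%N ->
  (forall x, x \in X -> [/\ (f x).1 :\: W = x.1 :\: W,
     (f x).2.1 :\: K = x.2.1 :\: K & (f x).2.2 :\: K = x.2.2 :\: K]) ->
  forall y, (#|[set x in X | f x == y]| <= 2 ^ a * (2 ^ c * 2 ^ c))%N.
Proof.
move=> Wa Kc fX y.
pose code (x : {set T} * ({set {set T}} * {set {set T}})) :=
  (x.1 :&: W, (x.2.1 :&: K, x.2.2 :&: K)).
have code_inj : {in [set x in X | f x == y] &, injective code}.
  move=> x x'; rewrite !inE => /andP[xX /eqP fx] /andP[xX' /eqP fx'].
  have [e1 e2 e3] := fX x xX; have [e1' e2' e3'] := fX x' xX'.
  rewrite fx in e1 e2 e3; rewrite fx' in e1' e2' e3'.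
  case: x x' {fx fx' xX xX'} e1 e2 e3 e1' e2' e3' => [S [F1 F2]] [S' [F1' F2']] /=.
  move=> e1 e2 e3 e1' e2' e3' [d1 d2 d3].
  by rewrite -(setID S W) -(setID F1 K) -(setID F2 K) d1 d2 d3 -e1 -e2 -e3 e1' e2' e3' !setID.
rewrite -(card_in_imset code_inj).
apply: (@leq_trans #|setX (powerset W) (setX (powerset K) (powerset K))|).
  apply/subset_leq_card/subsetP => z /imsetP[x _ ->].
  by rewrite !inE /= !subsetIr.
by rewrite !cardsX !card_powerset !leq_mul // leq_exp2l.
Qed.

End Counting.

(** * The grid *)

Lemma grid_adj_sym m n : symmetric (@grid_adj m n).
Proof.
move=> u v; rewrite /grid_adj [v.1 == _]eq_sym [v.2 == _]eq_sym.
by rewrite [(v.2.+1 == _) || _]orbC [(v.1.+1 == _) || _]orbC.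
Qed.

Lemma grid_edgeE m n (a c : 'I_m * 'I_n) : ([set a; c] \in grid_edges m n) = grid_adj a c.
Proof.
apply/idP/idP => [|ac]; last first.
  by rewrite inE; apply/existsP; exists a; apply/existsP; exists c; rewrite ac eqxx.
rewrite inE => /existsP[u /existsP[v /andP[uv /eqP ac]]].
have: a \in [set u; v] by rewrite -ac !inE eqxx.
have: c \in [set u; v] by rewrite -ac !inE eqxx orbT.
have: u \in [set a; c] by rewrite ac !inE eqxx.
have: v \in [set a; c] by rewrite ac !inE eqxx orbT.
rewrite !inE => va ua /orP[]/eqP cE /orP[]/eqP aE; subst; move: va ua uv;
  rewrite ?orbb //; try by rewrite grid_adj_sym.
  by move=> /eqP ->.
by move=> _ /eqP ->.
Qed.

Lemma grid_adjP m n (a c : 'I_m * 'I_n) : grid_adj a c <->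
  (a.1 = c.1 :> nat /\ (a.2.+1 = c.2 \/ c.2.+1 = a.2)) \/
  (a.2 = c.2 :> nat /\ (a.1.+1 = c.1 \/ c.1.+1 = a.1)).
Proof.
rewrite /grid_adj; split.
  move=> /orP[]/andP[/eqP -> /orP[]/eqP ->]; [left|left|right|right]; split=> //;
    by [left|right].
move=> [[/val_inj -> h]|[/val_inj -> h]]; apply/orP; [left|right]; rewrite eqxx /=;
  by apply/orP; case: h => ->; rewrite eqxx; [left|right].
Qed.

Section GridForests.
Variables (R : realType) (lambda : R).
Hypothesis lambda_ge0 : 0 <= lambda.

Lemma separated_le_same (k l m n : nat) (u v : 'I_m * 'I_n) :
  (90 <= k)%N -> (90 * 90 <= l)%N ->
  (10 <= m)%N -> (10 <= n)%N -> [set u; v] \in grid_edges m n ->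
  \sum_(P in two_partitions _ | same_part P u v == false)
    smooth_weight (grid_edges m n) lambda P <=
  expR (lambda * k%:R) * (2 ^ k * (2 ^ l * 2 ^ l))%N%:R *
  \sum_(P in two_partitions _ | same_part P u v == true)
    smooth_weight (grid_edges m n) lambda P.
Proof.
move=> k90 l90 m10 n10; rewrite grid_edgeE => /grid_adjP uv.
set E := grid_edges m n.
have [ax [fl [sw]]] := coord_exists m n _ _ _ _ (elimT ssrnat.leP m10) (elimT ssrnat.leP n10)
  (elimT ssrnat.ltP (ltn_ord u.1)) (elimT ssrnat.ltP (ltn_ord u.2))
  (elimT ssrnat.ltP (ltn_ord v.1)) (elimT ssrnat.ltP (ltn_ord v.2)) uv.
pose o := if sw then v else u; pose w := if sw then u else v.
have -> : (if sw then nat_of_ord v.1 else u.1) = o.1 by rewrite /o; case: (sw).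
have -> : (if sw then nat_of_ord v.2 else u.2) = o.2 by rewrite /o; case: (sw).
have -> : (if sw then nat_of_ord u.1 else v.1) = w.1 by rewrite /w; case: (sw).
have -> : (if sw then nat_of_ord u.2 else v.2) = w.2 by rewrite /w; case: (sw).
cbv zeta; set b := coord_bounds _ _ _ _ _ _ => -[tau_w b_roomy].
pose tau (a : 'I_m * 'I_n) : cell := coord ax fl o.1 o.2 a.1 a.2.
have tau_inj : injective tau.
  by move=> [a1 a2] [c1 c2] /coord_inj[/= /val_inj -> /val_inj ->].
have tau_in a : in_bounds b (tau a) = true by apply: coord_in_bounds; apply/ssrnat.ltP.
have tau_surj p : in_bounds b p = true -> exists a, tau a = p.
  case/coord_surj; try exact/ssrnat.ltP.
  by move=> i [j [/ssrnat.ltP im [/ssrnat.ltP jn <-]]]; exists (Ordinal im, Ordinal jn).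
have E_adj a c : [set a; c] \in E <-> adjc (tau a) (tau c).
  rewrite grid_edgeE; apply: (iff_trans (grid_adjP a c)).
  exact: iff_sym (coord_adj ax fl o.1 o.2 a.1 a.2 c.1 c.2).
have E_pair (e : {set 'I_m * 'I_n}) : e \in E -> exists a c, e = [set a; c].
  by rewrite inE => /existsP[a /existsP[c /andP[_ /eqP ->]]]; exists a, c.
pose W := flip_set tau; pose K := local_edges E tau.
pose sep (S : {set 'I_m * 'I_n}) :=
  [&& S != set0, S != setT & ((u \in S) == (v \in S)) == false].
pose same (S : {set 'I_m * 'I_n}) :=
  [&& S != set0, S != setT & ((u \in S) == (v \in S)) == true].
have ex (x : {set 'I_m * 'I_n} * ({set {set 'I_m * 'I_n}} * {set {set 'I_m * 'I_n}})) :
    exists y, x \in forests E sep -> [/\ y \in forests E same,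
      (forall a, a \notin W -> (a \in y.1) = (a \in x.1)),
      y.2.1 :\: K = x.2.1 :\: K & y.2.2 :\: K = x.2.2 :\: K].
  case: (boolP (x \in forests E sep)) => [|_]; last by exists x.
  case: x => [S [F1 F2]]; rewrite inE => /andP[/and3P[_ _ /eqP sepS]] /=.
  rewrite in_setX !inE => /andP[/asboolP t1 /asboolP t2].
  have ow : (o \in S) != (w \in S).
    by move: sepS; rewrite /o /w; case: (sw); rewrite 1?eq_sym => ->.
  have [S' [F1' [F2' [ow' t1' t2' SS' [k1 k2]]]]] :=
    tree_surgery tau_inj tau_in tau_surj E_adj E_pair b_roomy
      (coord_origin _ _ _ _) tau_w ow t1 t2.
  exists (S', (F1', F2')) => _; split=> //=.
  rewrite inE in_setX !inE /=; apply/andP; split; last by apply/andP; split; apply/asboolP.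
  apply/and3P; split.
  - by case: t1' => _ [].
  - by case: t2' => _ [S'C _] _; apply: contra S'C => /eqP ->; rewrite setCT.
  - by move: ow'; rewrite /o /w; case: (sw) => ->; rewrite eqxx.
have [f fP] := choice ex.
suff H : \sum_(x in forests E sep) weight lambda x.1 <=
    expR (lambda * k%:R) * (2 ^ k * (2 ^ l * 2 ^ l))%N%:R *
    \sum_(x in forests E same) weight lambda x.1.
  have two0 : (0 : R) < 2 by [].
  by rewrite -(ler_pM2l two0) [X in _ <= X]mulrCA !sum_smooth_weight.
apply: (ler_sum_fibers (f := f)).
- move=> x xX; have [fY SS' _ _] := fP x xX; split=> //.
  apply: (weight_le lambda_ge0 (W := W)) SS'.
  exact: leq_trans (card_flip_set tau_inj) k90.
- by move=> y; apply: expR_ge0.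
- exact: expR_ge0.
- apply: (card_fiber (W := W) (K := K)).
  + exact: leq_trans (card_flip_set tau_inj) k90.
  + exact: leq_trans (card_local_edges tau_inj E_pair) l90.
  + move=> x xX; have [_ SS' k1 k2] := fP x xX; split=> //.
    by apply/setP => z; rewrite !in_setD; case: (boolP (z \in W)) => //= zW; apply: SS'.
Qed.

Lemma connect_iter (T : finType) (e : rel T) (g : nat -> T) (k d : nat) :
  (forall i, (k <= i < k + d)%N -> e (g i) (g i.+1)) -> connect e (g k) (g (k + d)%N).
Proof.
elim: d => [|d IH] He; first by rewrite addn0.
apply: (@connect_trans _ _ (g (k + d)%N)).
  by apply: IH => i /andP[ki id]; apply: He; rewrite ki addnS ltnS ltnW.
by rewrite addnS; apply/connect1/He; rewrite leq_addr addnS leqnn.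
Qed.

Lemma rows_connected m n lo hi : (lo < hi)%N -> (hi <= m.+1)%N ->
  let S := [set a : 'I_m.+1 * 'I_n.+1 | lo <= a.1 < hi]%N in
  connected_graph S (induced_edges (grid_edges m.+1 n.+1) S).
Proof.
move=> lh hm S; have lm := leq_trans lh hm.
pose o : 'I_m.+1 * 'I_n.+1 := (inord lo, inord 0).
have oS : o \in S by rewrite inE /= inordK // leqnn lh.
split; first by apply/set0Pn; exists o.
set e := edge_rel _.
have eI a c : a \in S -> c \in S -> grid_adj a c -> e a c.
  move=> aS cS ac; rewrite /e /edge_rel inE grid_edgeE ac /=.
  by apply/subsetP => x; rewrite in_set2 => /orP[]/eqP->.
suff co a : a \in S -> connect e o a.
  move=> x y xS yS; apply: (@connect_trans _ _ o); last exact: co.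
  by rewrite connect_edge_sym co.
case: a => i j; rewrite inE /= => /andP[li ih].
apply: (@connect_trans _ _ (inord lo, j)).
  have -> : j = inord (0 + j) by rewrite add0n inord_val.
  apply: (connect_iter (g := fun k => (inord lo, inord k))) => k /andP[_ kj].
  have kn : (k.+1 < n.+1)%N by apply: leq_ltn_trans kj _; rewrite add0n.
  apply: eI; rewrite ?inE /= ?inordK ?leqnn //.
  by rewrite /grid_adj /= eqxx !inordK ?eqxx // ltnW.
have -> : i = inord (lo + (i - lo)) by rewrite subnKC // inord_val.
apply: (connect_iter (g := fun k => (inord k, j))) => k; rewrite subnKC // => /andP[lk ki].
have km : (k.+1 < m.+1)%N by apply: leq_ltn_trans ki _.
have kh : (k.+1 < hi)%N by apply: leq_ltn_trans ki _.
apply: eI; rewrite ?inE /= ?inordK ?lk ?(ltnW kh) ?(ltnW km) ?(leqW lk) ?kh //.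
by rewrite /grid_adj /= eqxx !inordK ?eqxx ?orbT // ltnW.
Qed.

Lemma sp_gt0 (T : finType) (V : {set T}) E : connected_graph V E -> (0 < sp V E)%N.
Proof.
move=> cV; have ac0 : acyclic_graph (set0 : {set {set T}}).
  by move=> [[|x [|y s]] [] // _ /andP[/= /andP[]]]; rewrite /edge_rel inE.
have [F tF _] := spanning_tree_extends (sub0set E) ac0 cV.
by apply/card_gt0P; exists F; rewrite inE; apply/asboolP.
Qed.

Lemma smooth_weight_ge0 (T : finType) (E : {set {set T}}) P : 0 <= smooth_weight E lambda P.
Proof. by rewrite mulr_ge0 ?expR_ge0. Qed.

Lemma sum_smooth_weight_gt0 m n :
  0 < \sum_(P in two_partitions ('I_m.+2 * 'I_n.+1)%type)
        smooth_weight (grid_edges m.+2 n.+1) lambda P.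
Proof.
pose S := [set a : 'I_m.+2 * 'I_n.+1 | 0 <= a.1 < 1]%N.
have SC : ~: S = [set a : 'I_m.+2 * 'I_n.+1 | 1 <= a.1 < m.+2]%N.
  by apply/setP => a; rewrite !inE ltn_ord andbT -leqNgt.
have cS : connected_graph S (induced_edges (grid_edges m.+2 n.+1) S).
  exact: rows_connected.
have cC : connected_graph (~: S) (induced_edges (grid_edges m.+2 n.+1) (~: S)).
  by rewrite SC; apply: rows_connected.
have P2 : [set S; ~: S] \in two_partitions ('I_m.+2 * 'I_n.+1)%type.
  apply/two_partitionsP; exists S, (~: S); split=> //.
  - by case: cS.
  - by case: cC.
  - by rewrite -subsets_disjoint.
  - by rewrite setUCr.
rewrite (bigD1 [set S; ~: S]) //=; apply: ltr_pwDl; last first.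
  by apply: sumr_ge0 => P _; apply: smooth_weight_ge0.
rewrite smooth_weightE; last by case: cS.
by rewrite mulr_gt0 ?expR_gt0 // ltr0n muln_gt0 !sp_gt0.
Qed.

End GridForests.

Theorem theorem1 (R : realType) (lambda : R) (lambda_ge0 : 0 <= lambda) :
  exists (f : R) (n0 : nat), 0 < f /\
    forall m n : nat, (n0 <= m)%N -> (n0 <= n)%N ->
      fair (grid_edges m n) (smooth_distribution (grid_edges m n) lambda) f.
Proof.
have [k [l [k90 l90]]] : exists k l, (90 <= k)%N /\ (90 * 90 <= l)%N.
  by exists 90%N, (90 * 90)%N.
pose C : R := expR (lambda * k%:R) * (2 ^ k * (2 ^ l * 2 ^ l))%N%:R.
have C0 : 0 <= C by rewrite mulr_ge0 ?expR_ge0.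
have C1 : 0 < 1 + C by apply: ltr_pwDl.
exists (1 + C)^-1, 10; split; first by rewrite invr_gt0.
move=> m n m10 n10 u v uv.
have le_sep := separated_le_same lambda_ge0 k90 l90 m10 n10 uv; rewrite -/C in le_sep.
set Z := \sum_(P in two_partitions _) smooth_weight (grid_edges m n) lambda P.
have Z0 : 0 < Z.
  by rewrite /Z; move: m n m10 n10 {u v uv le_sep Z} => [|[|m]] [|n] // _ _;
    apply: sum_smooth_weight_gt0.
rewrite /smooth_distribution -mulr_suml -/Z ler_pdivlMr // mulrC ler_pdivrMr //.
rewrite /Z (bigID (fun P => same_part P u v)) /= mulrDr mulr1 lerD2l mulrC.
under eq_bigl => P do rewrite -eqbF_neg.
apply: le_trans le_sep _; rewrite le_eqVlt; apply/orP; left; apply/eqP; congr (C * _).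
by apply: eq_bigl => P; rewrite eqb_id.
Qed.
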